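(* Consider the steady-state stochastic fountain (defined in the context) with birth rate $\lambda>0$, domain $\Omega$ with detectors $D_1,\dots,D_J\subset\partial\Omega$, admissible source distribution $\phi(x,v)$, and particles moving according to a piecewise-linear Markov process (PLMP). Then, for each $j$, the steady-state exit process $\{N_j(T)\}_{T\ge0}$, $$N_j(T)=\sum_{n=1}^\infty\mathbf{1}_{[0,T]}(\tau_n)\,\mathbf{1}_{D_j}(X_n(\tau_n)),$$ is a Poisson process with rate $\lambda p_j(\phi)$, where $p_j(\phi)=\mathbb{P}^\phi(X(\tau)\in D_j)$ is the probability that a single PLMP particle started at time $0$ with $(X(0),V(0))\sim\phi$ exits $\Omega$ through $D_j$.
   Context: Domain: $\Omega\subset\mathbb{R}^d$ is an open domain with compact closure and smooth boundary $\partial\Omega$. For a location process $X$ started at time $T_0$, its exit time is $\tau:=\inf\{t>T_0: X(t)\notin\Omega\}$; with $T_0=0$ it is assumed that $\sup_{x\in\Omega}\mathbb{E}^x[\tau]<\infty$ (expected exit time bounded uniformly over starting points in $\Omega$). Detectors: $D_1,\dots,D_J$ are pairwise disjoint connected subsets of $\partial\Omega$. PLMP: $\mathcal{V}$ is the space of velocities with integration measure $\mathrm{d}v$ (e.g. a circle of radius $c$ with its surface measure); $\sigma_s(x,v)\ge0$ is the velocity transition rate; $K(v,\cdot,x)$ is, for each $(v,x)$, a probability density on $\mathcal{V}$ for the new velocity after a jump from velocity $v$ at position $x$. Started at $(X_0,V_0)$ at time $J_0=0$, the first jump time $J_1$ satisfies $\mathbb{P}(J_1>t\mid X_0=x,V_0=v)=\exp(-\int_0^t\sigma_s(x+vt',v)\,\mathrm{d}t')$;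 given $(X(J_1),V_0)=(x,v)$, the new velocity $V_1$ has density $K(v,\cdot,x)$; subsequent jump times and velocities are defined similarly; and $V(t)=V_i$, $X(t)=X(J_i)+(t-J_i)V_i$ for $t\in[J_i,J_{i+1})$. The process is time-homogeneous, so a start at another time is a time shift. Admissible source distribution (PLMP case): $\phi(x,v)$ is a joint probability density on $\mathbb{R}^d\times\mathcal{V}$ of initial position and velocity which in the position variable is compactly supported on a ball of radius $\beta>0$ centered at some $\theta$ (the ball contained in $\Omega$) and radially symmetric about $\theta$. Steady-state stochastic fountain: let $A$ be a homogeneous Poisson point process on $\mathbb{R}$ with intensity $\lambda$ times Lebesgue measure (the birth process), and let $\{T_n\}_{n=1}^\infty$ be an enumeration of its points. For each $n$, $\{(X_n(t),V_n(t))\}_{t\ge T_n}$ is a PLMP started at time $T_n$ with velocity space $\mathcal{V}$, velocity transition rate $\sigma_s(x,v)$ and jump density $K(v,\cdot,x)$ (motion at constant velocity between jumps, with jumps from velocity $v$ at position $x$ occurring at rate $\sigma_s(x,v)$ to a new velocity with density $K(v,\cdot,x)$), and with $(X_n(T_n),V_n(T_n))\sim\phi$; the initial conditions are i.i.d. and the particles do not interact (the time-shifted paths $t\mapsto(X_n(T_n+t),V_n(T_n+t))$ are i.i.d. and independent of the birth process). $\tau_n$ is the exit time of $X_n$ from $\Omega$ (in absolute time). $\mathbb{P}^\phi$ denotes probability with $(X(0),V(0))\sim\phi$. $\mathbf{1}_A$ is the indicator function of $A$. *)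

(* Defs.v *)
From HB Require Import structures.
From mathcomp Require Import all_boot all_order all_algebra.
From mathcomp Require Import all_classical all_reals all_analysis.
From mathcomp Require Import measurable_realfun.

Set Implicit Arguments.
Unset Strict Implicit.
Unset Printing Implicit Defensive.

Import Order.TTheory GRing.Theory Num.Theory.
Import numFieldNormedType.Exports.

Local Open Scope classical_set_scope.
Local Open Scope ring_scope.

(* The sigma-algebra on R^n generated by the coordinates, i.e. the Borel one. *)
Section measurable_rV.
Context {R : realType} (n : nat).

Let coors : 'I_n -> 'rV[R]_n -> R := fun i x => x ord0 i.

Let rV_set0 : g_sigma_preimage coors set0.
Proof. exact: sigma_algebra0. Qed.

Let rV_setC A : g_sigma_preimage coors A -> g_sigma_preimage coors (~` A).
Proof. exact: sigma_algebraC. Qed.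

Let rV_bigcup (F : _^nat) : (forall i, g_sigma_preimage coors (F i)) ->
  g_sigma_preimage coors (\bigcup_i (F i)).
Proof. exact: sigma_algebra_bigcup. Qed.

HB.instance Definition _ := @isMeasurable.Build default_measure_display
  'rV[R]_n (g_sigma_preimage coors) rV_set0 rV_setC rV_bigcup.

End measurable_rV.

Section lebesgue_rV.
Context {R : realType}.

Definition rV_snoc n (p : 'rV[R]_n * R) : 'rV[R]_n.+1 :=
  \row_i (if unlift ord_max i is Some j then p.1 ord0 j else p.2).

(* R^n.+1 is identified with R^n * R through [rV_snoc]. *)
Fixpoint lebesgue_rV n : set 'rV[R]_n -> \bar R :=
  match n with
  | 0 => \d_(0 : 'rV[R]_0)
  | n.+1 => fun A =>
      (lebesgue_rV (n := n) \x (lebesgue_measure : set R -> \bar R))%E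
        (@rV_snoc n @^-1` A)
  end.
Arguments lebesgue_rV n A : clear implicits.

Lemma measurable_coord n (i : 'I_n) :
  measurable_fun [set: 'rV[R]_n] (fun x => x ord0 i).
Proof.
move=> _ B mB; rewrite setTI; apply: sub_sigma_algebra => /=.
rewrite -bigcup_seq/=; exists i => /=; first by rewrite mem_index_enum.
by exists B => //; rewrite setTI.
Qed.

Lemma measurable_rV_snoc n : measurable_fun [set: 'rV[R]_n * R] (@rV_snoc n).
Proof.
have mf (i : 'I_n.+1) :
    measurable_fun [set: 'rV[R]_n * R] (fun p => rV_snoc p ord0 i).
  case: (unliftP ord_max i) => [j|] ->.
    rewrite (_ : (fun p => _) = (fun p : 'rV[R]_n * R => p.1 ord0 j)).
      apply: (@measurableT_comp _ _ _ _ _ _ (fun x : 'rV[R]_n => x ord0 j)).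
        exact: measurable_coord.
      exact: measurable_fst.
    by apply/funext => p; rewrite mxE liftK.
  rewrite (_ : (fun p => _) = snd); first exact: measurable_snd.
  by apply/funext => p; rewrite mxE unlift_none.
move=> _; rewrite -[X in forall Y, X Y -> _]/(g_sigma_preimage _).
suff : g_sigma_preimage (fun (i : 'I_n.+1) (p : 'rV[R]_n * R) =>
    rV_snoc p ord0 i) `<=` measurable.
  move=> h Y mY; apply: h.
  rewrite (g_sigma_preimage_comp (fun i (x : 'rV[R]_n.+1) => x ord0 i)).
  by exists Y.
apply: smallest_sub; first exact: sigma_algebra_measurable.
rewrite -bigcup_seq; apply: bigcup_sub => i _.
by move=> A [B mB <-]; exact: mf.
Qed.

Lemma lebesgue_rV_is_measure n :
  [/\ lebesgue_rV n set0 = 0%E,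
      forall A, (0 <= lebesgue_rV n A)%E &
      semi_sigma_additive (lebesgue_rV n)].
Proof.
elim: n => [|n [m0 mge0 msa]].
  by split=> [|A|]; [exact: measure0|exact: measure_ge0|
                     exact: measure_semi_sigma_additive].
pose m : {measure set 'rV[R]_n -> \bar R} :=
  HB.pack (lebesgue_rV n) (isMeasure.Build _ _ _ _ m0 mge0 msa).
pose lebR : {sigma_finite_measure set (measurableTypeR R) -> \bar R} :=
  @lebesgue_measure R.
pose m' : {measure set ('rV[R]_n * measurableTypeR R) -> \bar R} :=
  (m \x lebR)%E.
have ms := @measurable_rV_snoc n.
split=> [|A|F mF tF mUF].
- by rewrite /= preimage_set0; exact: (measure0 m').
- exact: (measure_ge0 m').
- have := @measure_semi_sigma_additive _ _ _ m'
    (fun k => @rV_snoc n @^-1` F k).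
  rewrite -preimage_bigcup; apply.
  + by move=> k; rewrite -[X in measurable X]setTI; exact: ms.
  + apply/trivIsetP => i j _ _ ij; rewrite -preimage_setI.
    by move/trivIsetP : tF => /(_ _ _ _ _ ij) ->//; rewrite preimage_set0.
  + by rewrite -[X in measurable X]setTI; exact: ms.
Qed.

HB.instance Definition _ n := isMeasure.Build _ _ _ (lebesgue_rV n)
  (let: And3 h _ _ := lebesgue_rV_is_measure n in h)
  (let: And3 _ h _ := lebesgue_rV_is_measure n in h)
  (let: And3 _ _ h := lebesgue_rV_is_measure n in h).

Lemma measurable_box n (a b : 'rV[R]_n) :
  measurable [set x : 'rV[R]_n | forall i, a ord0 i <= x ord0 i <= b ord0 i].
Proof.
rewrite (_ : [set x | _] = \bigcap_(i in [set: 'I_n])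
    ((fun x : 'rV[R]_n => x ord0 i) @^-1` `[a ord0 i, b ord0 i])); last first.
  apply/seteqP; split => x /= h i; first by move=> _ /=; rewrite in_itv /= h.
  by have := h i I; rewrite /= in_itv.
apply: fin_bigcap_measurable => // i _.
by rewrite -[X in measurable X]setTI; apply: measurable_coord.
Qed.

Lemma lebesgue_rV_box n (a b : 'rV[R]_n) : (forall i, a ord0 i <= b ord0 i) ->
  lebesgue_rV n [set x : 'rV[R]_n | forall i, a ord0 i <= x ord0 i <= b ord0 i] =
  (\prod_i (b ord0 i - a ord0 i))%:E.
Proof.
elim: n a b => [|n IH] a b ab.
  by rewrite big_ord0 /= diracE mem_set//= => -[].
pose m : {measure set 'rV[R]_n -> \bar R} := lebesgue_rV n.
pose lebR : {sigma_finite_measure set (measurableTypeR R) -> \bar R} :=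
  @lebesgue_measure R.
pose low (x : 'rV[R]_n.+1) : 'rV[R]_n := \row_i x ord0 (lift ord_max i).
have lowE x i : low x ord0 i = x ord0 (lift ord_max i) by rewrite mxE.
have -> : lebesgue_rV n.+1
    [set x | forall i, a ord0 i <= x ord0 i <= b ord0 i] =
  (m \x lebR)%E ([set x : 'rV[R]_n | forall i, low a ord0 i <= x ord0 i <= low b ord0 i] `*`
                 `[a ord0 ord_max, b ord0 ord_max]).
  rewrite /=; congr (_ _); apply/seteqP; split=> -[x y] /=.
    move=> h; split=> [i|].
      by have := h (lift ord_max i); rewrite !lowE mxE liftK.
    by have := h ord_max; rewrite in_itv /= mxE unlift_none.
  move=> [h1 h2] i; case: (unliftP ord_max i) => [j|] ->.
    by have := h1 j; rewrite !lowE mxE liftK.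
  by move: h2; rewrite in_itv /= mxE unlift_none.
rewrite product_measure1E//; last exact: measurable_box.
rewrite [X in (X * _)%E](IH (low a) (low b)); last by move=> i; rewrite !lowE.
have -> : lebR `[a ord0 ord_max, b ord0 ord_max]%classic =
          (b ord0 ord_max - a ord0 ord_max)%:E.
  rewrite [LHS](@lebesgue_measure_itv R) /= lte_fin.
  by case: ltgtP (ab ord_max) => // -> _; rewrite subrr.
rewrite -EFinM big_ord_recr /=; congr (_ * _)%:E.
apply: eq_bigr => i _; rewrite !lowE.
by have -> : lift ord_max i = widen_ord (leqnSn n) i
  by apply/val_inj; rewrite /= /bump leqNgt ltn_ord.
Qed.

End lebesgue_rV.
Arguments lebesgue_rV {R} n A.

Section geometry.
Context {R : realType} {d : nat}.
Local Notation E := 'rV[R]_d.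

(* The library norm on matrices is the sup norm. *)
Definition enorm (x : E) : R := Num.sqrt (\sum_i x ord0 i ^+ 2).

Definition boundary (A : set E) : set E := closure A `\` interior A.

Definition partial (i : 'I_d) (f : E -> R) : E -> R :=
  fun x => 'D_(delta_mx ord0 i) f x.

Definition smooth_on (U : set E) (f : E -> R) : Prop :=
  forall (s : seq 'I_d) (x : E), U x ->
    {for x, continuous (foldr partial f s)} /\
    forall i, derivable (foldr partial f s) x (delta_mx ord0 i).

Definition smooth_boundary (Om : set E) : Prop :=
  forall p, boundary Om p ->
    exists (U : set E) (rho : E -> R),
      [/\ open U, U p, smooth_on U rho, (exists i, partial i rho p != 0) &
          forall x, U x ->
            (Om x <-> rho x < 0) /\ (boundary Om x <-> rho x = 0)].

Record smooth_bounded_domain (Om : set E) : Prop := {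
  domain_open : open Om;
  domain_nonempty : Om !=set0;
  domain_connected : connected Om;
  domain_compact_closure : compact (closure Om);
  domain_smooth_boundary : smooth_boundary Om }.

(* Measurability is needed for the exit probabilities to make sense: connected
   subsets of the boundary need not be Borel sets. *)
Record detectors (Om : set E) (J : nat) (D : 'I_J -> set E) : Prop := {
  detector_boundary : forall j, D j `<=` boundary Om;
  detector_connected : forall j, connected (D j);
  detector_disjoint : forall i j, i != j -> D i `&` D j = set0;
  detector_measurable : forall j, measurable (D j) }.

(* The infimum is +oo if the path never leaves [Om]. *)
Definition exit_time (Om : set E) (t0 : R) (x : R -> E) : \bar R :=
  ereal_inf [set t%:E | t in [set t | t0 < t /\ ~ Om (x t)]].

End geometry.

Section independence.
Context {R : realType} {dW} {W : measurableType dW} (P : probability W R).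

Definition generated_by {dT} {T : measurableType dT} (Y : W -> T) :
    set (set W) :=
  preimage_set_system setT Y measurable.

Definition mutually_independent (I : eqType) (F : I -> set (set W)) : Prop :=
  forall (s : seq I) (A : I -> set W), uniq s ->
    (forall i, i \in s -> F i (A i)) ->
    P (\bigcap_(i in [set` s]) A i) = (\prod_(i <- s) P (A i))%E.

(* On the event [G], the conditional probability of [A] given [Y] is [q]; it is
   used with [G] and [q] that are functions of [Y]. *)
Definition cond_prob_on {dT} {T : measurableType dT} (Y : W -> T)
    (G A : set W) (q : W -> \bar R) : Prop :=
  forall B, measurable B ->
    P (Y @^-1` B `&` G `&` A) = (\int[P]_(w in Y @^-1` B `&` G) q w)%E.

(* The second (dummy) argument of [poisson_prob] is irrelevant. With parameter
   0 this is the Dirac mass at 0. *)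
Definition poisson_mass (r : R) (k : nat) : \bar R := poisson_prob r 0%N [set k].

Definition point_count (T : nat -> W -> R) (B : set R) (w : W) : \bar R :=
  (\sum_(n <oo) (\1_B (T n w))%:E)%E.

(* [T] enumerates the points of a homogeneous Poisson point process on the real
   line of intensity [lam]. *)
Record homogeneous_ppp (lam : R) (T : nat -> W -> R) : Prop := {
  ppp_measurable : forall n, measurable_fun setT (T n);
  ppp_poisson : forall B : set R, measurable B -> forall k : nat,
    (lebesgue_measure B < +oo)%E ->
    P [set w | point_count T B w = k%:R%:E] =
    poisson_mass (lam * fine (lebesgue_measure B)) k;
  ppp_independent : forall (m : nat) (B : 'I_m -> set R),
    (forall i, measurable (B i)) -> trivIset setT B ->
    mutually_independent (fun i => generated_by (point_count T (B i))) }.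

(* A counting process may take the value +oo on a null set. *)
Record poisson_process (rate : R) (N : R -> W -> \bar R) : Prop := {
  poisson_measurable : forall t, 0 <= t -> measurable_fun setT (N t);
  poisson_paths : {ae P, forall w,
    [/\ N 0 w = 0%E,
        forall t, 0 <= t -> exists k : nat, N t w = k%:R%:E,
        forall s t, 0 <= s -> s <= t -> (N s w <= N t w)%E &
        forall t, 0 <= t -> (fun s => N s w) @ t^'+ --> N t w]};
  poisson_increments : forall s t (k : nat), 0 <= s -> s <= t ->
    P [set w | (N t w - N s w)%E = k%:R%:E] = poisson_mass (rate * (t - s)) k;
  poisson_independent : forall (m : nat) (t : nat -> R), 0 <= t 0%N ->
    (forall i, t i <= t i.+1) ->
    mutually_independent
      (fun i : 'I_m => generated_by (fun w => N (t i.+1) w - N (t i) w)%E) }.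

End independence.

Section plmp.
Context {R : realType} {d : nat}.
Local Notation E := 'rV[R]_d.
Variables (Vs : set E) (nu : {sigma_finite_measure set E -> \bar R}).
Variables (sigma_s : E -> E -> R) (K : E -> E -> E -> R).

(* [nu] is the measure dv on the set [Vs] of velocities, [sigma_s x v] the
   transition rate and [K v w x] the density at [w] of the velocity after a
   jump from velocity [v] at position [x]. *)
Record plmp_coefficients : Prop := {
  velocities_measurable : measurable Vs;
  rate_measurable : measurable_fun (setT `*` Vs)
    (fun z : E * E => sigma_s z.1 z.2);
  rate_ge0 : forall x v, Vs v -> 0 <= sigma_s x v;
  kernel_measurable : measurable_fun (Vs `*` Vs `*` setT)
    (fun z : E * E * E => K z.1.1 z.1.2 z.2);
  kernel_ge0 : forall v w x, Vs v -> Vs w -> 0 <= K v w x;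
  kernel_density : forall v x, Vs v ->
    (\int[nu]_(w in Vs) (K v w x)%:E = 1)%E }.

Section process.
Context {dW} {W : measurableType dW} (P : probability W R).

(* [J n] is the n-th jump time (+oo when there are fewer than n jumps) and
   [U n] the velocity between [J n] and [J n.+1].
   The history is the initial position and the jump times and velocities up to
   the n-th jump. *)
Definition plmp_history (X : R -> W -> E) (J : nat -> W -> \bar R)
    (U : nat -> W -> E) (n : nat) (w : W) : E * n.+1.-tuple (\bar R * E) :=
  (X 0 w, [tuple (J i w, U i w) | i < n.+1]).

(* Every trajectory is defined for all t >= 0: the jump times do not accumulate.
   The last two clauses give the conditional laws of the next jump time and of
   the next velocity given the whole past, whence the Markov property. *)
Record plmp_with_jumps (X V : R -> W -> E) (J : nat -> W -> \bar R)
    (U : nat -> W -> E) : Prop := {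
  plmp_measurable_init : measurable_fun setT (X 0);
  plmp_measurable_times : forall n, measurable_fun setT (J n);
  plmp_measurable_velocities : forall n, measurable_fun setT (U n);
  plmp_velocities : forall n w, Vs (U n w);
  plmp_time0 : forall w, J 0%N w = 0%E;
  plmp_times_ndecr : forall n w, (J n w <= J n.+1 w)%E;
  plmp_no_explosion : forall w (t : R), exists n, (t%:E < J n w)%E;
  plmp_velocity : forall n w t, (J n w <= t%:E < J n.+1 w)%E -> V t w = U n w;
  plmp_position : forall n w t, (J n w <= t%:E <= J n.+1 w)%E ->
    X t w = X (fine (J n w)) w + (t - fine (J n w)) *: U n w;
  plmp_jump_time : forall n (t : R), 0 <= t ->
    cond_prob_on P (plmp_history X J U n)
      [set w | (J n w < +oo)%E]
      [set w | (J n w + t%:E < J n.+1 w)%E]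
      (fun w => expeR (- \int[lebesgue_measure]_(s in `[0%R, t])
         (sigma_s (X (fine (J n w)) w + s *: U n w)%R (U n w))%:E)%E);
  plmp_jump_velocity : forall n (C : set E), measurable C ->
    cond_prob_on P (fun w => (plmp_history X J U n w, J n.+1 w))
      [set w | (J n.+1 w < +oo)%E]
      [set w | C (U n.+1 w)]
      (fun w => \int[nu]_(v in Vs `&` C)
         (K (U n w) v (X (fine (J n.+1 w)) w))%:E)%E }.

Definition plmp (X V : R -> W -> E) : Prop :=
  exists J U, plmp_with_jumps X V J U.

Definition starts_with_density (phi : E -> E -> R) (X V : R -> W -> E) : Prop :=
  forall C : set (E * E), measurable C ->
    P [set w | C (X 0 w, V 0 w)] =
    (\int[lebesgue_rV d \x nu]_(z in C `&` (setT `*` Vs)) (phi z.1 z.2)%:E)%E.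

Definition exit_probability (Om D : set E) (X : R -> W -> E) : \bar R :=
  P [set w | (exit_time Om 0 (X ^~ w) < +oo)%E /\
             D (X (fine (exit_time Om 0 (X ^~ w))) w)].

End process.

Record admissible_source (Om : set E) (phi : E -> E -> R) : Prop := {
  source_measurable : measurable_fun (setT `*` Vs)
    (fun z : E * E => phi z.1 z.2);
  source_ge0 : forall x v, Vs v -> 0 <= phi x v;
  source_density :
    (\int[lebesgue_rV d \x nu]_(z in setT `*` Vs) (phi z.1 z.2)%:E = 1)%E;
  source_ball : exists (theta : E) (beta : R),
    [/\ 0 < beta,
        [set x | enorm (x - theta) <= beta] `<=` Om,
        forall x v, Vs v -> beta < enorm (x - theta) -> phi x v = 0 &
        forall x y v, Vs v -> enorm (x - theta) = enorm (y - theta) ->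
          phi x v = phi y v] }.

(* The starting point of the Markov process is the pair (position, velocity). *)
Definition bounded_mean_exit_time (Om : set E) : Prop :=
  exists M : R, forall dW (W : measurableType dW) (P : probability W R)
    (X V : R -> W -> E) (x v : E),
    Om x -> Vs v -> plmp P X V -> (forall w, X 0 w = x /\ V 0 w = v) ->
    (\int[P]_w exit_time Om 0 (X ^~ w) <= M%:E)%E.

(* The product sigma-algebra on the paths indexed by the times t >= 0. *)
Definition path_events : set (set (R -> E * E)) :=
  <<s [set A | exists (t : R) (B : set (E * E)),
         [/\ 0 <= t, measurable B & A = [set p | B (p t)]]] >>.

Definition shifted_path {W : Type} (T : W -> R) (X V : R -> W -> E) (w : W) :
    R -> E * E :=
  fun t => (X (T w + t) w, V (T w + t) w).

(* Particle [n] is alive from time [T n] on: the values of [X n] and [V n]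
   before that time play no role. In the independence clause, [None] stands for
   the birth process and [Some n] for particle [n]. *)
Record stochastic_fountain {dW} {W : measurableType dW} (P : probability W R)
    (lam : R) (phi : E -> E -> R) (T : nat -> W -> R)
    (X V : nat -> R -> W -> E) : Prop := {
  fountain_births : homogeneous_ppp P lam T;
  fountain_plmp : forall n,
    plmp P (fun t w => X n (T n w + t) w) (fun t w => V n (T n w + t) w);
  fountain_source : forall n,
    starts_with_density P phi
      (fun t w => X n (T n w + t) w) (fun t w => V n (T n w + t) w);
  fountain_identically_distributed : forall n m A, path_events A ->
    P (shifted_path (T n) (X n) (V n) @^-1` A) =
    P (shifted_path (T m) (X m) (V m) @^-1` A);
  fountain_independent : mutually_independent P (fun o : option nat =>
    if o is Some n
    then preimage_set_system setT (shifted_path (T n) (X n) (V n)) path_events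
    else <<s \bigcup_n generated_by (T n) >>) }.

Definition exit_process {W : Type} (Om D : set E) (T : nat -> W -> R)
    (X : nat -> R -> W -> E) (t : R) (w : W) : \bar R :=
  (\sum_(n <oo)
     let tau := exit_time Om (T n w) (X n ^~ w) in
     (\1_[set s : \bar R | (0 <= s <= t%:E)%E] tau * \1_D (X n (fine tau) w))%:E)%E.

End plmp.

(* Main.v *)
(** Mark the n-th particle by its life time in [Om] if it leaves through the
    detector, and by [+oo] otherwise, so that the exit process counts the points
    [T n + mark n] falling in [[0, t]].  The marks are i.i.d. and independent of
    the Poisson process of births; averaging them out one after the other turns
    the joint Laplace transform of the numbers of displaced points in disjoint
    sets [B i] into the Laplace functional of the births at
    [psi(t) = - ln E(exp(- sum_i s_i 1_(t + mark in B i)))], which by Fubini and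
    translation invariance equals
    [prod_i exp(- lam p |B i| (1 - exp(- s_i)))] with [p = P(mark < +oo)].
    Uniqueness of power series coefficients, one variable at a time, then makes
    these numbers independent Poisson variables.

    That [p] may be computed with any PLMP started from the source rests on the
    uniqueness in law of such a process: the laws of the successive jump times
    and velocities agree by induction, the path up to time [t] is a function of
    the history on the event that exactly [n] jumps have occurred by time [t],
    and the mark is a measurable functional of the continuous path. *)

Require Import Defs.
From HB Require Import structures.
From mathcomp Require Import all_boot all_order all_algebra.
From mathcomp Require Import all_classical all_reals all_analysis.
From mathcomp Require Import measurable_realfun.
From mathcomp Require Import ring lra.

Set Implicit Arguments.
Unset Strict Implicit.
Unset Printing Implicit Defensive.

Import Order.TTheory GRing.Theory Num.Theory.
Import numFieldNormedType.Exports.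

Local Open Scope classical_set_scope.
Local Open Scope ring_scope.

(** The enumeration [T] comes in no particular order and the law of a single [T n] is not
    prescribed; only counts over all particles are. This is why the proof works with exp(- sum), a
    product over particles from which each independent mark can be integrated out alone.
    Independence is given for finite families only, so this is done for finitely many particles, and
    dominated convergence with bound 1 removes the truncation. A particle born arbitrarily long
    before time 0 may still leave after it, so that a displaced count could a priori be infinite.
    The value +oo is therefore carried along with transform 0, and is excluded almost surely only at
    the end, because Poisson masses sum to 1. The process that defines the exit probability lives on
    its own probability space. Nothing can be coupled: laws are compared as measures on path space,
    which forces the mark to be a measurable functional of the whole path and not merely a random
    variable. *)

(** * Measures with a density, and Fubini's theorem for weighted laws *)

Section weighted_measure.
Local Open Scope ereal_scope.
Context d (T : measurableType d) (R : realType).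
Variables (mu : {measure set T -> \bar R}) (f : T -> R).
Hypotheses (mf : measurable_fun setT f) (f0 : forall x, (0 <= f x)%R).

(** The measure with density [f]. The two proofs are arguments so that the measure structure
    declared below can be inferred from the term [weighted mu mf f0]. *)
Definition weighted of measurable_fun setT f & (forall x, (0 <= f x)%R) :=
  fun A => \int[mu]_(x in A) (f x)%:E.

Local Notation nu := (weighted mf f0).

Let weighted0 : nu set0 = 0.
Proof. exact: integral_set0. Qed.

Let weighted_ge0 A : 0 <= nu A.
Proof. by apply: integral_ge0 => x _; rewrite lee_fin. Qed.

Let weighted_sigma_additive : semi_sigma_additive nu.
Proof.
apply: semi_sigma_additive_nng_induced; first exact/measurable_EFinP.
by move=> x; rewrite lee_fin.
Qed.

HB.instance Definition _ := isMeasure.Build _ _ _ nu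
  weighted0 weighted_ge0 weighted_sigma_additive.

Import HBNNSimple.

(** Both sides are limits along an increasing sequence of simple functions, by monotone convergence;
    on a simple function each is a sum over its levels. *)
Lemma integral_weighted (h : T -> \bar R) :
  measurable_fun setT h -> (forall x, 0 <= h x) ->
  \int[nu]_x h x = \int[mu]_x (h x * (f x)%:E).
Proof.
move=> mh h0; pose h_ := nnsfun_approx measurableT mh.
have mh_ n : measurable_fun setT (fun x => (h_ n x)%:E).
  by exact/measurable_EFinP/measurable_funP.
have mfE : measurable_fun setT (EFin \o f) by exact/measurable_EFinP.
have ndh x : {homo (fun n => (h_ n x)%:E) : m n / (m <= n)%N >-> m <= n}.
  by move=> m n mn; rewrite lee_fin; exact/lefP/nd_nnsfun_approx.
have cvh x : (h_ n x)%:E @[n --> \oo] --> h x.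
  by apply: cvg_nnsfun_approx.
have -> : \int[mu]_x (h x * (f x)%:E) = limn (fun n => \int[mu]_x ((h_ n x)%:E * (f x)%:E)).
  rewrite -monotone_convergence//.
  - apply: eq_integral => x _; apply/esym/cvg_lim => //.
    exact: cvgeZr.
  - by move=> n; apply: emeasurable_funM.
  - by move=> n x _; rewrite mule_ge0// lee_fin.
  - by move=> x _ m n mn; rewrite lee_wpmul2r// ?lee_fin// -lee_fin ndh.
have -> : \int[nu]_x h x = limn (fun n => \int[nu]_x (h_ n x)%:E).
  rewrite -monotone_convergence//.
  - by apply: eq_integral => x _; apply/esym/cvg_lim.
  - by move=> n x _; rewrite lee_fin.
congr (limn _); apply/funext => n.
rewrite integralT_nnsfun sintegralE.
have E x : (h_ n x)%:E * (f x)%:E =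
    \sum_(r \in range (h_ n)) ((r * \1_(h_ n @^-1` [set r]) x)%:E * (f x)%:E).
  by rewrite [in LHS]fimfunE -fsumEFin// ge0_mule_fsuml// => r; exact: nnfun_muleindic_ge0.
under [RHS]eq_integral do rewrite E.
rewrite ge0_integral_fsum//; last 2 first.
- by move=> r; apply: emeasurable_funM => //; exact/measurable_EFinP/measurable_funM.
- by move=> r x _; rewrite mule_ge0// ?nnfun_muleindic_ge0// lee_fin.
apply: eq_fsbigr => r /set_mem [x _ <-].
under [RHS]eq_integral do rewrite EFinM -muleA.
rewrite ge0_integralZl//; last 3 first.
- by apply: emeasurable_funM => //; exact/measurable_EFinP.
- by move=> y _; rewrite mule_ge0// lee_fin.
- by rewrite lee_fin.
congr (_ * _); rewrite /= /weighted.
rewrite [LHS]integral_mkcond; apply: eq_integral => y _.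
by rewrite epatch_indic muleC.
Qed.

End weighted_measure.

Section weighted_independence.
Local Open Scope ereal_scope.
Context d d1 d2 (W : measurableType d) (S : measurableType d1)
  (U : measurableType d2) (R : realType).

(* Fubini's theorem for the law of [(T, M)] weighted by [Y]; in the application
   [Y'] is what [Y] becomes once the marks in it are averaged out. *)
Lemma integral_weighted_independence (P : probability W R)
    (Y Y' : W -> R) (T : W -> S) (M : W -> U) (pi : probability U R)
    (f : S * U -> \bar R) :
  measurable_fun setT Y -> (forall w, 0 <= Y w)%R ->
  measurable_fun setT Y' -> (forall w, 0 <= Y' w <= 1)%R ->
  measurable_fun setT T -> measurable_fun setT M ->
  (forall B C, measurable B -> measurable C ->
    \int[P]_(w in T @^-1` B `&` M @^-1` C) (Y w)%:E =
    (\int[P]_(w in T @^-1` B) (Y' w)%:E) * pi C) ->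
  measurable_fun setT f -> (forall z, 0 <= f z) ->
  \int[P]_w (f (T w, M w) * (Y w)%:E) =
  \int[P]_w ((\int[pi]_m f (T w, m)) * (Y' w)%:E).
Proof.
move=> mY Y0 mY' Y'01 mT mM H mf f0.
have Y'0 w : (0 <= Y' w)%R by case/andP : (Y'01 w).
have mTM : measurable_fun setT (fun w => (T w, M w)) by exact: measurable_fun_pair.
pose m : {measure set _ -> \bar R} :=
  measure_function_pushforward__canonical__measure_function_Measure (weighted P mY Y0) mTM.
pose m1' : {measure set S -> \bar R} := 
  measure_function_pushforward__canonical__measure_function_Measure (weighted P mY' Y'0) mT.
(* As [Y' <= 1], the total mass is at most 1. Finiteness makes the product with [pi] a measure
   determined by its values on rectangles. *)
have m1fin : fin_num_fun m1'.
  move=> A mA; rewrite ge0_fin_numE ?measure_ge0//.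
  apply: (@le_lt_trans _ _ (\int[P]_w (1 : \bar R))); last first.
    rewrite integral_cst// mul1e.
    exact: le_lt_trans (probability_le1 P measurableT) (ltry 1).
  apply: (@le_trans _ _ (\int[P]_w (Y' w)%:E)).
    apply: ge0_subset_integral => //.
    - by have := mT measurableT A mA; rewrite setTI.
    - exact/measurable_EFinP.
    - by move=> w _; rewrite lee_fin.
  apply: ge0_le_integral => //.
  - by move=> w _; rewrite lee_fin.
  - exact/measurable_EFinP.
  - by move=> w _; rewrite lee_fin; case/andP : (Y'01 w).
pose m1 : {finite_measure set S -> \bar R} :=
  HB.pack (Measure.sort m1') (Measure_isFinite.Build _ _ _ (m1' : set S -> \bar R) m1fin).
have mE X : measurable X -> (m1 \x pi) X = m X.
  by move=> mX; apply: product_measure_unique => // B C mB mC; rewrite /m /= -H.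
transitivity (\int[m]_z f z).
  rewrite ge0_integral_pushforward//=.
  by rewrite integral_weighted//; exact: measurableT_comp.
transitivity (\int[m1 \x pi]_z f z).
  by apply/esym/eq_measure_integral => A mA _; exact: mE.
rewrite fubini_tonelli1// /fubini_F.
transitivity (\int[m1']_t \int[pi]_m0 f (t, m0)) => //.
have mF : measurable_fun setT (fun t => \int[pi]_m0 f (t, m0)).
  exact: measurable_fun_fubini_tonelli_F.
have F0 t : 0 <= \int[pi]_m0 f (t, m0) by exact: integral_ge0.
rewrite ge0_integral_pushforward//= integral_weighted//.
exact: (measurableT_comp mF).
Qed.
End weighted_independence.
(** * Laplace transforms of counting variables *)

Section expN.
Context {R : realType}.
Implicit Types (x y : \bar R).

(** The function exp(- x) with values in [R], so that products stay real. The value 0 at +oo is the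
    limit, and agrees with the product rule; -oo gets the junk value 1. *)
Definition expN (x : \bar R) : R :=
  if x == +oo%E then 0 else expR (- fine x).

Lemma expN_EFin (r : R) : expN r%:E = expR (- r).
Proof. by []. Qed.

Lemma expNy : expN +oo%E = 0.
Proof. by rewrite /expN eqxx. Qed.

Lemma expN_ge0 x : 0 <= expN x.
Proof. by rewrite /expN; case: ifP => // _; exact: expR_ge0. Qed.

Lemma expN_le1 x : (0 <= x)%E -> expN x <= 1.
Proof.
rewrite /expN; case: ifP => // _ x0.
by rewrite -expR0 ler_expR oppr_le0 fine_ge0.
Qed.

Lemma expND x y : (0 <= x)%E -> (0 <= y)%E -> expN (x + y) = expN x * expN y.
Proof.
case: x => [r||] //; case: y => [s||] // _ _; rewrite ?expNy ?mulr0 ?mul0r//.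
by rewrite -EFinD !expN_EFin opprD expRD.
Qed.

Lemma expN_sum (I : Type) (r : seq I) (F : I -> \bar R) :
  (forall i, 0 <= F i)%E -> expN (\sum_(i <- r) F i)%E = \prod_(i <- r) expN (F i).
Proof.
move=> F0; elim: r => [|i r IH]; first by rewrite !big_nil expN_EFin oppr0 expR0.
by rewrite !big_cons expND ?IH//; apply: sume_ge0.
Qed.

Lemma measurable_expN : measurable_fun setT expN.
Proof.
apply: measurable_fun_ifT => //=.
  exact: measurable_fun_eqe.
by apply: measurableT_comp => //; apply: measurableT_comp.
Qed.

Lemma cvg_expN (u : nat -> \bar R) (x : \bar R) : (forall n, 0 <= u n)%E ->
  u n @[n --> \oo] --> x -> expN (u n) @[n --> \oo] --> expN x.
Proof.
move=> u0; case: x => [r ur|/cvgeyPge uy|ur].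
- have /fine_cvgP[ufin fur] := ur.
  have h : expR (- fine (u n)) @[n --> \oo] --> expR (- r).
    apply: continuous_cvg; first exact: continuous_expR.
    exact: cvgN.
  apply: cvg_trans h; apply: near_eq_cvg.
  near=> n; rewrite /expN ifF//; apply/negbTE.
  have : u n \is a fin_num by near: n.
  by rewrite fin_numE => /andP[].
- rewrite expNy; apply/cvgr0Pnorm_le => e e0.
  near=> n; rewrite ger0_norm ?expN_ge0//.
  have : ((- ln e)%:E <= u n)%E by near: n; exact: uy.
  case: (u n) => [s|_|//]; last by rewrite expNy ltW.
  by rewrite lee_fin expN_EFin lerNl => us; rewrite -[leRHS]lnK ?posrE// ler_expR.
- have /cvgeNyPle/(_ (-1)%R)[N _ /(_ N (leqnn _))/=] := ur.
  by move=> /(le_trans (u0 N)); rewrite lee_fin lerNr oppr0 ler10.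
Unshelve. all: by end_near. Qed.

(** Divergence is allowed: the products then tend to 0, the value of [expN] at +oo. *)
Lemma cvg_expN_series (u : nat -> R) : (forall n, 0 <= u n) ->
  \prod_(0 <= n < N) expR (- u n) @[N --> \oo] --> expN (\sum_(n <oo) (u n)%:E)%E.
Proof.
move=> u0.
rewrite (_ : (fun N => _) = (fun N => expN (\sum_(0 <= n < N) (u n)%:E)%E)).
  apply: cvg_expN; first by move=> N; apply: sume_ge0 => n _; rewrite lee_fin.
  by apply: is_cvg_nneseries => n _ _; rewrite lee_fin.
by apply/funext => N; rewrite expN_sum.
Qed.

End expN.

Section poisson_laplace.
Context {R : realType}.

Lemma poisson_mass_ge0 (r : R) k : (0 <= poisson_mass r k)%E.
Proof. exact: measure_ge0. Qed.

Lemma poisson_mass_pos (r : R) k : 0 < r ->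
  poisson_mass r k = (r ^+ k * k`!%:R^-1 * expR (- r))%:E.
Proof.
move=> r0; rewrite /poisson_mass /poisson_prob r0 esum_set1 ?lee_fin ?poisson_pmf_ge0//.
by rewrite /poisson_pmf r0.
Qed.

Lemma poisson_mass0 k : poisson_mass (0 : R) k = (k == 0%N)%:R%:E.
Proof.
rewrite /poisson_mass /poisson_prob ltxx diracE; case: k => [|k].
  by rewrite mem_set.
by rewrite memNset.
Qed.

Lemma sum_poisson_mass (r : R) : (\sum_(k <oo) poisson_mass r k = 1)%E.
Proof.
rewrite -(@probability_setT _ _ _ (poisson_prob r 0%N)).
rewrite (_ : [set: nat] = \bigcup_k [set k]); last first.
  by apply/seteqP; split => // k _; exists k.
rewrite measure_bigcup//.
  by apply: eq_eseriesl => k; rewrite in_setT.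
by move=> i j _ _ [k [/= -> ->]].
Qed.

(** With z = exp(- s), multiplying the k-th mass by z ^ k changes the parameter from r to r z, up to
    the factor exp(- r (1 - z)); the new masses sum to 1. For r = 0 the law is a Dirac mass and is
    treated apart. *)
Lemma poisson_laplace (r s : R) : 0 <= r -> 0 < s ->
  (\sum_(k <oo) (expR (- s) ^+ k)%:E * poisson_mass r k =
   (expR (- (r * (1 - expR (- s)))))%:E)%E.
Proof.
rewrite le_eqVlt => /predU1P[<- s0|r0 s0].
  rewrite mul0r oppr0 expR0 nneseries_recl//; last first.
    by move=> k _; rewrite mule_ge0// ?lee_fin ?exprn_ge0// ?expR_ge0// poisson_mass_ge0.
  rewrite poisson_mass0 expr0 mule1 eseries0 ?adde0//.
  by move=> [|k] // _ _; rewrite poisson_mass0 mule0.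
have rz0 : 0 < r * expR (- s) by rewrite mulr_gt0// expR_gt0.
rewrite (@eq_eseriesr _ _ (fun k => (expR (- (r * (1 - expR (- s)))))%:E *
    poisson_mass (r * expR (- s)) k)%E); last first.
  move=> k _; rewrite !poisson_mass_pos// -!EFinM; congr EFin.
  have -> : - r = - (r * expR (- s)) - r * (1 - expR (- s)).
    by ring.
  by rewrite expRD exprMn; ring.
rewrite nneseriesZl; last by move=> k _; exact: poisson_mass_ge0.
by rewrite sum_poisson_mass mule1.
Qed.

End poisson_laplace.

(** * Uniqueness of power series coefficients *)

Section power_series.
Context {R : realType}.
Local Open Scope ereal_scope.

(* For the first index at which [a] and [b] may differ, divide by [z ^+ n] and
   let [z = exp(- s)] tend to 0. *)
Let head_le (a b : nat -> R) (n : nat) :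
  (forall k, 0 <= a k <= 1)%R -> (forall k, 0 <= b k <= 1)%R ->
  (forall s, (0 < s)%R ->
    \sum_(k <oo) (expR (- s) ^+ k * a k)%:E =
    \sum_(k <oo) (expR (- s) ^+ k * b k)%:E) ->
  (forall k, (k < n)%N -> a k = b k) -> (a n <= b n)%R.
Proof.
move=> a01 b01 ab IH; apply/ler_addgt0Pr => e e0.
have a0 k : (0 <= a k)%R by case/andP : (a01 k).
have b0 k : (0 <= b k)%R by case/andP : (b01 k).
have b1 k : (b k <= 1)%R by case/andP : (b01 k).
(* The bound 1/2 keeps the geometric sums below 2; the bound e / 2 makes the remainder [2 * z] at
   most [e] after division by [z ^+ n]. *)
pose z : R := Num.min (2^-1)%R (e / 2)%R.
have z0 : (0 < z)%R by rewrite lt_min divr_gt0// invr_gt0 ltr0n.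
have z12 : (z <= 2^-1)%R by rewrite ge_min lexx.
have ze : (z <= e / 2)%R by rewrite ge_min lexx orbT.
have z1 : (z < 1)%R by rewrite (le_lt_trans z12)// invf_lt1// ltr1n.
have lnz : (0 < - ln z)%R by rewrite oppr_gt0 ln_lt0// z0.
have := ab _ lnz; rewrite opprK lnK ?posrE// => {}ab.
have za k : 0 <= (z ^+ k * a k)%:E by rewrite lee_fin mulr_ge0// exprn_ge0// ltW.
have zb k : 0 <= (z ^+ k * b k)%:E by rewrite lee_fin mulr_ge0// exprn_ge0// ltW.
rewrite (nneseries_split 0 n.+1)// in ab; rewrite (nneseries_split 0 n.+1)// in ab.
rewrite add0n !big_nat_recr//= in ab.
(* Subtracting [2 * z ^+ N] strengthens the bound 2 enough for induction, as [z <= 2^-1]. *)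
have geo N : (\sum_(0 <= k < N) z ^+ k <= 2 - 2 * z ^+ N)%R.
  elim: N => [|N IHN]; first by rewrite big_nil expr0 mulr1 subrr.
  rewrite big_nat_recr//= (le_trans (lerD IHN (lexx _)))// exprS.
  have : (z * z ^+ N <= 2^-1 * z ^+ N)%R by rewrite ler_wpM2r// exprn_ge0// ltW.
  by lra.
have tail : \sum_(n.+1 <= k <oo) (z ^+ k * b k)%:E <= (z ^+ n.+1 * 2)%:E.
  rewrite -nneseries_addn//; apply: lime_le.
    by apply: is_cvg_nneseries => k _ _; exact: zb.
  apply: nearW => N; rewrite sumEFin lee_fin.
  apply: (@le_trans _ _ (z ^+ n.+1 * \sum_(0 <= k < N) z ^+ k)%R).
    rewrite mulr_sumr; apply: ler_sum => k _.
    rewrite -exprD addnC -[leRHS]mulr1 ler_wpM2l// ?exprn_ge0// ?ltW//.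
  rewrite ler_wpM2l ?exprn_ge0 ?(ltW z0)// (le_trans (geo N))//.
  by rewrite gerBl mulr_ge0// exprn_ge0// ltW.
have heads : \sum_(0 <= k < n) (z ^+ k * a k)%:E = \sum_(0 <= k < n) (z ^+ k * b k)%:E.
  by rewrite !big_mkord; apply: eq_bigr => k _; rewrite IH.
(* The tail of [a] is dropped, that of [b] is bounded, and the terms before [n] agree. *)
have : (z ^+ n * a n <= z ^+ n * b n + z ^+ n.+1 * 2)%R.
  rewrite -lee_fin.
  have : \sum_(0 <= k < n) (z ^+ k * a k)%:E + (z ^+ n * a n)%:E <=
         \sum_(0 <= k < n) (z ^+ k * b k)%:E + (z ^+ n * b n)%:E + (z ^+ n.+1 * 2)%:E.
    apply: (@le_trans _ _ (\sum_(0 <= k < n) (z ^+ k * b k)%:E + (z ^+ n * b n)%:E +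
        \sum_(n.+1 <= k <oo) (z ^+ k * b k)%:E)).
      by rewrite -ab leeDl// nneseries_ge0.
    by rewrite leeD2l.
  rewrite heads !sumEFin -!EFinD !lee_fin; lra.
rewrite exprSr -mulrA -mulrDr ler_pM2l ?exprn_gt0// => /le_trans; apply.
by rewrite lerD2l; lra.
Qed.


Lemma power_series_unique (a b : nat -> R) :
  (forall k, 0 <= a k <= 1)%R -> (forall k, 0 <= b k <= 1)%R ->
  (forall s, (0 < s)%R ->
    \sum_(k <oo) (expR (- s) ^+ k * a k)%:E =
    \sum_(k <oo) (expR (- s) ^+ k * b k)%:E) ->
  a = b.
Proof.
move=> a01 b01 ab; apply/funext; elim/ltn_ind => n IH; apply/eqP; rewrite eq_le.
rewrite head_le//= head_le//; first by move=> s s0; rewrite ab.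
by move=> k kn; rewrite IH.
Qed.

End power_series.
Lemma indicM (R : realType) (T : Type) (A B : set T) (w : T) :
  \1_A w * \1_B w = \1_(A `&` B) w :> R.
Proof. by rewrite indicI. Qed.

Lemma prod_indic (R : realType) (T : Type) (A : nat -> set T) (m : nat) (w : T) :
  \prod_(0 <= i < m) \1_(A i) w = \1_(\bigcap_(i in [set i | (i < m)%N]) A i) w :> R.
Proof.
elim: m => [|m IH].
  rewrite big_nil (_ : \bigcap_(i in _) _ = setT) ?indicT//.
  by apply/seteqP; split => // x _ i.
rewrite big_nat_recr//= IH indicM; congr (\1_ _ _); apply/seteqP; split => x /=.
  move=> [h Am] i /=; rewrite ltnS leq_eqVlt => /predU1P[->//|]; exact: h.
by move=> h; split => [i /= im|]; apply: h => /=; rewrite // ltnS ltnW.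
Qed.

(** * Passing between joint laws and joint Laplace transforms *)

Section counting_variables.
Local Open Scope ereal_scope.
Context d (W : measurableType d) (R : realType) (P : probability W R).

Definition nat_valued (N : W -> \bar R) :=
  forall w, N w = +oo \/ exists k : nat, N w = k%:R%:E.

(** An infinite value belongs to no [value_in N C], not even for [C = setT]; the event
    [value_in N setT] thus expresses finiteness. *)
Definition value_in (N : W -> \bar R) (C : set nat) : set W :=
  [set w | exists2 k, C k & N w = k%:R%:E].

Lemma measurable_preimage_set1 (N : W -> \bar R) y : measurable_fun setT N ->
  measurable (N @^-1` [set y]).
Proof. by move=> mN; rewrite -[X in measurable X]setTI; exact: mN. Qed.

Lemma measurable_value_in (N : W -> \bar R) C : measurable_fun setT N ->
  measurable (value_in N C).
Proof.
move=> mN; rewrite (_ : value_in N C = \bigcup_(k in C) (N @^-1` [set k%:R%:E])).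
  by apply: bigcup_measurable => k _; exact: measurable_preimage_set1.
by apply/seteqP; split => w /= [k Ck Nw]; exists k.
Qed.

Lemma natr_EFin_inj (k l : nat) : k%:R%:E = l%:R%:E :> \bar R -> k = l.
Proof. by move=> [] /eqP; rewrite eqr_nat => /eqP. Qed.

Lemma series_indic_value (N : W -> \bar R) (a : nat -> R) (w : W) :
  (forall k, (0 <= a k)%R) ->
  \sum_(k <oo) (a k * \1_(N @^-1` [set k%:R%:E]) w)%:E =
  if pselect (exists k : nat, N w = k%:R%:E) is left e
  then (a (projT1 (cid e)))%:E else 0.
Proof.
move=> a0; case: pselect => [e|ne].
  case: cid => k /= Nk; rewrite (@nneseriesD1 _ _ k)//; last first.
    by move=> l _; rewrite lee_fin mulr_ge0.
  rewrite eseries0 ?adde0 ?indicE ?mem_set ?mulr1// => l _ /andP[_ lk].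
  rewrite indicE memNset ?mulr0//= Nk => /natr_EFin_inj kl.
  by rewrite kl eqxx in lk.
rewrite eseries0// => k _ _; rewrite indicE memNset ?mulr0//= => Nk.
by apply: ne; exists k.
Qed.

(** Splitting over the finite values of [N] loses nothing: since [0 < s], the integrand vanishes
    where [N] is infinite. *)
Lemma integral_expN_nat_valued (Y : W -> R) (N : W -> \bar R) (s : R) :
  measurable_fun setT Y -> (forall w, 0 <= Y w)%R ->
  measurable_fun setT N -> nat_valued N -> (0 < s)%R ->
  \int[P]_w (Y w * expN (s%:E * N w))%:E =
  \sum_(k <oo) (expR (- s) ^+ k)%:E * \int[P]_w (Y w * \1_(N @^-1` [set k%:R%:E]) w)%:E.
Proof.
move=> mY Y0 mN nN s0.
have z0 k : (0 <= expR (- s) ^+ k)%R by rewrite exprn_ge0// expR_ge0.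
have mY1 k : measurable_fun setT (fun w => (Y w * \1_(N @^-1` [set k%:R%:E]) w)%R).
  by apply: measurable_funM => //; apply: measurable_indic; exact: measurable_preimage_set1.
have Y10 k w : (0 <= Y w * \1_(N @^-1` [set k%:R%:E]) w)%R by rewrite mulr_ge0.
transitivity (\int[P]_w \sum_(k <oo) ((expR (- s) ^+ k)%:E * (Y w * \1_(N @^-1` [set k%:R%:E]) w)%:E)).
  apply: eq_integral => w _.
  under eq_eseriesr do rewrite -EFinM mulrCA EFinM.
  rewrite nneseriesZl; last by move=> k _; rewrite lee_fin mulr_ge0.
  rewrite series_indic_value// EFinM; congr (_ * _).
  case: pselect => [e|ne]; first case: cid => k /= ->.
    by rewrite -EFinM expN_EFin -mulNr mulrC expRM_natl.
  by have [->|//] := nN w; rewrite mulry gtr0_sg// mul1e expNy.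
rewrite integral_nneseries//; last 2 first.
- by move=> k; apply: emeasurable_funM => //; exact/measurable_EFinP.
- by move=> k w _; rewrite mule_ge0// lee_fin.
apply: eq_eseriesr => k _; rewrite ge0_integralZl//.
- exact/measurable_EFinP.
- by move=> w _; rewrite lee_fin.
Qed.

Lemma integral_value_in (Y : W -> R) (N : W -> \bar R) (C : set nat) :
  measurable_fun setT Y -> (forall w, 0 <= Y w)%R -> measurable_fun setT N ->
  \int[P]_w (Y w * \1_(value_in N C) w)%:E =
  \sum_(k <oo) (\1_C k)%:E * \int[P]_w (Y w * \1_(N @^-1` [set k%:R%:E]) w)%:E.
Proof.
move=> mY Y0 mN.
have mY1 k : measurable_fun setT (fun w => (Y w * \1_(N @^-1` [set k%:R%:E]) w)%R).
  by apply: measurable_funM => //; apply: measurable_indic; exact: measurable_preimage_set1.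
have Y10 k w : (0 <= Y w * \1_(N @^-1` [set k%:R%:E]) w)%R by rewrite mulr_ge0.
transitivity (\int[P]_w \sum_(k <oo) ((\1_C k)%:E * (Y w * \1_(N @^-1` [set k%:R%:E]) w)%:E)).
  apply: eq_integral => w _.
  under eq_eseriesr do rewrite -EFinM mulrCA EFinM.
  rewrite nneseriesZl; last by move=> k _; rewrite lee_fin mulr_ge0.
  rewrite series_indic_value// EFinM; congr (_ * _).
  case: pselect => [e|ne]; first case: cid => k /= Nk.
    rewrite !indicE; congr ((nat_of_bool _)%:R%:E); apply/idP/idP => /set_mem h; apply/mem_set.
      by case: h => l Cl; rewrite Nk => /natr_EFin_inj ->.
    by exists k.
  by rewrite indicE memNset// => -[k _ Nk]; apply: ne; exists k.
rewrite integral_nneseries//; last 2 first.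
- by move=> k; apply: emeasurable_funM => //; exact/measurable_EFinP.
- by move=> k w _; rewrite mule_ge0// lee_fin.
apply: eq_eseriesr => k _; rewrite ge0_integralZl//.
- exact/measurable_EFinP.
- by move=> w _; rewrite lee_fin.
Qed.

Lemma measurable_expNZ (N : W -> \bar R) (s : R) : measurable_fun setT N ->
  measurable_fun setT (fun w => expN (s%:E * N w)).
Proof.
move=> mN; apply: (measurableT_comp measurable_expN).
exact: measurable_funeM.
Qed.

Lemma nat_valued_ge0 N w : nat_valued N -> 0 <= N w.
Proof. by move=> nN; have [->|[k ->]] := nN w; rewrite ?leey// lee_fin. Qed.

Lemma expNZ_le1 N (s : R) w : nat_valued N -> (0 < s)%R -> (expN (s%:E * N w) <= 1)%R.
Proof. by move=> nN s0; rewrite expN_le1// mule_ge0// ?nat_valued_ge0// lee_fin ltW. Qed.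

Lemma integral_le1 (Y : W -> R) : measurable_fun setT Y ->
  (forall w, 0 <= Y w <= 1)%R -> \int[P]_w (Y w)%:E <= 1.
Proof.
move=> mY Y01; apply: (@le_trans _ _ (\int[P]_w (cst 1 w))).
  apply: ge0_le_integral => //.
  - by move=> w _; rewrite lee_fin; case/andP : (Y01 w).
  - exact/measurable_EFinP.
  - by move=> w _; rewrite lee_fin; case/andP : (Y01 w).
by rewrite integral_cst// mul1e; exact: probability_le1.
Qed.

(** The weight [Y] will hold the factors of the other variables. The numbers E(Y; N = k) and c Q{k}
    lie in [0, 1] and have the same generating function at z = exp(- s), hence they agree. *)
Lemma law_of_laplace1 (Y : W -> R) (N : W -> \bar R) (c : R)
    (Q : probability nat R) (G : R -> R) :
  measurable_fun setT Y -> (forall w, 0 <= Y w <= 1)%R ->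
  measurable_fun setT N -> nat_valued N -> (0 <= c <= 1)%R ->
  (forall s, (0 < s)%R -> \sum_(k <oo) (expR (- s) ^+ k)%:E * Q [set k] = (G s)%:E) ->
  (forall s, (0 < s)%R -> \int[P]_w (Y w * expN (s%:E * N w))%:E = (c * G s)%:E) ->
  forall C, \int[P]_w (Y w * \1_(value_in N C) w)%:E = c%:E * Q C.
Proof.
move=> mY Y01 mN nN c01 QG YG C.
have Y0 w : (0 <= Y w)%R by case/andP : (Y01 w).
have c0 : (0 <= c)%R by case/andP : c01.
have mY1 k : measurable_fun setT (fun w => (Y w * \1_(N @^-1` [set k%:R%:E]) w)%R).
  by apply: measurable_funM => //; apply: measurable_indic; exact: measurable_preimage_set1.
pose a k := fine (\int[P]_w (Y w * \1_(N @^-1` [set k%:R%:E]) w)%:E).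
have aE k : \int[P]_w (Y w * \1_(N @^-1` [set k%:R%:E]) w)%:E = (a k)%:E /\ (0 <= a k <= 1)%R.
  have ge0 : 0 <= \int[P]_w (Y w * \1_(N @^-1` [set k%:R%:E]) w)%:E.
    by apply: integral_ge0 => w _; rewrite lee_fin mulr_ge0.
  have le1 : \int[P]_w (Y w * \1_(N @^-1` [set k%:R%:E]) w)%:E <= 1.
    apply: integral_le1 => // w; rewrite mulr_ge0//=.
    by rewrite mulr_ile1//; case/andP : (Y01 w).
  have fn : \int[P]_w (Y w * \1_(N @^-1` [set k%:R%:E]) w)%:E \is a fin_num.
    by rewrite ge0_fin_numE// (le_lt_trans le1)// ltry.
  rewrite /a fineK//; split => //; rewrite -!lee_fin fineK// ge0 le1//.
pose b k := (c * fine (Q [set k]))%R.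
have QE k : Q [set k] = (fine (Q [set k]))%:E by rewrite fineK// fin_num_measure.
have Q01 k : (0 <= fine (Q [set k]) <= 1)%R.
  by rewrite -!lee_fin -QE measure_ge0/=; exact: probability_le1.
have ab : a = b.
  apply: power_series_unique.
  - by move=> k; case: (aE k).
  - move=> k; have /andP[q0 q1] := Q01 k; case/andP : c01 => _ c1.
    by rewrite mulr_ge0//= mulr_ile1.
  - move=> s s0; transitivity (\int[P]_w (Y w * expN (s%:E * N w))%:E).
      rewrite integral_expN_nat_valued//; apply: eq_eseriesr => k _.
      by rewrite (aE k).1 EFinM.
    rewrite YG// EFinM -QG// -nneseriesZl//; last first.
      by move=> k _; rewrite mule_ge0// lee_fin exprn_ge0// expR_ge0.
    by apply: eq_eseriesr => k _; rewrite QE -!EFinM mulrCA.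
rewrite integral_value_in//.
rewrite [X in Q X](_ : C = \bigcup_(k in C) [set k]); last first.
  by apply/seteqP; split => [k Ck|k [l Cl ->//]]; exists k.
rewrite measure_bigcup//; last by move=> i j _ _ [k [/= -> ->]].
rewrite -nneseriesZl; last by move=> k _; exact: measure_ge0.
rewrite [RHS]eseries_mkcond; apply: eq_eseriesr => k _.
rewrite (aE k).1 ab /b EFinM -QE indicE; case: ifPn => _; by rewrite ?mul0e// mul1e.
Qed.

(** Needed because the point process is specified by the masses of its counts, whereas marks are
    averaged in Laplace transforms. *)
Lemma laplace_of_masses (m : nat) (N : nat -> W -> \bar R)
    (q : nat -> nat -> R) (s G : nat -> R) :
  (forall i, measurable_fun setT (N i)) -> (forall i, nat_valued (N i)) ->
  (forall i, (0 < s i)%R) -> (forall i k, (0 <= q i k)%R) ->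
  (forall i, \sum_(k <oo) (expR (- s i) ^+ k * q i k)%:E = (G i)%:E) ->
  (forall k : nat -> nat,
    P (\bigcap_(i in [set i | (i < m)%N]) (N i @^-1` [set (k i)%:R%:E])) =
    (\prod_(0 <= i < m) q i (k i))%:E) ->
  \int[P]_w (\prod_(0 <= i < m) expN ((s i)%:E * N i w))%:E =
  (\prod_(0 <= i < m) G i)%:E.
Proof.
move=> mN nN s0 q0 qG mass.
have m1 (k : nat -> nat) i : measurable_fun setT (\1_(N i @^-1` [set (k i)%:R%:E]) : W -> R).
  by apply: measurable_indic; exact: measurable_preimage_set1.
have mE i := measurable_expNZ (s i) (mN i).
(* The first [r] variables already carry Laplace factors, the others indicators. Summing over the
   value of variable [r] needs the induction hypothesis for all [k]. *)
have claim r : (r <= m)%N -> forall k : nat -> nat,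
    \int[P]_w ((\prod_(0 <= i < r) expN ((s i)%:E * N i w)) *
      \prod_(r <= i < m) \1_(N i @^-1` [set (k i)%:R%:E]) w)%:E =
    ((\prod_(0 <= i < r) G i) * \prod_(r <= i < m) q i (k i))%:E.
  elim: r => [_ k|r IH rm k].
    rewrite big_nil mul1r -mass.
    under eq_integral do rewrite big_nil mul1r prod_indic.
    rewrite integral_indic ?setIT//; apply: bigcap_measurableType => i _.
    exact: measurable_preimage_set1.
  pose Y w := ((\prod_(0 <= i < r) expN ((s i)%:E * N i w)) *
    \prod_(r.+1 <= i < m) \1_(N i @^-1` [set (k i)%:R%:E]) w)%R.
  transitivity (\int[P]_w (Y w * expN ((s r)%:E * N r w))%:E).
    by apply: eq_integral => w _; rewrite big_nat_recr//= mulrAC.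
  rewrite integral_expN_nat_valued//; last 2 first.
    by apply: measurable_funM; apply: measurable_prod => i _.
    move=> w; rewrite mulr_ge0// prodr_ge0// => i _; exact: expN_ge0.
  rewrite big_nat_recr//= mulrAC EFinM -(qG r) -nneseriesZl; last first.
    by move=> l _; rewrite lee_fin mulr_ge0// exprn_ge0// expR_ge0.
  apply: eq_eseriesr => l _.
  pose k' i := if i == r then l else k i.
  have -> : \int[P]_w (Y w * \1_(N r @^-1` [set l%:R%:E]) w)%:E =
      ((\prod_(0 <= i < r) G i) * \prod_(r <= i < m) q i (k' i))%:E.
    rewrite -(IH (ltnW rm)); apply: eq_integral => w _.
    rewrite /Y -mulrA; congr (_ * _)%:E; rewrite (big_ltn rm) mulrC /k' eqxx; congr (_ * _)%R.
    by apply: eq_big_nat => i /andP[ri _]; rewrite gtn_eqF.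
  rewrite (big_ltn rm) /k' eqxx -!EFinM; congr EFin.
  rewrite (_ : \prod_(r.+1 <= i < m) q i _ = \prod_(r.+1 <= i < m) q i (k i))%R.
    by ring.
  by apply: eq_big_nat => i /andP[ri _]; rewrite gtn_eqF.
have := claim m (leqnn m) (fun=> 0%N); rewrite (big_geq (leqnn m)) mulr1 => <-.
by apply: eq_integral => w _; rewrite (big_geq (leqnn m)) mulr1.
Qed.

(** Converse of [laplace_of_masses]: Laplace factors are replaced by indicators from the left. At
    each step one parameter varies while the others stay fixed, so that uniqueness in a single
    variable suffices. *)
Lemma law_of_laplace (m : nat) (N : nat -> W -> \bar R)
    (Q : nat -> probability nat R) (G : nat -> R -> R) :
  (forall i, measurable_fun setT (N i)) -> (forall i, nat_valued (N i)) ->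
  (forall i s, (0 < s)%R -> (0 <= G i s <= 1)%R) ->
  (forall i s, (0 < s)%R ->
    \sum_(k <oo) (expR (- s) ^+ k)%:E * Q i [set k] = (G i s)%:E) ->
  (forall s : nat -> R, (forall i, 0 < s i)%R ->
    \int[P]_w (\prod_(0 <= i < m) expN ((s i)%:E * N i w))%:E =
    (\prod_(0 <= i < m) G i (s i))%:E) ->
  forall C : nat -> set nat,
    P (\bigcap_(i in [set i | (i < m)%N]) value_in (N i) (C i)) =
    \prod_(0 <= i < m) Q i (C i).
Proof.
move=> mN nN G01 QG lap C.
have QE i : Q i (C i) = (fine (Q i (C i)))%:E by rewrite fineK// fin_num_measure.
have Q01 i : (0 <= fine (Q i (C i)) <= 1)%R.
  by rewrite -!lee_fin -QE measure_ge0/=; exact: probability_le1.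
have m1 i : measurable_fun setT (\1_(value_in (N i) (C i)) : W -> R).
  by apply: measurable_indic; exact: measurable_value_in.
have claim r : (r <= m)%N -> forall s : nat -> R, (forall i, 0 < s i)%R ->
    \int[P]_w ((\prod_(0 <= i < r) \1_(value_in (N i) (C i)) w) *
      \prod_(r <= i < m) expN ((s i)%:E * N i w))%:E =
    ((\prod_(0 <= i < r) fine (Q i (C i))) * \prod_(r <= i < m) G i (s i))%:E.
  elim: r => [_ s s0|r IH rm s s0].
    rewrite big_nil mul1r -lap//.
    by under eq_integral do rewrite big_nil mul1r.
  pose Y w := ((\prod_(0 <= i < r) \1_(value_in (N i) (C i)) w) *
      \prod_(r.+1 <= i < m) expN ((s i)%:E * N i w))%R.
  transitivity (\int[P]_w (Y w * \1_(value_in (N r) (C r)) w)%:E).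
    by apply: eq_integral => w _; rewrite big_nat_recr//= mulrAC.
  (* The part of the joint transform that does not involve variable [r]; the bounds on [G] and [Q]
     keep it in [0, 1]. *)
  pose c := ((\prod_(0 <= i < r) fine (Q i (C i))) * \prod_(r.+1 <= i < m) G i (s i))%R.
  rewrite (@law_of_laplace1 _ _ c (Q r) (G r))//.
  - by rewrite QE -EFinM big_nat_recr//= mulrAC.
  - by apply: measurable_funM; apply: measurable_prod => i _ //; exact: measurable_expNZ.
  - move=> w.
    have A : (0 <= \prod_(0 <= i < r) (\1_(value_in (N i) (C i)) w : R) <= 1)%R.
      rewrite prodr_ge0//= prodr_ile1// => i _.
      by rewrite indicE; case: (_ \in _); rewrite ?lexx ?ler01.
    have B : (0 <= \prod_(r.+1 <= i < m) expN ((s i)%:E * N i w) <= 1)%R.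
      rewrite prodr_ge0/= ?prodr_ile1// => i _; last exact: expN_ge0.
      by rewrite expN_ge0/= expNZ_le1.
    by case/andP : A => A0 A1; case/andP : B => B0 B1; rewrite mulr_ge0//= mulr_ile1.
  - rewrite mulr_ge0 ?prodr_ge0//=.
    + rewrite mulr_ile1// ?prodr_ge0// ?prodr_ile1//.
      * by move=> i _; case/andP : (Q01 i).
      * by move=> i _; case/andP : (G01 i _ (s0 i)).
      * by move=> i _; exact: G01.
    + by move=> i _; case/andP : (Q01 i).
    + by move=> i _; case/andP : (G01 i _ (s0 i)).
  - by move=> t t0; exact: QG.
  - move=> t t0; pose s' i := if i == r then t else s i.
    transitivity (\int[P]_w ((\prod_(0 <= i < r) \1_(value_in (N i) (C i)) w) *
        \prod_(r <= i < m) expN ((s' i)%:E * N i w))%:E).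
      apply: eq_integral => w _.
      rewrite /Y -mulrA; congr (_ * _)%:E; rewrite (big_ltn rm) mulrC /s' eqxx; congr (_ * _)%R.
      by apply: eq_big_nat => i /andP[ri _]; rewrite gtn_eqF.
    rewrite (IH (ltnW rm)); last by move=> i; rewrite /s'; case: ifP.
    congr EFin; rewrite /c -mulrA; congr (_ * _)%R.
    rewrite (big_ltn rm) mulrC /s' eqxx; congr (_ * _)%R.
    by apply: eq_big_nat => i /andP[ri _]; rewrite gtn_eqF.
have := claim m (leqnn m) (fun=> 1%R) (fun=> ltr01); rewrite (big_geq (leqnn m)) mulr1.
rewrite (eq_bigr (fun i => (fine (Q i (C i)))%:E)) => [|i _]; last exact: QE.
rewrite -(big_morph EFin EFinM erefl) => <-.
under eq_integral do rewrite (big_geq (leqnn m)) mulr1 prod_indic.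
rewrite integral_indic ?setIT//; apply: bigcap_measurableType => i _.
exact: measurable_value_in.
Qed.

End counting_variables.
(** * Displaced Poisson point processes *)

Section point_process_laplace.
Local Open Scope ereal_scope.
Context d (W : measurableType d) (R : realType) (P : probability W R).

(** The terms of a convergent series are eventually smaller than 1, and natural numbers smaller than
    1 are 0. *)
Lemma nat_series_valued (u : nat -> nat) :
  \sum_(n <oo) (u n)%:R%:E = +oo :> \bar R \/
  exists k : nat, \sum_(n <oo) (u n)%:R%:E = k%:R%:E :> \bar R.
Proof.
have u0 n : 0 <= (u n)%:R%:E :> \bar R by rewrite lee_fin.
have [Soo|] := ltP (\sum_(n <oo) (u n)%:R%:E : \bar R) +oo; last first.
  by rewrite leye_eq => /eqP; left.
right.
have u0R n : (0 <= (u n)%:R :> R)%R by [].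
have := cvg_series_cvg_0 (nnseries_is_cvg u0R Soo).
move=> /cvgr0Pnorm_lt /(_ _ ltr01)[N _ uN].
exists (\sum_(0 <= n < N) u n)%N.
rewrite (nneseries_split 0 N)// add0n eseries0 ?adde0; last first.
  move=> n Nn _; have := uN n Nn => /=.
  by rewrite ger0_norm// -[X in (_ < X)%R]/(1%:R) ltr_nat ltnS leqn0 => /eqP ->.
by rewrite sumEFin natr_sum.
Qed.

Lemma point_count_nat_valued (T : nat -> W -> R) B : nat_valued (point_count T B).
Proof.
move=> w; rewrite /point_count; under eq_eseriesr do rewrite indicE.
exact: nat_series_valued.
Qed.

Lemma measurable_point_count (T : nat -> W -> R) B :
  (forall n, measurable_fun setT (T n)) -> measurable B ->
  measurable_fun setT (point_count T B).
Proof.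
move=> mT mB; apply: ge0_emeasurable_sum.
  by move=> n w _ _; rewrite lee_fin.
move=> n _; apply/measurable_EFinP.
by apply: (measurableT_comp (f := \1_B : R -> R)) => //; exact: measurable_indic.
Qed.

Lemma integral_indicr (mu : {measure set W -> \bar R}) (D : set W) (Y : W -> R) :
  \int[mu]_(w in D) (Y w)%:E = \int[mu]_w (Y w * \1_D w)%:E.
Proof.
rewrite integral_mkcond; apply: eq_integral => w _.
by rewrite epatch_indic.
Qed.

Variables (lam : R) (lam0 : (0 < lam)%R) (T : nat -> W -> R).
Hypothesis ppp : homogeneous_ppp P lam T.

Let mT n : measurable_fun setT (T n). Proof. exact: (ppp_measurable ppp). Qed.

Lemma ppp_laplace_counts (m : nat) (B : nat -> set R) (s : nat -> R) :
  (forall i, (i < m)%N -> measurable (B i)) ->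
  (forall i, (i < m)%N -> lebesgue_measure (B i) < +oo) ->
  (forall i j, (i < m)%N -> (j < m)%N -> i != j -> B i `&` B j = set0) ->
  (forall i, (0 < s i)%R) ->
  \int[P]_w (\prod_(0 <= i < m) expN ((s i)%:E * point_count T (B i) w))%:E =
  (\prod_(0 <= i < m)
     expR (- (lam * fine (lebesgue_measure (B i)) * (1 - expR (- s i)))))%:E.
Proof.
move=> mB Boo dB s0.
(* [laplace_of_masses] asks for a family over all of [nat]; the empty set fills the indices from [m]
   on. *)
pose B' i := if (i < m)%N then B i else set0.
have mB' i : measurable (B' i) by rewrite /B'; case: ifPn => // /mB.
have B'oo i : lebesgue_measure (B' i) < +oo.
  by rewrite /B'; case: ifPn => [/Boo//|_]; rewrite measure0.
have q0 i k : (0 <= fine (poisson_mass (lam * fine (lebesgue_measure (B' i))) k))%R.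
  by rewrite fine_ge0// poisson_mass_ge0.
have qfin i k : poisson_mass (lam * fine (lebesgue_measure (B' i))) k \is a fin_num.
  exact: fin_num_measure.
transitivity (\int[P]_w (\prod_(0 <= i < m) expN ((s i)%:E * point_count T (B' i) w))%:E).
  apply: eq_integral => w _; congr EFin; apply: eq_big_nat => i /andP[_ im].
  by rewrite /B' im.
rewrite (@laplace_of_masses _ _ _ P m (fun i => point_count T (B' i))
  (fun i k => fine (poisson_mass (lam * fine (lebesgue_measure (B' i))) k)) s
  (fun i => expR (- (lam * fine (lebesgue_measure (B' i)) * (1 - expR (- s i))))))//.
- by congr EFin; apply: eq_big_nat => i /andP[_ im]; rewrite /B' im.
- by move=> i; exact: measurable_point_count.
- by move=> i; exact: point_count_nat_valued.
- move=> i; rewrite -poisson_laplace//; last by rewrite mulr_ge0// ?fine_ge0// ltW.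
  by apply: eq_eseriesr => k _; rewrite EFinM fineK.
- move=> k.
  have tB : trivIset setT (fun i : 'I_m => B' i).
    apply/trivIsetP => i j _ _ ij; rewrite /B' !ltn_ord; exact: dB.
  have := ppp_independent ppp (fun i : 'I_m => mB' i) tB.
  move=> /(_ (index_enum 'I_m) (fun i => point_count T (B' i) @^-1` [set (k i)%:R%:E])).
  move=> /(_ (index_enum_uniq _)) H.
  rewrite big_mkord (big_morph EFin EFinM erefl).
  rewrite (_ : \bigcap_(i in _) _ = \bigcap_(i in [set` index_enum 'I_m])
    (point_count T (B' (i : 'I_m)) @^-1` [set (k i)%:R%:E])); last first.
    apply/seteqP; split => w h i /=; first by move=> _; apply: h; exact: ltn_ord.
    by move=> im; apply: (h (Ordinal im)); rewrite /= mem_index_enum.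
  rewrite H; last first.
    by move=> i _; exists [set (k i)%:R%:E] => //; rewrite setTI.
  apply: eq_bigr => i _; rewrite fineK//.
  by rewrite -(ppp_poisson ppp).
Qed.

(** The level 0 has to be left out, since it may have infinite Lebesgue measure; [F 0 = 0] makes
    this harmless. *)
Lemma sum_indic_levels (h : R -> R) (r : seq R) (F : R -> R) (t : R) :
  uniq r -> (forall x, x \in r -> x != 0)%R -> (h t != 0 -> h t \in r)%R ->
  F 0%R = 0%R ->
  F (h t) = (\sum_(x <- r) F x * \1_(h @^-1` [set x]) t)%R.
Proof.
move=> ur r0 hr F0; have [ht0|/hr htr] := eqVneq (h t) 0%R.
  rewrite ht0 F0 big_seq big1// => x xr; rewrite indicE memNset ?mulr0//= => htx.
  by move: (r0 _ xr); rewrite -htx ht0 eqxx.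
rewrite (bigD1_seq (h t))//= big1 ?addr0.
  by rewrite indicE mem_set ?mulr1.
by move=> x xh; rewrite indicE memNset ?mulr0//= => hx; rewrite hx eqxx in xh.
Qed.

(** The sum of [h] over the points is a combination of the counts on the nonzero level sets, which
    are disjoint and of finite measure. *)
Lemma ppp_laplace_simple (h : R -> R) :
  measurable_fun setT h -> (forall t, 0 <= h t)%R -> finite_set (range h) ->
  lebesgue_measure (~` (h @^-1` [set 0%R])) < +oo ->
  \int[P]_w (expN (\sum_(n <oo) (h (T n w))%:E))%:E =
  (expN (lam%:E * \int[lebesgue_measure]_t (1 - expR (- h t))%:E))%:E.
Proof.
move=> mh h0 /finite_seqP[r0 r0E] hoo.
pose r := [seq x <- undup r0 | (x != 0)%R].
have ur : uniq r by rewrite filter_uniq// undup_uniq.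
have rn0 x : x \in r -> (x != 0)%R by rewrite mem_filter => /andP[].
have hr t : (h t != 0 -> h t \in r)%R.
  move=> ht; rewrite mem_filter ht mem_undup.
  have : range h (h t) by exists t.
  by rewrite r0E.
have rpos x : x \in r -> (0 < x)%R.
  move=> xr; rewrite lt_neqAle eq_sym rn0//=.
  move: xr; rewrite mem_filter mem_undup => /andP[_ xr].
  have : [set` r0] x by [].
  by rewrite -r0E => -[t _ <-].
(* The default 1 keeps [s i] positive beyond the list of levels. *)
pose s i := nth 1%R r i.
have s0 i : (0 < s i)%R.
  rewrite /s; have [ir|ir] := ltnP i (size r); first by apply: rpos; exact: mem_nth.
  by rewrite nth_default.
pose B x := h @^-1` [set x].
have mB x : measurable (B x) by rewrite -[X in measurable X]setTI; exact: mh.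
have Boo x : x \in r -> lebesgue_measure (B x) < +oo.
  move=> xr; apply: le_lt_trans hoo; apply: le_measure; rewrite ?inE//.
    exact: (mB x).
    exact: (measurableC (mB 0%R)).
  by move=> t /= htx; rewrite htx => x0; move: (rn0 _ xr); rewrite x0 eqxx.
have level F t := @sum_indic_levels h r F t ur rn0 (@hr t).
transitivity (\int[P]_w (\prod_(0 <= i < size r) expN ((s i)%:E * point_count T (B (s i)) w))%:E).
  apply: eq_integral => w _; congr EFin.
  rewrite -(@expN_sum _ _ _ (fun i => (s i)%:E * point_count T (B (s i)) w)); last first.
    move=> i; apply: mule_ge0; first by rewrite lee_fin ltW.
    by apply: nat_valued_ge0; exact: point_count_nat_valued.
  congr expN.
  transitivity (\sum_(n <oo) \sum_(0 <= i < size r) ((s i)%:E * (\1_(B (s i)) (T n w))%:E)).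
    apply: eq_eseriesr => n _; rewrite (level id)// (big_nth 1%R) -sumEFin.
    by apply: eq_bigr => i _; rewrite EFinM.
  rewrite nneseries_sum_nat; last by move=> i n; rewrite mule_ge0// lee_fin// ltW.
  apply: eq_bigr => i _; by rewrite nneseriesZl.
rewrite (@ppp_laplace_counts (size r) (fun i => B (s i)) s)//; last 2 first.
- by move=> i ir; apply: Boo; exact: mem_nth.
- move=> i j ir jr ij; apply/seteqP; split => // t [hi hj].
  have /eqP : s i = s j := etrans (esym hi) hj.
  by rewrite /s nth_uniq// (negbTE ij).
congr EFin.
rewrite (_ : \int[_]_t _ = (\sum_(x <- r) (1 - expR (- x)) * fine (lebesgue_measure (B x)))%:E).
  rewrite -EFinM expN_EFin mulr_sumr [in RHS](big_nth 1%R) -sumrN expR_sum.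
  by apply: eq_bigr => i _; congr expR; rewrite /s; ring.
have e01 x : x \in r -> (0 <= 1 - expR (- x))%R.
  by move=> /rpos x0; rewrite subr_ge0 -expR0 ler_expR oppr_le0 ltW.
(* The absolute value changes nothing for levels in [r], but makes each summand nonnegative for
   every [x], as integration term by term requires. *)
transitivity (\int[lebesgue_measure]_t
    \sum_(x <- r) ((`|1 - expR (- x)| * \1_(B x) t)%R)%:E).
  apply: eq_integral => t _; rewrite sumEFin; congr EFin.
  rewrite (level (fun x => 1 - expR (- x))%R) ?oppr0 ?expR0 ?subrr// !big_seq.
  by apply: eq_bigr => x xr; rewrite ger0_norm// e01.
have mS x : measurable_fun setT (fun t => (`|1 - expR (- x)| * \1_(B x) t)%:E).
  by apply/measurable_EFinP; apply: measurable_funM => //; exact: measurable_indic.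
have S0 x t : setT t -> 0 <= (`|1 - expR (- x)| * \1_(B x) t)%:E.
  by move=> _; rewrite lee_fin mulr_ge0.
transitivity (\sum_(x <- r) \int[lebesgue_measure]_t (`|1 - expR (- x)| * \1_(B x) t)%:E).
  by rewrite ge0_integral_sum// => x *; first [exact: mS | exact: S0].
rewrite -sumEFin big_seq [RHS]big_seq; apply: eq_bigr => x xr.
under eq_integral do rewrite EFinM.
rewrite ge0_integralZl//; last first.
  by apply/measurable_EFinP; apply: measurable_indic; exact: mB.
rewrite integral_indic//; last exact: mB.
rewrite setIT EFinM ger0_norm ?e01// fineK//.
by rewrite ge0_fin_numE// Boo.
Qed.

Import HBNNSimple.

(** Monotone convergence for the counting measure on [nat]. *)
Lemma cvg_nneseries_ndecr (a : nat -> nat -> \bar R) (b : nat -> \bar R) :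
  (forall k n, 0 <= a k n) -> (forall n, {homo a^~ n : k l / (k <= l)%N >-> k <= l}) ->
  (forall n, a k n @[k --> \oo] --> b n) ->
  \sum_(n <oo) a k n @[k --> \oo] --> \sum_(n <oo) b n.
Proof.
move=> a0 nda ab.
have b0 n : 0 <= b n.
  rewrite -(cvg_lim _ (ab n))//; apply: lime_ge; first by apply/cvg_ex; exists (b n).
  exact: nearW.
under eq_fun do rewrite -ge0_integral_count//.
rewrite -ge0_integral_count//.
rewrite (_ : (\int[_]_t b t) = \int[counting]_n limn (a^~ n)); last first.
  by apply: eq_integral => n _; apply/esym/cvg_lim.
by apply: cvg_monotone_convergence.
Qed.

Lemma cvg_integral_le1 (Y : nat -> W -> R) (Y' : W -> R) :
  (forall n, measurable_fun setT (Y n)) -> (forall n w, 0 <= Y n w <= 1)%R ->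
  (forall w, Y n w @[n --> \oo] --> Y' w) ->
  \int[P]_w (Y n w)%:E @[n --> \oo] --> \int[P]_w (Y' w)%:E.
Proof.
move=> mY Y01 YY'; apply: (@dominated_cvg _ _ _ P setT measurableT _ _ (cst 1)).
- by move=> n; exact/measurable_EFinP.
- by move=> w _; apply/fine_cvgP; split; [exact: nearW|exact: YY'].
- by [].
- exact: finite_measure_integrable_cst.
- by move=> n w _; case/andP : (Y01 n w) => ? ?; rewrite lee_fin ger0_norm.
Qed.

(** The Laplace functional formula, obtained from simple functions by dominated convergence on the
    left and monotone convergence on the right. The integral may be infinite; the right-hand side is
    then 0. *)
Lemma ppp_laplace (psi : R -> R) :
  measurable_fun setT psi -> (forall t, 0 <= psi t)%R ->
  \int[P]_w (expN (\sum_(n <oo) (psi (T n w))%:E))%:E =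
  (expN (lam%:E * \int[lebesgue_measure]_t (1 - expR (- psi t))%:E))%:E.
Proof.
move=> mpsi psi0.
have mpsiE : measurable_fun setT (EFin \o psi) by exact/measurable_EFinP.
pose h_ := nnsfun_approx measurableT mpsiE.
pose I k : set R := `[(- k%:R)%R, k%:R]%classic.
(* Cutting off to [- k, k] gives the simple functions a support of finite measure and keeps the
   sequence increasing. *)
pose phi k t := (h_ k t * \1_(I k) t)%R.
have mphi k : measurable_fun setT (phi k).
  by apply: measurable_funM; [exact: measurable_funP|apply: measurable_indic; exact: measurable_itv].
have phi0 k t : (0 <= phi k t)%R by rewrite mulr_ge0.
have ndphi t k l : (k <= l)%N -> (phi k t <= phi l t)%R.
  move=> kl; rewrite ler_pM//; first exact/lefP/nd_nnsfun_approx.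
  rewrite !indicE ler_nat; case: (boolP (t \in I k)) => //.
  move=> /set_mem tk; rewrite mem_set//=; move: tk; rewrite /I /= !in_itv/= => /andP[a b].
  have kl' : (k%:R <= l%:R :> R)%R by rewrite ler_nat.
  by rewrite (le_trans _ a) ?lerN2// (le_trans b).
have cvphi t : phi k t @[k --> \oo] --> psi t.
  have : h_ k t @[k --> \oo] --> psi t.
    have /fine_cvgP[_] : EFin \o h_^~ t @ \oo --> (psi t)%:E.
      by apply: cvg_nnsfun_approx => //= x _; rewrite lee_fin.
    exact.
  apply: cvg_trans; apply: near_eq_cvg.
  near=> k; rewrite /phi indicE mem_set ?mulr1//= /I/= in_itv/= -ler_norml.
  near: k; exact: nbhs_infty_ger.
have simple k : \int[P]_w (expN (\sum_(n <oo) (phi k (T n w))%:E))%:E =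
    (expN (lam%:E * \int[lebesgue_measure]_t (1 - expR (- phi k t))%:E))%:E.
  apply: ppp_laplace_simple => //.
    apply: (@sub_finite_set _ _ ([set 0%R] `|` range (h_ k))); last first.
      by rewrite finite_setU; split => //; exact: fimfunP.
    move=> _ [t _ <-]; rewrite /phi indicE; case: (_ \in _); rewrite ?mulr0 ?mulr1.
      by right; exists t.
    by left.
  apply: (@le_lt_trans _ _ (lebesgue_measure (I k))); last first.
    by rewrite lebesgue_measure_itv/=; case: ifPn => // _; rewrite -EFinB ltry.
  apply: le_measure; rewrite ?inE//.
    by apply: measurableC; rewrite -[X in measurable X]setTI; exact: mphi.
    exact: measurable_itv.
  move=> t /=; apply: contra_notP => tI; rewrite /phi indicE memNset ?mulr0//.
have e01 k t : (0 <= 1 - expR (- phi k t))%R.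
  by rewrite subr_ge0 -expR0 ler_expR oppr_le0.
have lhs : \int[P]_w (expN (\sum_(n <oo) (phi k (T n w))%:E))%:E @[k --> \oo] -->
    \int[P]_w (expN (\sum_(n <oo) (psi (T n w))%:E))%:E.
  apply: cvg_integral_le1.
  - move=> k; apply: (measurableT_comp measurable_expN).
    apply: ge0_emeasurable_sum; first by move=> n w _ _; rewrite lee_fin.
    by move=> n _; apply/measurable_EFinP; exact: measurableT_comp.
  - by move=> k w; rewrite expN_ge0 expN_le1// nneseries_ge0// => n _ _; rewrite lee_fin.
  - move=> w; apply: cvg_expN.
      by move=> k; rewrite nneseries_ge0// => n _ _; rewrite lee_fin.
    apply: cvg_nneseries_ndecr.
    + by move=> k n; rewrite lee_fin.
    + by move=> n k l kl; rewrite lee_fin ndphi.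
    + by move=> n; apply/fine_cvgP; split; [exact: nearW|exact: cvphi].
have rhs : (expN (lam%:E * \int[lebesgue_measure]_t (1 - expR (- phi k t))%:E))%:E @[k --> \oo] -->
    (expN (lam%:E * \int[lebesgue_measure]_t (1 - expR (- psi t))%:E))%:E.
  apply/fine_cvgP; split; first exact: nearW.
  apply: cvg_expN.
    move=> k; rewrite mule_ge0 ?lee_fin ?(ltW lam0)// integral_ge0// => t _.
    by rewrite lee_fin.
  apply: cvgeZl => //.
  rewrite [X in _ --> X](_ : _ = \int[lebesgue_measure]_t
      limn (fun k => (1 - expR (- phi k t))%:E)); last first.
    apply: eq_integral => t _; apply/esym/cvg_lim => //.
    apply/fine_cvgP; split; first exact: nearW.
    have ecv : expR (- phi k t) @[k --> \oo] --> expR (- psi t).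
      apply: continuous_cvg; first exact: continuous_expR.
      by apply: cvgN; exact: cvphi.
    by apply: cvgB; [exact: cvg_cst|exact: ecv].
  apply: cvg_monotone_convergence => //.
  - move=> k; apply/measurable_EFinP; apply: measurable_funB => //.
    exact: (measurableT_comp (@measurable_expR R) (measurable_funN (mphi k))).
  - by move=> k t _; rewrite lee_fin.
  - by move=> t _ k l kl; rewrite lee_fin lerB// ler_expR lerN2 ndphi.
move: lhs; rewrite (funext simple) => lhs.
exact: (cvg_unique (@ereal_hausdorff R) lhs rhs).
Unshelve. all: by end_near. Qed.

End point_process_laplace.

(** * Integrating out independent marks *)

Section marked_points.
Local Open Scope ereal_scope.
Context d (W : measurableType d) (R : realType) (P : probability W R).
Variables (T : nat -> W -> R) (M : nat -> W -> \bar R) (pi : probability (\bar R) R).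

Definition births_algebra : set (set W) := <<s \bigcup_n generated_by (T n) >>.

Hypothesis mT : forall n, measurable_fun setT (T n).
Hypothesis mM : forall n, measurable_fun setT (M n).
Hypothesis marks_independent : forall (N : nat) (A : set W) (C : nat -> set (\bar R)),
  births_algebra A -> (forall n, measurable (C n)) ->
  P (A `&` \bigcap_(n in [set n | (n < N)%N]) (M n @^-1` C n)) =
  P A * \prod_(0 <= n < N) pi (C n).

Let births_measurable A : births_algebra A -> measurable A.
Proof.
apply: smallest_sub; first exact: sigma_algebra_measurable.
by move=> B [n _ [C mC <-]]; exact: mT.
Qed.

Let birthsI A B : births_algebra A -> births_algebra B -> births_algebra (A `&` B).
Proof. exact: (@measurableI _ (g_sigma_algebraType (\bigcup_n generated_by (T n)))). Qed.

Let births_preimage n B : measurable B -> births_algebra (T n @^-1` B).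
Proof.
move=> mB; apply: sub_sigma_algebra; exists n => //.
by exists B => //; rewrite setTI.
Qed.

Let births_setT : births_algebra setT.
Proof. exact: (@measurableT _ (g_sigma_algebraType (\bigcup_n generated_by (T n)))). Qed.

Lemma integral_prod_marks (f : R * \bar R -> R) (N : nat) :
  measurable_fun setT f -> (forall z, 0 <= f z <= 1)%R ->
  \int[P]_w (\prod_(0 <= n < N) f (T n w, M n w))%:E =
  \int[P]_w (\prod_(0 <= n < N) fine (\int[pi]_m (f (T n w, m))%:E))%:E.
Proof.
move=> mf f01.
have f0 z : (0 <= f z)%R by case/andP : (f01 z).
pose g t := fine (\int[pi]_m (f (t, m))%:E).
have mf2 t : measurable_fun setT (fun m => f (t, m)) by exact: measurable_fun_pair2.
have g_int t : 0 <= \int[pi]_m (f (t, m))%:E <= 1.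
  apply/andP; split; first by apply: integral_ge0 => m _; rewrite lee_fin.
  exact: integral_le1.
have gE t : \int[pi]_m (f (t, m))%:E = (g t)%:E.
  have /andP[a b] := g_int t; rewrite /g fineK// ge0_fin_numE//.
  exact: le_lt_trans b (ltry 1).
have g01 t : (0 <= g t <= 1)%R by rewrite -!lee_fin -gE.
have mg : measurable_fun setT g.
  apply/measurable_EFinP; rewrite (_ : _ \o _ = fun t => \int[pi]_m (f (t, m))%:E).
    apply: (@measurable_fun_fubini_tonelli_F _ _ _ _ _ pi (EFin \o f)) => //.
      exact/measurable_EFinP.
  by apply/funext => t; rewrite gE.
have piE C : pi C = (fine (pi C))%:E \/ ~ measurable C.
  by have [mC|] := pselect (measurable C); [left; rewrite fineK// fin_num_measure|right].
have pi01 C : measurable C -> (0 <= fine (pi C) <= 1)%R.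
  move=> mC; have [E|//] := piE C.
  by rewrite -!lee_fin -E measure_ge0/=; exact: probability_le1.
have mTM n : measurable_fun setT (fun w => f (T n w, M n w)).
  by apply: (measurableT_comp mf); exact: measurable_fun_pair.
have mgT n : measurable_fun setT (fun w => g (T n w)) by exact: measurableT_comp.
(* The indicator of [A] absorbs the events [T r \in B] that arise when the
   product measure is tested on rectangles. *)
have claim r : (r <= N)%N -> forall A (C : nat -> set (\bar R)),
    births_algebra A -> (forall n, measurable (C n)) ->
    \int[P]_w ((\prod_(0 <= n < r) f (T n w, M n w)) * \1_A w *
      \prod_(r <= n < N) \1_(M n @^-1` C n) w)%:E =
    \int[P]_w ((\prod_(0 <= n < r) g (T n w)) * \1_A w *
      \prod_(r <= n < N) fine (pi (C n)))%:E.
  elim: r => [_ A C bA mC|r IH rN A C bA mC].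
    under eq_integral do rewrite big_nil mul1r prod_indic.
    under [RHS]eq_integral do rewrite big_nil mul1r mulrC EFinM.
    rewrite ge0_integralZl//; last 2 first.
      by apply/measurable_EFinP; apply: measurable_indic; exact: births_measurable.
      by rewrite lee_fin prodr_ge0// => n _; case/andP : (pi01 _ (mC n)).
    have mI : measurable (\bigcap_(n in [set n | (n < N)%N]) (M n @^-1` C n)).
      apply: bigcap_measurableType => n _.
      by rewrite -[X in measurable X]setTI; exact: mM.
    under eq_integral do rewrite indicM.
    transitivity (P (A `&` \bigcap_(n in [set n | (n < N)%N]) (M n @^-1` C n))).
      rewrite integral_indic ?setIT//.
      by apply: measurableI => //; exact: births_measurable.
    rewrite marks_independent// integral_indic ?setIT//; last exact: births_measurable.
    rewrite muleC; congr (_ * _).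
    rewrite (big_morph EFin EFinM erefl); apply: eq_bigr => n _.
    by have [//|] := piE (C n); case.
  have mC1 n : measurable_fun setT (\1_(M n @^-1` C n) : W -> R).
    apply: measurable_indic.
    by rewrite -[X in measurable X]setTI; exact: mM.
  have mA : measurable_fun setT (\1_A : W -> R).
    by apply: measurable_indic; exact: births_measurable.
  pose Y w := ((\prod_(0 <= n < r) f (T n w, M n w)) * \1_A w *
    \prod_(r.+1 <= n < N) \1_(M n @^-1` C n) w)%R.
  pose Y' w := ((\prod_(0 <= n < r) g (T n w)) * \1_A w *
    \prod_(r.+1 <= n < N) fine (pi (C n)))%R.
  have pf01 w : (0 <= \prod_(0 <= n < r) f (T n w, M n w) <= 1)%R.
    by rewrite prodr_ge0//= prodr_ile1.
  have pg01 w : (0 <= \prod_(0 <= n < r) g (T n w) <= 1)%R.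
    rewrite prodr_ge0/= ?prodr_ile1// => n _; by case/andP : (g01 (T n w)).
  have i01 (B : set W) w : (0 <= (\1_B w : R) <= 1)%R.
    by rewrite indicE; case: (_ \in _); rewrite ?lexx ?ler01.
  transitivity (\int[P]_w ((f (T r w, M r w))%:E * (Y w)%:E)).
    apply: eq_integral => w _; rewrite -EFinM; congr EFin.
    by rewrite big_nat_recr//= /Y; ring.
  rewrite (@integral_weighted_independence _ _ _ _ _ _ _ P Y Y' (T r) (M r) pi (EFin \o f))//=.
  - apply: eq_integral => w _; rewrite gE -EFinM; congr EFin.
    by rewrite [in RHS]big_nat_recr//= /Y'; ring.
  - apply: measurable_funM; first apply: measurable_funM => //.
      by apply: measurable_prod.
    by apply: measurable_prod.
  - move=> w; rewrite !mulr_ge0//; first by case/andP : (pf01 w).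
    by rewrite prodr_ge0.
  - apply: measurable_funM => //; apply: measurable_funM => //.
    by apply: measurable_prod.
  - move=> w; have /andP[a b] := pg01 w; have /andP[c e] := i01 A w.
    have /andP[h k] : (0 <= \prod_(r.+1 <= n < N) fine (pi (C n)) <= 1)%R.
      rewrite prodr_ge0/= ?prodr_ile1// => n _; first exact: pi01.
      by case/andP : (pi01 _ (mC n)).
    by rewrite !mulr_ge0//= mulr_ile1 ?mulr_ge0// mulr_ile1.
  - move=> B D mB mD.
    (* To test the rectangle [B], [D], the induction hypothesis is applied with [B] merged into [A]
       and [D] as the set for mark [r]. *)
    pose C' n := if n == r then D else C n.
    have mC' n : measurable (C' n) by rewrite /C'; case: ifP.
    have H := IH (ltnW rN) _ _ (birthsI bA (births_preimage r mB)) mC'.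
    rewrite (integral_indicr P (T r @^-1` B `&` M r @^-1` D)).
    rewrite (integral_indicr P (T r @^-1` B)).
    transitivity (\int[P]_w ((\prod_(0 <= n < r) f (T n w, M n w)) *
        \1_(A `&` T r @^-1` B) w * \prod_(r <= n < N) \1_(M n @^-1` C' n) w)%:E).
      apply: eq_integral => w _; congr EFin; rewrite (big_ltn rN) /C' eqxx -!indicM.
      rewrite (_ : \prod_(r.+1 <= n < N) _ = \prod_(r.+1 <= n < N) \1_(M n @^-1` C n) w)%R.
        by rewrite /Y; ring.
      by apply: eq_big_nat => i /andP[ri _]; rewrite gtn_eqF.
    rewrite {}H.
    have [piD|//] := piE D; rewrite [pi D]piD muleC.
    have mY'1 : measurable_fun setT (fun w => (Y' w * \1_(T r @^-1` B) w)%:E).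
      apply/measurable_EFinP; apply: measurable_funM.
        apply: measurable_funM => //; apply: measurable_funM => //.
        by apply: measurable_prod.
      by apply: measurable_indic; rewrite -[X in measurable X]setTI; exact: mT.
    have Y'10 w : setT w -> 0 <= (Y' w * \1_(T r @^-1` B) w)%:E.
      move=> _; rewrite lee_fin /Y' !mulr_ge0//; first by case/andP : (pg01 w).
      by rewrite prodr_ge0// => n _; case/andP : (pi01 _ (mC n)).
    have D0 : 0 <= (fine (pi D))%:E by rewrite lee_fin; case/andP : (pi01 _ mD).
    rewrite -(ge0_integralZl P measurableT mY'1 Y'10 D0).
    apply: eq_integral => w _; rewrite -EFinM; congr EFin; rewrite (big_ltn rN) /C' eqxx -!indicM.
    rewrite (_ : \prod_(r.+1 <= n < N) fine _ = \prod_(r.+1 <= n < N) fine (pi (C n)))%R.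
      by rewrite /Y'; ring.
    by apply: eq_big_nat => i /andP[ri _]; rewrite gtn_eqF.
  - exact/measurable_EFinP.
have := claim N (leqnn N) _ (fun=> setT) births_setT (fun=> measurableT).
under eq_integral do rewrite (big_geq (leqnn N)) indicT !mulr1.
by under [X in _ = X -> _]eq_integral do rewrite (big_geq (leqnn N)) indicT !mulr1.
Qed.

End marked_points.

(** * Laplace transform of the displaced counts *)

Lemma lebesgue_measure_translation (R : realType) (a : R) (B : set R) :
  measurable B ->
  lebesgue_measure ((fun t => t + a) @^-1` B) = lebesgue_measure B.
Proof.
have ma : measurable_fun [set: measurableTypeR R]
    ((fun t => t + a) : measurableTypeR R -> measurableTypeR R).
  exact: measurable_funD.
move=> mB; apply/esym.
pose mu := measure_function_pushforward__canonical__measure_function_Measure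
  (@lebesgue_measure R) ma.
apply: (@lebesgue_measure_unique R mu) => // _ [[x y] /= xy <-].
rewrite /mu/= /pushforward.
rewrite (_ : _ @^-1` _ = `]x - a, y - a]%classic); last first.
  apply/seteqP; split => t /=; rewrite !in_itv/=; lra.
by rewrite !lebesgue_measure_itv/= !lte_fin ltrD2r -!EFinD; case: ifP => // _; congr EFin; ring.
Qed.

(** At most one indicator is nonzero at [x]. It serves with F(x) = 1 - exp(- x), to linearize the
    exponent. *)
Lemma sum_indic_disjoint (R : realType) (T : Type) (m : nat) (B : nat -> set T)
    (s : nat -> R) (F : R -> R) (x : T) :
  (forall i j, (i < m)%N -> (j < m)%N -> i != j -> B i `&` B j = set0) ->
  F 0 = 0 ->
  F (\sum_(0 <= i < m) s i * \1_(B i) x) = \sum_(0 <= i < m) F (s i) * \1_(B i) x.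
Proof.
move=> dB F0; have [[i im Bi]|nB] := pselect (exists2 i, (i < m)%N & B i x).
  have E G : \sum_(0 <= j < m) G j * \1_(B j) x = G i :> R.
    rewrite (bigD1_seq i)/= ?iota_uniq ?mem_index_iota//.
    rewrite indicE mem_set// mulr1 big_seq_cond big1 ?addr0// => j /andP[].
    rewrite mem_index_iota => /andP[_ jm] ji.
    rewrite indicE memNset ?mulr0// => Bj.
    by have := dB _ _ jm im ji; rewrite -subset0 => /(_ x); apply.
  by rewrite (E s) (E (F \o s)).
have E G : \sum_(0 <= j < m) G j * \1_(B j) x = 0 :> R.
  rewrite big_nat big1// => j /andP[_ jm].
  by rewrite indicE memNset ?mulr0// => Bj; apply: nB; exists j.
by rewrite (E s) (E (F \o s)).
Qed.

Section displaced_points.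
Local Open Scope ereal_scope.
Context d (W : measurableType d) (R : realType) (P : probability W R).
Variables (lam : R) (lam0 : (0 < lam)%R).
Variables (T : nat -> W -> R) (M : nat -> W -> \bar R) (pi : probability (\bar R) R).

Hypothesis ppp : homogeneous_ppp P lam T.
Hypothesis mM : forall n, measurable_fun setT (M n).
Hypothesis marks_independent : forall (N : nat) (A : set W) (C : nat -> set (\bar R)),
  births_algebra T A -> (forall n, measurable (C n)) ->
  P (A `&` \bigcap_(n in [set n | (n < N)%N]) (M n @^-1` C n)) =
  P A * \prod_(0 <= n < N) pi (C n).

Let mT n : measurable_fun setT (T n). Proof. exact: (ppp_measurable ppp). Qed.

(** Taking the image of [B] in the extended reals discards the points whose mark is infinite. *)
Definition displaced_count (B : set R) (w : W) : \bar R :=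
  \sum_(n <oo) (\1_(EFin @` B) ((T n w)%:E + M n w))%:E.

Lemma displaced_count_nat_valued B : nat_valued (displaced_count B).
Proof.
move=> w; rewrite /displaced_count; under eq_eseriesr do rewrite indicE.
exact: nat_series_valued.
Qed.

Lemma measurable_displaced (n : nat) :
  measurable_fun setT (fun w => (T n w)%:E + M n w).
Proof. by apply: emeasurable_funD => //; exact/measurable_EFinP. Qed.

Lemma measurable_displaced_count B : measurable B ->
  measurable_fun setT (displaced_count B).
Proof.
move=> mB; apply: ge0_emeasurable_sum.
  by move=> n w _ _; rewrite lee_fin.
move=> n _; apply/measurable_EFinP.
apply: (measurableT_comp (f := \1_(EFin @` B) : \bar R -> R)).
  by apply: measurable_indic; exact: measurable_image_EFin.
exact: measurable_displaced.
Qed.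

Let p := fine (pi [set m | m \is a fin_num]).

Lemma displaced_laplace (m : nat) (B : nat -> set R) (s : nat -> R) :
  (forall i, measurable (B i)) ->
  (forall i, lebesgue_measure (B i) < +oo) ->
  (forall i j, (i < m)%N -> (j < m)%N -> i != j -> B i `&` B j = set0) ->
  (forall i, (0 < s i)%R) ->
  \int[P]_w (\prod_(0 <= i < m) expN ((s i)%:E * displaced_count (B i) w))%:E =
  (\prod_(0 <= i < m)
     expR (- (lam * p * fine (lebesgue_measure (B i)) * (1 - expR (- s i)))))%:E.
Proof.
move=> mB Boo dB s0.
pose B' i := [set z : R * \bar R | (EFin @` (B i)) (z.1%:E + z.2)].
have madd : measurable_fun setT (fun z : R * \bar R => z.1%:E + z.2).
  apply: emeasurable_funD; last exact: measurable_snd.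
  by apply/measurable_EFinP; exact: measurable_fst.
have mB' i : measurable (B' i).
  rewrite -[B' i]setTI; apply: madd => //; apply: measurable_image_EFin; exact: mB.
have dB' i j : (i < m)%N -> (j < m)%N -> i != j -> B' i `&` B' j = set0.
  move=> im jm ij; apply/seteqP; split => // z [[b Bb bz] [c Bc cz]].
  have [bc] : b%:E = c%:E := etrans bz (esym cz).
  by have := dB _ _ im jm ij; rewrite -subset0 => /(_ b); apply; split; rewrite // bc.
pose h z := (\sum_(0 <= i < m) s i * \1_(B' i) z)%R.
have mIB i : measurable_fun setT (\1_(B' i) : R * \bar R -> R).
  by apply: measurable_indic; exact: mB'.
have mh : measurable_fun setT h.
  by apply: measurable_sum => i; apply: measurable_funM.
have mfin : measurable [set x : \bar R | x \is a fin_num].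
  by rewrite -[X in measurable X]setTI; apply: emeasurable_fin_num => //; exact: measurable_id.
have h0 z : (0 <= h z)%R by apply: sumr_ge0 => i _; rewrite mulr_ge0// ltW.
have hS z : (h z <= \sum_(0 <= i < m) s i)%R.
  apply: ler_sum => i _; apply: ler_piMr; first by rewrite ltW.
  by rewrite indicE -[leRHS]/(1%:R)%R ler_nat leq_b1.
pose f z := expR (- h z).
have mf : measurable_fun setT f.
  exact: (measurableT_comp (@measurable_expR R) (measurable_funN mh)).
have f01 z : (0 <= f z <= 1)%R.
  by rewrite expR_ge0/= -expR0 ler_expR oppr_le0.
have f0 z : (0 <= f z)%R by rewrite expR_ge0.
pose g t := fine (\int[pi]_m (f (t, m))%:E).
have mf2 t : measurable_fun setT (fun m => f (t, m)) by exact: measurable_fun_pair2.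
have g_int t : 0 <= \int[pi]_m (f (t, m))%:E <= 1.
  apply/andP; split; first by apply: integral_ge0 => x _; rewrite lee_fin.
  exact: integral_le1.
have gE t : \int[pi]_m (f (t, m))%:E = (g t)%:E.
  have /andP[a b] := g_int t; rewrite /g fineK// ge0_fin_numE//.
  exact: le_lt_trans b (ltry 1).
have g01 t : (0 <= g t <= 1)%R by rewrite -!lee_fin -gE.
have mg : measurable_fun setT g.
  apply/measurable_EFinP; rewrite (_ : _ \o _ = fun t => \int[pi]_m (f (t, m))%:E).
    apply: (@measurable_fun_fubini_tonelli_F _ _ _ _ _ pi (EFin \o f)) => //.
    exact/measurable_EFinP.
  by apply/funext => t; rewrite gE.
(* The logarithm below requires [g] to be positive: [h] is bounded by the sum of the [s i], so [f]
   stays away from 0. *)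
have g_gt0 t : (0 < g t)%R.
  apply: (@lt_le_trans _ _ (expR (- \sum_(0 <= i < m) s i)%R)); first exact: expR_gt0.
  rewrite -lee_fin -gE.
  have <- : \int[pi]_x (cst (expR (- \sum_(0 <= i < m) s i))%:E x) =
      (expR (- \sum_(0 <= i < m) s i))%:E.
    by rewrite integral_cst//= [X in _ * X](@probability_setT _ _ _ pi) mule1.
  apply: ge0_le_integral => //.
  - by move=> x _; rewrite lee_fin expR_ge0.
  - exact/measurable_EFinP.
  - by move=> x _; rewrite lee_fin ler_expR lerN2.
pose psi t := (- ln (g t))%R.
have psi0 t : (0 <= psi t)%R by rewrite oppr_ge0 ln_le0//; case/andP : (g01 t).
have gpsi t : g t = expR (- psi t) by rewrite opprK lnK// posrE.
have mpsi : measurable_fun setT psi.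
  by apply: measurable_funN; apply: measurableT_comp.
have mTM n : measurable_fun setT (fun w => f (T n w, M n w)).
  by apply: (measurableT_comp mf); exact: measurable_fun_pair.
have mgT n : measurable_fun setT (fun w => g (T n w)) by exact: measurableT_comp.
have cvf : \int[P]_w (\prod_(0 <= n < N) f (T n w, M n w))%:E @[N --> \oo] -->
    \int[P]_w (expN (\sum_(n <oo) (h (T n w, M n w))%:E))%:E.
  apply: cvg_integral_le1.
  - by move=> N; apply: measurable_prod.
  - by move=> N w; rewrite prodr_ge0//= prodr_ile1.
  - by move=> w; exact: (cvg_expN_series (fun n => h0 (T n w, M n w))).
have cvgs : \int[P]_w (\prod_(0 <= n < N) g (T n w))%:E @[N --> \oo] -->
    \int[P]_w (expN (\sum_(n <oo) (psi (T n w))%:E))%:E.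
  apply: cvg_integral_le1.
  - by move=> N; apply: measurable_prod.
  - by move=> N w; rewrite prodr_ge0/= ?prodr_ile1// => n _; rewrite ltW.
  - move=> w; under eq_fun do under eq_bigr do rewrite gpsi.
    exact: (cvg_expN_series (fun n => psi0 (T n w))).
(* The marks are averaged out for the first [N] particles; both sides then converge as [N] tends to
   infinity. *)
have fg N : \int[P]_w (\prod_(0 <= n < N) f (T n w, M n w))%:E =
    \int[P]_w (\prod_(0 <= n < N) g (T n w))%:E.
  exact: (integral_prod_marks mT mM marks_independent).
move: cvf; rewrite (funext fg) => cvf.
have := cvg_unique (@ereal_hausdorff R) cvf cvgs.
rewrite (ppp_laplace lam0 ppp mpsi psi0) => H.
transitivity (\int[P]_w (expN (\sum_(n <oo) (h (T n w, M n w))%:E))%:E).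
  apply: eq_integral => w _; congr EFin.
  rewrite -(@expN_sum _ _ _ (fun i => (s i)%:E * displaced_count (B i) w)); last first.
    move=> i; apply: mule_ge0; first by rewrite lee_fin ltW.
    by apply: nat_valued_ge0; exact: displaced_count_nat_valued.
  congr expN.
  transitivity (\sum_(n <oo) \sum_(0 <= i < m)
      ((s i)%:E * (\1_(EFin @` B i) ((T n w)%:E + M n w))%:E)); last first.
    by apply: eq_eseriesr => n _; rewrite -sumEFin; apply: eq_bigr => i _; rewrite -EFinM.
  rewrite nneseries_sum_nat; last by move=> i n; rewrite mule_ge0// lee_fin// ltW.
  by apply: eq_bigr => i _; rewrite nneseriesZl.
rewrite H; congr EFin.
have e01 i : (0 <= 1 - expR (- s i))%R.
  by rewrite subr_ge0 -expR0 ler_expR oppr_le0 ltW.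
have fE z : (1 - f z = \sum_(0 <= i < m) (1 - expR (- s i)) * \1_(B' i) z :> R)%R.
  rewrite /f /h (@sum_indic_disjoint _ _ m B' s (fun x => 1 - expR (- x))%R)//.
  by rewrite oppr0 expR0 subrr.
rewrite (_ : \int[_]_t _ =
    (\sum_(0 <= i < m) (1 - expR (- s i)) * (p * fine (lebesgue_measure (B i))))%:E).
  rewrite -EFinM expN_EFin mulr_sumr -sumrN expR_sum.
  by apply: eq_bigr => i _; congr expR; ring.
transitivity (\int[lebesgue_measure]_t \int[pi]_x (1 - f (t, x))%:E).
  apply: eq_integral => t _; rewrite -gpsi.
  under [RHS]eq_integral do rewrite EFinB.
  rewrite integralB_EFin//=; last 2 first.
  - exact: finite_measure_integrable_cst.
  - apply/integrableP; split; first exact/measurable_EFinP.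
    under eq_integral do rewrite gee0_abs ?lee_fin//.
    by rewrite gE ltry.
  by rewrite integral_cst// mul1e [X in X - _](@probability_setT _ _ _ pi) gE.
have m1f : measurable_fun setT (fun z => (1 - f z)%:E).
  by apply/measurable_EFinP; apply: measurable_funB.
have f1 z : 0 <= (1 - f z)%:E by rewrite lee_fin subr_ge0; case/andP : (f01 z).
(* After the exchange the birth time is integrated first, with the mark held fixed. *)
rewrite (@fubini_tonelli _ _ _ _ _ lebesgue_measure pi (fun z => (1 - f z)%:E))//.
have mB'1 (x : \bar R) i : measurable_fun setT (fun t : R => (\1_(B' i) (t, x) : R)%:E).
  have pairm : measurable_fun [set: R] (fun t : R => (t, x)).
    exact: measurable_fun_pair.
  by apply/measurable_EFinP; exact: (measurableT_comp (mIB i) pairm).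
transitivity (\int[pi]_x \sum_(0 <= i < m)
    ((1 - expR (- s i))%:E * ((fine (lebesgue_measure (B i)))%:E * (\1_[set m : \bar R | m \is a fin_num] x : R)%:E))).
  apply: eq_integral => x _.
  under eq_integral.
    move=> t _; rewrite fE -sumEFin.
    under eq_bigr do rewrite EFinM.
    over.
  have A1 i : measurable_fun setT
      (fun t : R => (1 - expR (- s i))%:E * (\1_(B' i) (t, x) : R)%:E).
    by apply: measurable_funeM; exact: mB'1.
  rewrite ge0_integral_sum; [|by []|by move=> i; exact: A1|
    by move=> i t _; rewrite mule_ge0// lee_fin].
  apply: eq_bigr => i _.
  rewrite ge0_integralZl; [|by []|exact: mB'1|by move=> *; rewrite lee_fin|by rewrite lee_fin].
  congr (_ * _).
  (* For a finite mark the section in [t] is a translate of [B i]; for an infinite one it is empty.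
     This is how the factor [p] arises. *)
  case: x A1 => [x||] _; last 2 first.
  - rewrite indicE memNset// mule0 integral0_eq// => t _; rewrite indicE memNset//=.
    by rewrite /B'/= => -[b _]; rewrite addey.
  - rewrite indicE memNset// mule0 integral0_eq// => t _; rewrite indicE memNset//=.
    by rewrite /B'/= => -[b _].
  rewrite indicE mem_set// mule1 fineK; last by rewrite ge0_fin_numE.
  rewrite -(lebesgue_measure_translation x (mB i)) -[in RHS](setIT (_ @^-1` _)).
  rewrite -integral_indic//; last first.
    by rewrite -[X in measurable X]setTI; apply: measurable_funD.
  apply: eq_integral => t _; rewrite !indicE; congr ((nat_of_bool _)%:R%:E).
  apply/idP/idP => /set_mem H'; apply/mem_set.
    case: H' => b Bb bE; have [bE'] : b%:E = (t + x)%:E by rewrite bE.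
    by rewrite /= -bE'.
  by exists (t + x)%R.
have A2 : measurable_fun setT
    (fun x : \bar R => (\1_[set m : \bar R | m \is a fin_num] x : R)%:E).
  by apply/measurable_EFinP; exact: measurable_indic.
rewrite ge0_integral_sum; [|by []|by move=> i; do 2 apply: measurable_funeM|
  by move=> i x _; rewrite !mule_ge0// lee_fin// fine_ge0].
rewrite -sumEFin; apply: eq_bigr => i _.
under eq_integral do rewrite muleA.
rewrite ge0_integralZl; [|by []|exact: A2|by move=> *; rewrite lee_fin|
  by rewrite mule_ge0// lee_fin// fine_ge0].
rewrite integral_indic//.
rewrite setIT -muleA EFinM; congr (_ * _).
rewrite muleC EFinM; congr (_ * _); rewrite fineK// fin_num_measure//.
Qed.

End displaced_points.

(** * From displaced counts to a Poisson process *)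

(** A point at or before [t] remains counted or uncounted when the interval grows, and a point after
    [t] is not reached by times close enough to [t]. *)
Lemma near_indic_right (R : realType) (x : \bar R) (t : R) :
  \forall s \near t^'+, (\1_(EFin @` `[0%R, s]) x : R) = \1_(EFin @` `[0%R, t]) x.
Proof.
have E s : (\1_(EFin @` `[0%R, s]) x : R) = ((0 <= x)%E && (x <= s%:E)%E)%:R.
  rewrite indicE; congr ((nat_of_bool _)%:R); apply/idP/idP.
    by move=> /set_mem[r /=]; rewrite in_itv/= => /andP[a b] <-; rewrite !lee_fin a b.
  move=> /andP[x0 xs]; apply/mem_set; exists (fine x).
    rewrite /= in_itv/= fine_ge0//=; move: x0 xs; case: x => //= r.
  by rewrite fineK// ge0_fin_numE// (le_lt_trans xs)// ltry.
have [xt|tx] := leP x t%:E.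
  near=> s; rewrite !E xt (le_trans xt)// lee_fin; near: s; exact: nbhs_right_ge.
case: x E tx => [r| |//] E tx; last first.
  by near=> s; rewrite !E /= !leye_eq.
have /negbTE rt : ~~ (r%:E <= t%:E)%E by rewrite -ltNge.
near=> s; have /negbTE rs : ~~ (r%:E <= s%:E)%E.
  by rewrite -ltNge lte_fin; near: s; exact: nbhs_right_lt.
by rewrite !E rt rs.
Unshelve. all: by end_near. Qed.

Section almost_sure_equality.
Local Open Scope ereal_scope.
Context d (W : measurableType d) (R : realType) (P : probability W R).

Lemma ae_eq_probability (A B : set W) : measurable A -> measurable B ->
  {ae P, forall w, A w <-> B w} -> P A = P B.
Proof.
move=> mA mB AB; rewrite -[A]setIT -[B]setIT -!integral_indic//.
apply: ge0_ae_eq_integral => //.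
- by apply/measurable_EFinP; exact: measurable_indic.
- by apply/measurable_EFinP; exact: measurable_indic.
apply: filterS AB => w AB _; rewrite !indicE; congr ((nat_of_bool _)%:R%:E).
by apply/idP/idP => /set_mem h; apply/mem_set/AB.
Qed.

Lemma probability1_ae (A : set W) : measurable A -> P A = 1 ->
  {ae P, forall w, A w}.
Proof.
move=> mA PA; exists (~` A); split; first exact: measurableC.
  by rewrite probability_setC// PA subee.
by [].
Qed.

End almost_sure_equality.

Section displaced_poisson_process.
Local Open Scope ereal_scope.
Context d (W : measurableType d) (R : realType) (P : probability W R).
Variables (lam : R) (lam0 : (0 < lam)%R).
Variables (T : nat -> W -> R) (M : nat -> W -> \bar R) (pi : probability (\bar R) R).

Hypothesis ppp : homogeneous_ppp P lam T.
Hypothesis mM : forall n, measurable_fun setT (M n).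
Hypothesis marks_independent : forall (N : nat) (A : set W) (C : nat -> set (\bar R)),
  births_algebra T A -> (forall n, measurable (C n)) ->
  P (A `&` \bigcap_(n in [set n | (n < N)%N]) (M n @^-1` C n)) =
  P A * \prod_(0 <= n < N) pi (C n).

Let mT n : measurable_fun setT (T n). Proof. exact: (ppp_measurable ppp). Qed.

Let p := fine (pi [set m | m \is a fin_num]).
Let p0 : (0 <= p)%R. Proof. exact: fine_ge0. Qed.
Let rate := (lam * p)%R.
Let rate0 : (0 <= rate)%R. Proof. by rewrite mulr_ge0// ltW. Qed.

Local Notation dc := (displaced_count T M).
Let mdc B : measurable B -> measurable_fun setT (dc B).
Proof. exact: (measurable_displaced_count ppp mM). Qed.

Lemma displaced_law (m : nat) (B : nat -> set R) :
  (forall i, measurable (B i)) ->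
  (forall i, lebesgue_measure (B i) < +oo) ->
  (forall i j, (i < m)%N -> (j < m)%N -> i != j -> B i `&` B j = set0) ->
  forall C : nat -> set nat,
    P (\bigcap_(i in [set i | (i < m)%N]) value_in (dc (B i)) (C i)) =
    \prod_(0 <= i < m) poisson_prob (rate * fine (lebesgue_measure (B i))) 0%N (C i).
Proof.
move=> mB Boo dB C.
have r0 i : (0 <= rate * fine (lebesgue_measure (B i)))%R.
  by rewrite mulr_ge0// fine_ge0.
apply: (@law_of_laplace _ _ _ P m (fun i => dc (B i))
  (fun i => poisson_prob (rate * fine (lebesgue_measure (B i))) 0%N)
  (fun i s => expR (- (rate * fine (lebesgue_measure (B i)) * (1 - expR (- s))))%R)).
- by move=> i; exact: mdc.
- by move=> i; exact: displaced_count_nat_valued.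
- move=> i s s0; rewrite expR_ge0/= -expR0 ler_expR oppr_le0; apply: mulr_ge0 => //.
  by rewrite subr_ge0 ler_expR oppr_le0 ltW.
- by move=> i s s0; exact: poisson_laplace.
- by move=> s s0; exact: (displaced_laplace lam0 ppp mM marks_independent).
Qed.

Lemma displaced_law1 (B : set R) (C : set nat) :
  measurable B -> lebesgue_measure B < +oo ->
  P (value_in (dc B) C) = poisson_prob (rate * fine (lebesgue_measure B)) 0%N C.
Proof.
move=> mB Boo.
have := @displaced_law 1 (fun=> B) (fun=> mB) (fun=> Boo) _ (fun=> C).
rewrite big_nat1 => <-; last by move=> [|?] [|?].
congr (P _); apply/seteqP; split => w; first by move=> h i.
by move=> /(_ 0%N); exact.
Qed.

(** The Poisson law gives mass 1 to the natural numbers, which leaves none for the value +oo. *)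
Lemma displaced_count_finite (B : set R) :
  measurable B -> lebesgue_measure B < +oo -> {ae P, forall w, dc B w < +oo}.
Proof.
move=> mB Boo; have : {ae P, forall w, value_in (dc B) setT w}.
  apply: probability1_ae; first exact: measurable_value_in (mdc mB).
  by rewrite displaced_law1// probability_setT.
by apply: filterS => w [k _ ->]; rewrite ltry.
Qed.

Let I (s t : R) : set R := `]s, t]%classic.
Let I0 (t : R) : set R := `[0%R, t]%classic.

Let mI s t : measurable (I s t). Proof. exact: measurable_itv. Qed.
Let mI0 t : measurable (I0 t). Proof. exact: measurable_itv. Qed.

Let Ioo s t : lebesgue_measure (I s t) < +oo.
Proof. by rewrite lebesgue_measure_itv/=; case: ifP => // _; rewrite -EFinB ltry. Qed.

Let I0oo t : lebesgue_measure (I0 t) < +oo.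
Proof. by rewrite lebesgue_measure_itv/=; case: ifP => // _; rewrite -EFinB ltry. Qed.

Let leb_I s t : (s <= t)%R -> fine (lebesgue_measure (I s t)) = (t - s)%R.
Proof.
move=> st; rewrite lebesgue_measure_itv/= lte_fin; case: ifPn => [_|].
  by rewrite -EFinB.
by rewrite -leNgt => ts; apply/eqP; rewrite eq_sym subr_eq0 eq_le ts.
Qed.

Let dc_ge0 B w : 0 <= dc B w.
Proof. by apply: nat_valued_ge0; exact: displaced_count_nat_valued. Qed.

Let dcD (s t : R) w : (0 <= s)%R -> (s <= t)%R ->
  dc (I0 t) w = dc (I0 s) w + dc (I s t) w.
Proof.
move=> s0 st; rewrite /displaced_count -nneseriesD//.
- apply: eq_eseriesr => n _; rewrite -EFinD; congr EFin.
  rewrite !indicE -natrD; congr (_%:R).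
  set x := _ + _.
  have [[r xr]|nx] := pselect (exists r : R, x = r%:E); last first.
    by rewrite !memNset// => -[r _ rx]; apply: nx; exists r.
  have E (B : set R) : (x \in EFin @` B) = (r \in B).
    rewrite xr; apply/idP/idP => /set_mem h; apply/mem_set; last by exists r.
    by case: h => y By [<-].
  rewrite !E; have F (i : interval R) : (r \in [set` i]) = (r \in i).
    by apply/idP/idP => [/set_mem//|h]; apply/mem_set.
  rewrite !F !in_itv/=; have [r0|r0] := leP 0%R r => /=; last first.
    by rewrite (_ : (s < r)%R = false)//; apply/negbTE; rewrite -leNgt ltW// (lt_le_trans r0).
  by have [rs|sr] := leP r s => //=; rewrite (le_trans rs st).
Qed.

(** One null set for all times: countably many integer horizons suffice, as counts on [0, s] grow
    with [s]. *)
Let finite_counts : {ae P, forall w, forall K : nat, dc (I0 K%:R) w < +oo}.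
Proof. by apply: ae_foralln => K; exact: displaced_count_finite. Qed.

Let finite_count (s : R) w : (forall K : nat, dc (I0 K%:R) w < +oo) -> (0 <= s)%R ->
  dc (I0 s) w < +oo.
Proof.
move=> h s0; pose K := (Num.truncn s).+1.
have sK : (s <= K%:R)%R by rewrite ltW// truncnS_gt.
apply: le_lt_trans (h K); rewrite (dcD w s0 sK).
exact: leeDl.
Qed.

(** Cancelling the count on [0, s] is legitimate because it is finite. *)
Let dcB (s t : R) w : (forall K : nat, dc (I0 K%:R) w < +oo) -> (0 <= s)%R -> (s <= t)%R ->
  dc (I0 t) w - dc (I0 s) w = dc (I s t) w.
Proof.
move=> h s0 st; rewrite (dcD w s0 st) addeAC subee ?add0e//.
by rewrite ge0_fin_numE// finite_count.
Qed.

Let measurable_increment (s t : R) :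
  measurable_fun setT (fun w => dc (I0 t) w - dc (I0 s) w).
Proof. by apply: emeasurable_funB; exact: mdc. Qed.

(** Finiteness on [0, t + 1] means that only finitely many indices contribute up to time t + 1, and
    each of these indicators is constant just after [t]. *)
Let right_continuous w (t : R) : (forall K : nat, dc (I0 K%:R) w < +oo) -> (0 <= t)%R ->
  dc (I0 s) w @[s --> t^'+] --> dc (I0 t) w.
Proof.
move=> h t0.
have t10 : (0 <= t + 1)%R by rewrite addr_ge0.
have := finite_count h t10; rewrite {1}/displaced_count => Soo.
have u0 n : (0 <= \1_(EFin @` I0 (t + 1)) ((T n w)%:E + M n w) :> R)%R by [].
have := cvg_series_cvg_0 (nnseries_is_cvg u0 Soo).
move=> /cvgr0Pnorm_lt /(_ _ ltr01)[N _ uN].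
have zero n s : (N <= n)%N -> (s <= t + 1)%R ->
    \1_(EFin @` I0 s) ((T n w)%:E + M n w) = 0%R :> R.
  move=> Nn st; have := uN n Nn; rewrite /= ger0_norm// !indicE.
  case: (boolP (_ \in EFin @` I0 s)) => // /set_mem[r]; rewrite /I0/= in_itv/= => /andP[a b] <-.
  rewrite mem_set ?ltxx//=; exists r => //; rewrite /I0/= in_itv/= a/=.
  exact: le_trans st.
have fin s : (s <= t + 1)%R -> dc (I0 s) w =
    \sum_(0 <= n < N) (\1_(EFin @` I0 s) ((T n w)%:E + M n w))%:E.
  move=> st; rewrite /displaced_count (nneseries_split 0 N)// add0n.
  by rewrite eseries0 ?adde0// => n Nn _; rewrite zero.
apply: cvg_near_cst; near=> s.
rewrite !fin//; last 2 first.
- by rewrite lerDl.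
- by near: s; apply: nbhs_right_le; rewrite ltrDl.
rewrite !big_mkord; apply: eq_bigr => n _; congr EFin.
suff : forall n : 'I_N, (\1_(EFin @` `[0%R, s]) ((T n w)%:E + M n w) : R) =
    \1_(EFin @` `[0%R, t]) ((T n w)%:E + M n w).
  exact.
by near: s; apply: filter_forall => k; exact: near_indic_right.
Unshelve. all: by end_near. Qed.

(** An increment is the count on ]s, t] only where the counts are finite, so events on increments
    are transferred to counts up to a null set. *)
Let increment_value (s t : R) (B : set (\bar R)) : (0 <= s)%R -> (s <= t)%R ->
  measurable B ->
  {ae P, forall w, B (dc (I0 t) w - dc (I0 s) w) <->
    value_in (dc (I s t)) [set k | B k%:R%:E] w}.
Proof.
move=> s0 st mB; apply: filterS finite_counts => w h; rewrite dcB//.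
have : dc (I s t) w < +oo.
  apply: le_lt_trans (finite_count h (le_trans s0 st)).
  by rewrite (dcD w s0 st) leeDr.
have [->//|[k Nk]] := @displaced_count_nat_valued _ _ _ T M (I s t) w => _.
split; first by rewrite Nk; exists k.
by move=> [l Bl ->].
Qed.

Lemma displaced_poisson_process :
  poisson_process P rate (fun t => dc (I0 t)).
Proof.
split.
- by move=> t _; exact: mdc.
- have zero : {ae P, forall w, dc (I0 0%R) w = 0}.
    have := @probability1_ae _ _ _ P (value_in (dc (I0 0%R)) [set 0%N]).
    move=> /(_ (measurable_value_in _ (mdc (mI0 _)))) H.
    have {H} : {ae P, forall w, value_in (dc (I0 0%R)) [set 0%N] w}.
      apply: H; rewrite displaced_law1//.
      rewrite lebesgue_measure_itv/= ltxx/= mulr0 /poisson_prob ltxx.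
      by rewrite diracE mem_set.
    by apply: filterS => w [k -> ->].
  apply: filterS2 zero finite_counts => w z h; split => //.
  + move=> t t0; have [E|//] := @displaced_count_nat_valued _ _ _ T M (I0 t) w.
    by have := finite_count h t0; rewrite E.
  + by move=> s t s0 st; rewrite (dcD w s0 st) leeDl.
  + by move=> t t0; exact: right_continuous.
- move=> s t k s0 st.
  rewrite (_ : poisson_mass _ _ = P (value_in (dc (I s t)) [set k])); last first.
    by rewrite displaced_law1// leb_I.
  apply: ae_eq_probability.
  + have := measurable_increment s t measurableT (emeasurable_set1 (k%:R%:E : \bar R)).
    by rewrite setTI.
  + exact: measurable_value_in (mdc (mI _ _)).
  + have := increment_value s0 st (emeasurable_set1 (k%:R%:E : \bar R)).
    apply: filterS => w [h1 h2]; split.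
      by move=> /h1[l /natr_EFin_inj -> E]; exists k.
    by move=> [l -> E]; apply: h2; exists k.
- move=> m t t00 tS s A us gA.
  have tle i j : (i <= j)%N -> (t i <= t j)%R.
    exact: (homo_leq (@lexx _ _) (@le_trans _ _)).
  have t0 i : (0 <= t i)%R by exact: le_trans t00 (tle _ _ (leq0n i)).
  have /choice[B BP] : forall i : 'I_m, exists B : set (\bar R), i \in s ->
      measurable B /\ A i = (fun w => dc (I0 (t i.+1)) w - dc (I0 (t i)) w) @^-1` B.
    move=> i; have [/gA[B mB BA]|_] := boolP (i \in s); last by exists setT.
    by exists B => _; split => //; rewrite -BA setTI.
  (* Independence is tested on a subfamily [s] of the increments, while [displaced_law] treats all
     of them; the indices outside [s] get [setT], whose Poisson probability is 1. *)
  pose C (i : nat) : set nat := if insub i is Some j then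
    if j \in s then [set k | B j k%:R%:E] else setT else setT.
  have CE (i : 'I_m) : C i = if i \in s then [set k | B i k%:R%:E] else setT.
    by rewrite /C insubT//= => im; rewrite (_ : Sub _ _ = i)//; exact/val_inj.
  have dI i j : (i < m)%N -> (j < m)%N -> i != j ->
      I (t i) (t i.+1) `&` I (t j) (t j.+1) = set0.
    have H k l : (k < l)%N -> I (t k) (t k.+1) `&` I (t l) (t l.+1) = set0.
      move=> kl; apply/seteqP; split => // x [] /=; rewrite /I/= !in_itv/=.
      move=> /andP[_ a] /andP[b _]; have := lt_le_trans b a.
      by rewrite ltNge tle.
    by move=> _ _; case: ltngtP => // kl _; [|rewrite setIC]; exact: H.
  have mA i : i \in s -> measurable (A i).
    by move=> /BP[mB ->]; rewrite -[X in measurable X]setTI; apply: measurable_increment.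
  have PA i : i \in s -> P (A i) =
      poisson_prob (rate * fine (lebesgue_measure (I (t i) (t i.+1)))) 0%N (C i).
    move=> si; have [mB AE] := BP i si; rewrite -displaced_law1//.
    apply: ae_eq_probability; first exact: mA.
      exact: measurable_value_in (mdc (mI _ _)).
    by rewrite AE CE si; apply: increment_value.
  have -> : P (\bigcap_(i in [set` s]) A i) =
      P (\bigcap_(i in [set i | (i < m)%N]) value_in (dc (I (t i) (t i.+1))) (C i)).
    apply: ae_eq_probability.
    + by apply: fin_bigcap_measurable => [|i /mA //]; exact: finite_seq.
    + by apply: bigcap_measurableType => i _; exact: measurable_value_in (mdc (mI _ _)).
    have H i : {ae P, forall w, i \in s -> (A i w <-> value_in (dc (I (t i) (t i.+1))) (C i) w)}.
      have [si|] := boolP (i \in s); last by move=> _; exact: aeW.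
      have [mB AE] := BP i si.
      by rewrite AE CE si; apply: filterS (increment_value (t0 i) (tS i) mB).
    have {}H : {ae P, forall w, forall i, i \in s ->
       (A i w <-> value_in (dc (I (t i) (t i.+1))) (C i) w)} by exact: filter_forall.
    (* For indices outside [s] the event [value_in _ setT] still says that the count is finite,
       which holds only almost surely. *)
    have G : {ae P, forall w, forall i : 'I_m, value_in (dc (I (t i) (t i.+1))) setT w}.
      apply: filter_forall => i; apply: filterS (displaced_count_finite (mI (t i) (t i.+1)) (Ioo _ _)) => w.
      by have [->//|[k Nk] _] := @displaced_count_nat_valued _ _ _ T M (I (t i) (t i.+1)) w; exists k.
    apply: filterS2 H G => w H G; split => [h i /= im|h i /= si].
      rewrite -[i]/(val (Ordinal im)); have [si|si] := boolP (Ordinal im \in s).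
        by apply/(H _ si); exact: h.
      by rewrite CE (negbTE si); exact: G.
    by apply/(H _ si); apply: h => /=.
  rewrite displaced_law// big_mkord.
  rewrite (bigID (fun i : 'I_m => i \in s))/= [X in _ * X]big1 ?mule1; last first.
    by move=> i si; rewrite CE (negbTE si) probability_setT.
  rewrite -big_uniq//= !big_seq; apply: eq_bigr => i si.
  by rewrite PA.
Qed.

End displaced_poisson_process.
(** * Exit functionals on path space *)

Section borel_rV.
Context {R : realType} {n : nat}.
Local Notation E := 'rV[R]_n.

Lemma rV_ballP (x y : E) (e : R) :
  ball x e y <-> 0 < e /\ forall i, `|x ord0 i - y ord0 i| < e.
Proof.
split=> [[e0 h]|[e0 h]]; split => // i; first exact: h.
by move=> j; rewrite (ord1 i); exact: h.
Qed.

Lemma measurable_fun_rV d (T : measurableType d) (f : T -> E) :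
  (forall i, measurable_fun setT (fun x => f x ord0 i)) -> measurable_fun setT f.
Proof.
move=> mf _; rewrite -[X in forall Y, X Y -> _]/(g_sigma_preimage _).
suff : g_sigma_preimage (fun i x => f x ord0 i) `<=` measurable.
  move=> h Y mY; apply: h.
  rewrite (g_sigma_preimage_comp (fun i (x : E) => x ord0 i)).
  by exists Y.
apply: smallest_sub; first exact: sigma_algebra_measurable.
rewrite -bigcup_seq; apply: bigcup_sub => i _.
by move=> A [B mB <-]; exact: mf.
Qed.

Lemma measurable_fun_addrV d (T : measurableType d) (f g : T -> E) :
  measurable_fun setT f -> measurable_fun setT g -> measurable_fun setT (fun x => f x + g x).
Proof.
move=> mf mg; apply: measurable_fun_rV => i.
under eq_fun do rewrite mxE.
by apply: measurable_funD; exact: (measurableT_comp (measurable_coord i)).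
Qed.

Lemma measurable_fun_scalerV d (T : measurableType d) (a : T -> R) (f : T -> E) :
  measurable_fun setT a -> measurable_fun setT f -> measurable_fun setT (fun x => a x *: f x).
Proof.
move=> ma mf; apply: measurable_fun_rV => i.
under eq_fun do rewrite mxE.
by apply: measurable_funM => //; exact: (measurableT_comp (measurable_coord i)).
Qed.

Lemma measurable_fun_sumrV d (T : measurableType d) (I : Type) (r : seq I) (f : I -> T -> E) :
  (forall i, measurable_fun setT (f i)) -> measurable_fun setT (fun x => \sum_(i <- r) f i x).
Proof.
move=> mf; elim: r => [|i r IH].
  by under eq_fun do rewrite big_nil; exact: measurable_cst.
under eq_fun do rewrite big_cons.
exact: measurable_fun_addrV.
Qed.

(** Measurability here means generated by coordinates; an open set is the union of the countably
    many rational cubes of half-side [k.+1%:R^-1] that it contains. *)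
Lemma open_measurable_rV (U : set E) : open U -> measurable U.
Proof.
move=> oU.
pose box (c : 'rV[rat]_n * nat) : set E :=
  \bigcap_(i in [set: 'I_n]) ((fun x : E => x ord0 i) @^-1` ball (ratr (c.1 ord0 i) : R) c.2.+1%:R^-1).
have -> : U = \bigcup_c [set x | box c `<=` U /\ box c x].
  apply/seteqP; split => [x Ux|x [c _]]; last by move=> [cU /cU].
  have /nbhs_ballP[e /= e0 xeU] : nbhs x U by exact: open_nbhs_nbhs.
  (* Two points of a cube are each within [k.+1%:R^-1] of its centre, hence within [e] of each
     other. *)
  have [k ke] : exists k : nat, k.+1%:R^-1 < e / 2 :> R.
    have e20 : 0 < e / 2 by rewrite divr_gt0.
    by exists (Num.truncn (e / 2)^-1); rewrite invf_plt ?posrE// truncnS_gt.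
  have /choice[c cx] : forall i : 'I_n, exists q : rat, ball (ratr q : R) k.+1%:R^-1 (x ord0 i).
    move=> i; have k0 : 0 < k.+1%:R^-1 :> R by rewrite invr_gt0.
    have /rat_in_itvoo[q] : x ord0 i - k.+1%:R^-1 < x ord0 i + k.+1%:R^-1 :> R.
      by rewrite ltrD2l (lt_trans _ k0)// oppr_lt0.
    rewrite in_itv/= => /andP[a b]; exists q.
    by rewrite /ball/= ltr_norml ltrBlDl ltrBrDl a b.
  pose c' : 'rV[rat]_n * nat := (\row_i c i, k).
  have xc : box c' x by move=> i _; rewrite /= mxE; exact: cx.
  exists c' => //; split => // y cy.
  apply: xeU; apply/rV_ballP; split => // i.
  have := xc i I; have := cy i I; rewrite /ball/= !mxE => h1 h2.
  rewrite (_ : _ - _ = - (ratr (c i) - x ord0 i) + (ratr (c i) - y ord0 i)); last by ring.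
  rewrite (le_lt_trans (ler_normD _ _))// normrN.
  by rewrite (lt_trans (ltrD h2 h1))// [ltRHS]splitr; exact: (ltrD ke ke).
apply: countable_bigcupT_measurable => [|c]; first exact: countableP.
have [cU|ncU] := pselect (box c `<=` U); last first.
  by rewrite (_ : [set x | _] = set0)//; apply/seteqP; split => // x [].
rewrite (_ : [set x | _] = box c); last by apply/seteqP; split => // x [].
apply: fin_bigcap_measurable => // i _.
rewrite -[X in measurable X]setTI; apply: measurable_coord => //.
exact: measurable_ball.
Qed.

End borel_rV.

(* Paths of positions only: the exit event does not involve the velocities. *)
Definition position_generators {R : realType} {d : nat} : set (set (R -> 'rV[R]_d)) :=
  [set A | exists (t : R) (B : set 'rV[R]_d),
     [/\ 0 <= t, measurable B & A = [set p | B (p t)]]].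

(** * Exit time and exit place as measurable functionals of the path *)

Section path_functional.
Context {R : realType} {d : nat}.
Local Notation E := 'rV[R]_d.
Local Notation path := (g_sigma_algebraType (@position_generators R d)).

Lemma measurable_position (t : R) : 0 <= t ->
  measurable_fun [set: path] (fun p => p t : E).
Proof.
move=> t0 _ B mB; rewrite setTI; apply: sub_sigma_algebra.
by exists t, B.
Qed.

Variables (Om D : set E).
Hypotheses (oOm : open Om) (mD : measurable D).

(* The value [+oo] records that the path does not leave through [D]; when the
   exit time is [+oo] both branches give [+oo]. *)
Definition exit_mark (x : R -> E) : \bar R :=
  let tau := exit_time Om 0 x in if `[< D (x (fine tau)) >] then tau else +oo%E.

(* Nothing is known about a path at negative times. *)
Definition stopped_continuous (p : path) :=
  continuous (fun t : R => p (Num.max 0 t) : E).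

(** These sets increase to the open set [Om]. Their complements are open neighbourhoods of [~]
    Om[, so a continuous path that touches]~[Om] visits each of them at a rational time. *)
Let Omk (k : nat) : set E := [set x | ball x k.+1%:R^-1 `<=` Om].

Let measurable_Omk k : measurable (Omk k).
Proof.
rewrite -[Omk k]setCK; apply: measurableC; apply: open_measurable_rV.
rewrite (_ : ~` _ = \bigcup_(y in ~` Om) ball y k.+1%:R^-1).
  by apply: bigcup_open => y _; exact: ball_open.
apply/seteqP; split => x /=.
  move=> /existsNP[y /not_implyP[xy Oy]]; exists y => //.
  exact: ball_sym.
by move=> [y Oy xy] h; apply: Oy; apply: h; exact: ball_sym.
Qed.

(* For continuous paths: the closed set [~` Om] is visited during [[a, b]]. *)
Let hit (a b : rat) : set path := [set p | forall k : nat, exists2 q : rat,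
  (0 <= q) && (ratr a <= (ratr q : R) <= ratr b) & ~ Omk k (p (ratr q))].

Let measurable_hit a b : measurable (hit a b).
Proof.
rewrite (_ : hit a b = \bigcap_k \bigcup_(q in [set: rat])
  (if (0 <= q) && (ratr a <= (ratr q : R) <= ratr b)
   then [set p : path | ~ Omk k (p (ratr q))] else set0)).
  apply: bigcapT_measurable => k; apply: countable_bigcupT_measurable => [|q].
    exact: countableP.
  case: ifPn => // /andP[q0 _].
  rewrite -[X in measurable X]setTI.
  apply: (measurable_position _ measurableT (measurableC (measurable_Omk k))).
  by rewrite ler0q.
apply/seteqP; split => p h k; first by move=> _; have [q qab Oq] := h k; exists q => //; rewrite qab.
by have [q _] := h k I; case: ifPn => // qab Oq; exists q.
Qed.

(** From right to left, continuity and density of the rationals. From left to right, compactness: a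
    path that stays in [Om] during [a, b] stays in a single [Omk k]. *)
Let hitP (a b : rat) (p : path) : stopped_continuous p -> 0 < a -> a < b ->
  hit a b p <-> exists2 s : R, ratr a <= s <= ratr b & ~ Om (p s).
Proof.
move=> cp a0 ab; have ra0 : 0 < ratr a :> R by rewrite ltr0q.
have rab : ratr a < ratr b :> R by rewrite ltr_rat.
have pE s : 0 <= s -> (p (Num.max 0 s)) = (p s) by move=> s0; rewrite max_r.
split; last first.
  move=> [s sab Os] k.
  have s0 : 0 < s by case/andP : sab => as_ _; exact: lt_le_trans as_.
  have k0 : 0 < k.+1%:R^-1 :> R by rewrite invr_gt0.
  have := cp s; rewrite /continuous_at pE ?ltW// => /cvgrPdist_lt /(_ _ k0).
  move=> /nbhs_ballP[e /= e0 se].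
  (* A rational time is sought within [e] of [s] and inside [a, b]; there is room even if [s] is an
     endpoint, because [a < b]. *)
  have : Num.max (ratr a) (s - e) < Num.min (ratr b) (s + e).
    rewrite gt_max !lt_min rab/=; case/andP : sab => as_ sb.
    by apply/and3P; split; try apply/andP; try split; lra.
  move=> /rat_in_itvoo[q]; rewrite in_itv/= gt_max lt_min => /andP[/andP[aq sq] /andP[qb qs]].
  have q0 : 0 < ratr q :> R by exact: lt_trans aq.
  exists q; first by rewrite -(ler0q R) ltW//= !ltW.
  have /se : ball s e (ratr q : R) by rewrite /ball/= ltr_norml; apply/andP; split; lra.
  rewrite pE ?ltW// => pq Oq; apply: Os; apply: Oq.
  by rewrite -ball_normE/= distrC.
move=> h; apply: contrapT => nex.
have inOm s : s \in `[ratr a : R, ratr b] -> Om (p (Num.max 0 s)).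
  rewrite in_itv/= => sab; apply: contrapT => Os; apply: nex; exists s => //.
  by rewrite -pE// ltW//; case/andP : sab => as_ _; exact: lt_le_trans as_.
have /compact_near_coveringP nc := @segment_compact R (ratr a) (ratr b).
have := nc nat \oo (fun k s => Omk k (p (Num.max 0 s))) _.
have {nc} H : forall s, `[ratr a : R, ratr b]%classic s ->
    \forall s' \near s & k \near \oo, Omk k (p (Num.max 0 s')).
  move=> s sab; have Os := inOm s sab.
  have /nbhs_ballP[e /= e0 eOm] : nbhs (p (Num.max 0 s)) Om by exact: open_nbhs_nbhs.
  have e20 : 0 < e / 2 by rewrite divr_gt0.
  have /cvg_ballP/(_ _ e20) cps := cp s.
  (* Half of [e] is spent on the motion of the path near [s], the other half on the radius
     [k.+1%:R^-1]. *)
  exists ([set s' | ball (p (Num.max 0 s)) (e / 2) (p (Num.max 0 s'))],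
          [set k : nat | k.+1%:R^-1 < e / 2 :> R]).
    split; first exact: cps.
    near=> k; rewrite /= invf_plt ?posrE//.
    rewrite (@lt_trans _ _ k%:R)// ?ltr_nat//; near: k; exact: nbhs_infty_gtr.
  move=> [s' k] /= [ss' ke] y py; apply: eOm.
  rewrite [e]splitr; apply: ball_triangle ss' _.
  exact: le_ball (ltW ke) _ py.
move=> /(_ _ H)[K _ /(_ K (leqnn K)) HK].
have [q /andP[q0 qab] Oq] := h K; apply: Oq.
by have := HK (ratr q) _; rewrite pE ?ler0q//; apply; rewrite /= in_itv.
Unshelve. all: by end_near. Qed.

(** A countable substitute for the exit time: it is measurable on all paths, and by [hitP] equals
    [exit_time] on continuous ones. The condition [0 < a] matches the strictly positive times in
    [exit_time]. *)
Let tau' (p : path) : \bar R := ereal_inf [set x | exists (a b : rat),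
  [/\ 0 < a, a < b, hit a b p & x = (ratr b)%:E]].

Let measurable_tau' : measurable_fun setT tau'.
Proof.
apply: (measurability _ (ErealGenInftyO.measurableE R)).
move=> _ [_ [r ->] <-]; rewrite setTI.
rewrite (_ : _ @^-1` _ = \bigcup_(c in [set: rat * rat])
  (if [&& 0 < c.1, c.1 < c.2 & (ratr c.2 : R) < r] then hit c.1 c.2 else set0)).
  apply: countable_bigcupT_measurable => [|c]; first exact: countableP.
  by case: ifPn => // _; exact: measurable_hit.
apply/seteqP; split => p /=.
  rewrite in_itv/= => /ereal_inf_lt[_ [a [b [a0 ab hab ->]]] br].
  by exists (a, b) => //=; rewrite a0 ab -lte_fin br.
move=> [[a b] _] /=; case: ifPn => // /and3P[a0 ab br] hab.
rewrite in_itv/=; apply: le_lt_trans (_ : ((ratr b)%:E < r%:E)%E); last by rewrite lte_fin.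
by apply: ereal_inf_lbound; exists a, b.
Qed.

Let tau'_ge0 p : (0 <= tau' p)%E.
Proof.
apply: le_ereal_inf_tmp => _ [a [b [a0 ab _ ->]]].
by rewrite lee_fin ler0q ltW// (lt_trans a0).
Qed.

Let tau'E (p : path) : stopped_continuous p -> tau' p = exit_time Om 0 p.
Proof.
move=> cp; apply/eqP; rewrite eq_le; apply/andP; split.
- apply: le_ereal_inf_tmp => _ [s [s0 Os] <-].
  apply/lee_addgt0Pr => e e0; rewrite -EFinD.
  have /rat_in_itvoo[a] := s0; rewrite in_itv/= => /andP[a0 as_].
  have /rat_in_itvoo[b] : s < s + e by rewrite ltrDl.
  rewrite in_itv/= => /andP[sb be].
  apply: le_trans (_ : ((ratr b)%:E <= _)%E); last by rewrite lee_fin ltW.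
  apply: ereal_inf_lbound; exists a, b.
  have a0' : 0 < a by rewrite -(ltr0q R).
  have ab : a < b by rewrite -(ltr_rat R) (lt_trans as_).
  by split => //; apply/hitP => //; exists s; rewrite // !ltW.
- apply: le_ereal_inf_tmp => _ [a [b [a0 ab hab ->]]].
  move/(hitP cp a0 ab) : hab => [s /andP[as_ sb] Os].
  apply: le_trans (_ : (s%:E <= _)%E); last by rewrite lee_fin.
  apply: ereal_inf_lbound; exists s => //; split => //.
  by rewrite (lt_le_trans _ as_)// ltr0q.
Qed.

(* The exit time is approached from the right by points of [k.+1^-1 * nat]. *)
Let grid (k j : nat) : R := j.+1%:R / k.+1%:R.
Let grid_ge0 k j : 0 <= grid k j. Proof. by rewrite divr_ge0. Qed.

Let eval_grid (k : nat) (p : path) : E :=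
  (p (grid k (Num.truncn (k.+1%:R * fine (tau' p))))).

Let measurable_eval_grid k : measurable_fun setT (eval_grid k).
Proof.
have mt : measurable_fun setT (fun p : path => k.+1%:R * fine (tau' p)).
  by apply: measurable_funM => //; apply: measurableT_comp.
move=> _ B mB; rewrite setTI.
rewrite (_ : _ @^-1` _ = \bigcup_j ((fun p : path => k.+1%:R * fine (tau' p)) @^-1` `[j%:R, j.+1%:R[
   `&` (fun p : path => (p (grid k j))) @^-1` B)).
  apply: bigcupT_measurable => j; apply: measurableI.
    by rewrite -[X in measurable X]setTI; apply: mt.
  rewrite -[X in measurable X]setTI; exact: measurable_position.
have t0 p : 0 <= k.+1%:R * fine (tau' p) by rewrite mulr_ge0// fine_ge0// tau'_ge0.
apply/seteqP; split => p /=.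
  move=> Bp; exists (Num.truncn (k.+1%:R * fine (tau' p))) => //; split => //=.
  by rewrite in_itv/=; exact: truncn_itv.
move=> [j _ [/= jt Bp]]; rewrite /eval_grid (_ : Num.truncn _ = j)//.
by apply/eqP; rewrite truncn_eq// -in_itv.
Qed.

(** The upper limit of the coordinates exists and is measurable for every path, and is the actual
    limit for continuous ones. *)
Let exit_position (p : path) : E :=
  \row_i fine (limn_esup (fun k => (eval_grid k p ord0 i)%:E)).

Let measurable_exit_position : measurable_fun setT exit_position.
Proof.
apply: measurable_fun_rV => i.
have -> : (fun p => exit_position p ord0 i) =
    (fun p => fine (limn_esup (fun k => (eval_grid k p ord0 i)%:E))).
  by apply/funext => p; rewrite mxE.
apply: (measurableT_comp (@fine_measurable _ setT measurableT)).
apply: measurable_fun_limn_esup => k; apply/measurable_EFinP.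
exact: (measurableT_comp (measurable_coord i)).
Qed.

Let exit_positionE (p : path) : stopped_continuous p ->
  exit_position p = (p (fine (tau' p))).
Proof.
move=> cp; set t := fine (tau' p); have t0 : 0 <= t by apply: fine_ge0; exact: tau'_ge0.
(* The grid time exceeds [t] by at most [k.+1%:R^-1]. *)
have gt : grid k (Num.truncn (k.+1%:R * t)) @[k --> \oo] --> t.
  apply/cvgrPdist_le => e e0; near=> k.
  have k0 : 0 < k.+1%:R :> R by [].
  have /andP[a b] := truncn_itv (mulr_ge0 (ltW k0) t0).
  have ke : k.+1%:R^-1 <= e.
    rewrite invf_ple ?posrE// (@le_trans _ _ k%:R)// ?ler_nat//; near: k; exact: nbhs_infty_ger.
  rewrite ler0_norm; last first.
    by rewrite subr_le0 ler_pdivlMr// mulrC ltW.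
  rewrite opprB lerBlDr ler_pdivrMr// -natr1.
  have : 1 <= e * k.+1%:R by rewrite -ler_pdivrMr// div1r.
  by rewrite mulrDl [t * _]mulrC; lra.
have pc : (fun k => (p (Num.max 0 (grid k (Num.truncn (k.+1%:R * t)))))) @ \oo --> (p t).
  have := cp t; rewrite /continuous_at max_r// => H.
  exact: (cvg_comp _ _ gt H).
apply/rowP => i; rewrite mxE.
have ci : eval_grid k p ord0 i @[k --> \oo] --> (p t) ord0 i.
  apply/cvg_ballP => e e0; have /cvg_ballP/(_ e e0) := pc.
  apply: filterS => k /=; rewrite max_r// => /rV_ballP[_]; exact.
have ciE : (eval_grid k p ord0 i)%:E @[k --> \oo] --> ((p t) ord0 i)%:E.
  by apply/fine_cvgP; split; [exact: nearW|exact: ci].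
rewrite is_cvg_limn_esupE; last by apply/cvg_ex; exists ((p t) ord0 i)%:E.
by rewrite (cvg_lim _ ciE).
Unshelve. all: by end_near. Qed.

(** An event of the product sigma-algebra depends on countably many times only, which does not
    suffice to express continuity; so [Phi] is measurable on all paths and agrees with [exit_mark]
    on the continuous ones. *)
Lemma measurable_path_functional : exists2 Phi : path -> \bar R,
  measurable_fun setT Phi &
  forall p, stopped_continuous p -> Phi p = exit_mark p.
Proof.
exists (fun p => if `[< D (exit_position p) >] then tau' p else +oo%E).
  apply: measurable_fun_ifT => //.
  apply: (measurable_fun_bool true).
  rewrite (_ : _ @^-1` _ = exit_position @^-1` D).
    exact: measurable_exit_position.
  by apply/seteqP; split => p /=; [move/asboolP|move=> ?; apply/asboolP].
by move=> p cp; rewrite /exit_mark -tau'E// exit_positionE.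
Qed.

End path_functional.
(** * Uniqueness in law of PLMPs *)

Section equality_in_law.
Local Open Scope ereal_scope.
Context {R : realType} {dW dW1 : measure_display}
  {W : measurableType dW} {W1 : measurableType dW1}
  (P : probability W R) (P1 : probability W1 R).

(** Equality of laws restricted to an event, across two probability spaces: histories are compared
    on the event that the n-th jump takes place. *)
Definition same_law_on {d} {S : measurableType d} (Y : W -> S) (G : set W)
    (Y1 : W1 -> S) (G1 : set W1) :=
  forall B, measurable B -> P (Y @^-1` B `&` G) = P1 (Y1 @^-1` B `&` G1).

Context {d : measure_display} {S : measurableType d}.
Variables (Y : W -> S) (G : set W) (Y1 : W1 -> S) (G1 : set W1).
Hypotheses (mY : measurable_fun setT Y) (mY1 : measurable_fun setT Y1).
Hypotheses (mG : measurable G) (mG1 : measurable G1).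

Lemma same_law_on_integral (q : S -> \bar R) (B : set S) :
  same_law_on Y G Y1 G1 -> measurable B ->
  measurable_fun setT q -> (forall y, 0 <= q y) ->
  \int[P]_(w in Y @^-1` B `&` G) q (Y w) =
  \int[P1]_(w in Y1 @^-1` B `&` G1) q (Y1 w).
Proof.
move=> YY1 mB mq q0.
(* Either integral is one of [q] against the image under [Z] of the measure restricted to [H], that
   is, with density the indicator of [H]. *)
have key dd (V : measurableType dd) (Q : probability V R) (Z : V -> S) (H : set V)
    (mZ : measurable_fun setT Z) (mH : measurable H) :
    exists2 m : {measure set S -> \bar R}, (forall A, measurable A -> m A = Q (Z @^-1` A `&` H)) &
    \int[Q]_(w in Z @^-1` B `&` H) q (Z w) = \int[m]_(y in B) q y.
  have m1 : measurable_fun setT (\1_H : V -> R) by exact: measurable_indic.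
  have i0 x : (0 <= (\1_H x : R))%R by [].
  exists (measure_function_pushforward__canonical__measure_function_Measure
    (weighted Q m1 i0) mZ).
    move=> A mA; rewrite /= /pushforward/= /weighted integral_indic//.
      by rewrite setIC.
    by rewrite -[X in measurable X]setTI; exact: mZ.
  rewrite (ge0_integral_pushforward mZ _ mB (measurable_funTS mq) (fun y _ => q0 y)).
  have mZB : measurable (Z @^-1` B) by rewrite -[X in measurable X]setTI; exact: mZ.
  have mqZ : measurable_fun setT (q \o Z) by exact: measurableT_comp.
  have mr : measurable_fun setT ((q \o Z) \_ (Z @^-1` B)).
    by apply/(measurable_restrictT _ mZB); exact: measurable_funTS.
  have r0 w : 0 <= ((q \o Z) \_ (Z @^-1` B)) w by apply: erestrict_ge0 => ? _; exact: q0.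
  rewrite [RHS]integral_mkcond integral_weighted//.
  rewrite setIC integral_mkcondr [LHS]integral_mkcond; apply: eq_integral => w _.
  by rewrite [X in X w = _]epatch_indic.
have [m mE ->] := key _ _ P Y G mY mG.
have [m1 m1E ->] := key _ _ P1 Y1 G1 mY1 mG1.
apply: eq_measure_integral => A mA _.
by rewrite /= mE// m1E// YY1.
Qed.

Lemma same_law_on_comp {d'} {S' : measurableType d'} (Phi : S -> S') :
  same_law_on Y G Y1 G1 -> measurable_fun setT Phi ->
  same_law_on (Phi \o Y) G (Phi \o Y1) G1.
Proof.
move=> YY1 mPhi B mB.
have mPB : measurable (Phi @^-1` B).
  by rewrite -[X in measurable X]setTI; exact: mPhi.
exact: (YY1 _ mPB).
Qed.

Lemma same_law_on_sub (C : set S) : same_law_on Y G Y1 G1 -> measurable C ->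
  same_law_on Y (Y @^-1` C `&` G) Y1 (Y1 @^-1` C `&` G1).
Proof.
move=> YY1 mC B mB; rewrite setIA [in RHS]setIA.
exact: (YY1 _ (measurableI _ _ mB mC)).
Qed.

Lemma same_law_on_eq {d'} {S' : measurableType d'} (Z Z' : W -> S') (Z1 Z1' : W1 -> S') :
  same_law_on Z G Z1 G1 -> (forall w, G w -> Z w = Z' w) ->
  (forall w, G1 w -> Z1 w = Z1' w) -> same_law_on Z' G Z1' G1.
Proof.
move=> ZZ1 ZZ' ZZ1' B mB.
rewrite (_ : Z' @^-1` B `&` G = Z @^-1` B `&` G); last first.
  by apply/seteqP; split => w [] /= Bw Gw; rewrite ?ZZ'// in Bw *; rewrite -ZZ'.
rewrite ZZ1//; congr (P1 _).
by apply/seteqP; split => w [] /= Bw Gw; rewrite ?ZZ1'// in Bw *; rewrite -ZZ1'.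
Qed.

(** Uniqueness of measures is used twice: with [A] fixed, from the pi-system [C] to all measurable
    [B], then from rectangles to the product sigma-algebra. *)
Lemma same_law_on_pair {d'} {S' : measurableType d'} (Z : W -> S') (Z1 : W1 -> S')
    (C : set (set S')) :
  measurable_fun setT Z -> measurable_fun setT Z1 ->
  setI_closed C -> C setT -> measurable = <<s C >> ->
  (forall A B, measurable A -> C B ->
    P (Y @^-1` A `&` G `&` Z @^-1` B) = P1 (Y1 @^-1` A `&` G1 `&` Z1 @^-1` B)) ->
  same_law_on (fun w => (Y w, Z w)) G (fun w => (Y1 w, Z1 w)) G1.
Proof.
move=> mZ mZ1 CI CT mC H.
have restr dd (V : measurableType dd) (Q : probability V R) (D : set V)
    dd' (T : measurableType dd') (X : V -> T)
    (mX : measurable_fun setT X) (mD : measurable D) :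
    exists2 m : {measure set T -> \bar R}, (forall A, measurable A -> m A = Q (X @^-1` A `&` D)) & m setT < +oo.
  have m1 : measurable_fun setT (\1_D : V -> R) by exact: measurable_indic.
  have i0 x : (0 <= (\1_D x : R))%R by [].
  pose m := measure_function_pushforward__canonical__measure_function_Measure
    (weighted Q m1 i0) mX.
  have mE A : measurable A -> m A = Q (X @^-1` A `&` D).
    move=> mA; rewrite /m /= /pushforward/= /weighted integral_indic//.
      by rewrite setIC.
    by have := mX measurableT A mA; rewrite setTI.
  exists m => //; rewrite mE//.
  apply: le_lt_trans (probability_le1 Q _) (ltry 1).
  by rewrite preimage_setT setTI.
have mYG A : measurable A -> measurable (Y @^-1` A `&` G).
  by move=> mA; apply: measurableI => //; rewrite -[X in measurable X]setTI; exact: mY.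
have mYG1 A : measurable A -> measurable (Y1 @^-1` A `&` G1).
  by move=> mA; apply: measurableI => //; rewrite -[X in measurable X]setTI; exact: mY1.
have rect A B : measurable A -> measurable B ->
    P (Y @^-1` A `&` G `&` Z @^-1` B) = P1 (Y1 @^-1` A `&` G1 `&` Z1 @^-1` B).
  move=> mA mB.
  have [m mE moo] := restr _ _ P _ _ _ _ mZ (mYG _ mA).
  have [m1 m1E _] := restr _ _ P1 _ _ _ _ mZ1 (mYG1 _ mA).
  rewrite setIC -mE// [in RHS]setIC -m1E//.
  apply: (measure_unique C (fun=> setT)) => //.
  - by apply/seteqP; split => // x _; exists 0%N.
  - move=> X CX; have mX : measurable X by rewrite mC; exact: sub_sigma_algebra.
    by rewrite mE// m1E// setIC [in RHS]setIC H.
move=> Q mQ.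
have mYZ : measurable_fun setT (fun w => (Y w, Z w)) by exact: measurable_fun_pair.
have mYZ1 : measurable_fun setT (fun w => (Y1 w, Z1 w)) by exact: measurable_fun_pair.
have [m mE moo] := restr _ _ P _ _ _ _ mYZ mG.
have [m1 m1E _] := restr _ _ P1 _ _ _ _ mYZ1 mG1.
rewrite -mE// -m1E//.
apply: (measure_unique [set A `*` B | A in measurable & B in measurable] (fun=> setT)) => //.
- by rewrite measurable_prod_measurableType.
- move=> _ _ [A mA [B mB <-]] [A' mA' [B' mB' <-]]; rewrite -setXI.
  exists (A `&` A'); first exact: measurableI.
  by exists (B `&` B') => //; exact: measurableI.
- by move=> _; exists setT => //; exists setT => //; rewrite setXTT.
- by apply/seteqP; split => // x _; exists 0%N.
- move=> _ [A mA [B mB <-]].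
  rewrite mE ?m1E; [|exact: measurableX..].
  transitivity (P (Y @^-1` A `&` G `&` Z @^-1` B)).
    by congr (P _); apply/seteqP; split => w /= [[? ?] ?].
  rewrite rect//; congr (P1 _).
  by apply/seteqP; split => w /= [[? ?] ?].
Qed.

End equality_in_law.

(** * Trajectories as functions of the jump history *)

Section histories.
Context {R : realType} {d : nat}.
Local Notation E := 'rV[R]_d.

Definition history (n : nat) : Type := (E * n.+1.-tuple (\bar R * E))%type.

(* The value [+oo] beyond the last jump of the history lets the last velocity
   act for ever in [hist_position]. *)
Definition hist_time n (h : history n) (k : nat) : \bar R :=
  if (k <= n)%N then (tnth h.2 (inord k)).1 else +oo%E.

Definition hist_velocity n (h : history n) (k : nat) : E := (tnth h.2 (inord k)).2.

(* [x = -oo] would give the junk value 0; jump times are nonnegative. *)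
Definition clip (t : R) (x : \bar R) : R := fine (mine t%:E x).

(** Velocity [k] has acted during min(t, J(k+1)) - min(t, J(k)) by time [t]. This needs no case
    distinction on the interval containing [t], so measurability and continuity in [t] come
    termwise. *)
Definition hist_position n (h : history n) (t : R) : E :=
  h.1 + \sum_(0 <= k < n.+1)
    (clip t (hist_time h k.+1) - clip t (hist_time h k)) *: hist_velocity h k.

Lemma measurable_hist_time n k :
  measurable_fun [set: E * n.+1.-tuple (\bar R * E)] (fun h => @hist_time n h k).
Proof.
rewrite /hist_time; case: (k <= n)%N; last exact: measurable_cst.
apply: (measurableT_comp measurable_fst).
by apply: (measurableT_comp (measurable_tnth _)); exact: measurable_snd.
Qed.

Lemma measurable_hist_velocity n k :
  measurable_fun [set: E * n.+1.-tuple (\bar R * E)] (fun h => @hist_velocity n h k).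
Proof.
apply: (measurableT_comp measurable_snd).
by apply: (measurableT_comp (measurable_tnth _)); exact: measurable_snd.
Qed.

Lemma measurable_clip d' (T : measurableType d') (t : T -> R) (x : T -> \bar R) :
  measurable_fun setT t -> measurable_fun setT x ->
  measurable_fun setT (fun y => clip (t y) (x y)).
Proof.
move=> mt mx; apply: (measurableT_comp (@fine_measurable _ setT measurableT)).
by apply: measurable_mine => //; exact/measurable_EFinP.
Qed.

Lemma measurable_hist_position n d' (T : measurableType d')
    (h : T -> E * n.+1.-tuple (\bar R * E)) (t : T -> R) :
  measurable_fun setT h -> measurable_fun setT t ->
  measurable_fun setT (fun y => @hist_position n (h y) (t y)).
Proof.
move=> mh mt; apply: measurable_fun_addrV.
  exact: (measurableT_comp measurable_fst).
apply: measurable_fun_sumrV => k; apply: measurable_fun_scalerV; last first.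
  exact: (measurableT_comp (@measurable_hist_velocity n k) mh).
by apply: measurable_funB; apply: measurable_clip => //;
  exact: (measurableT_comp (@measurable_hist_time n _) mh).
Qed.

Lemma clip_le (t : R) (x : \bar R) : (t%:E <= x)%E -> clip t x = t.
Proof. by move=> tx; rewrite /clip min_l. Qed.

Lemma clip_ge (t : R) (x : \bar R) : (x <= t%:E)%E -> clip t x = fine x.
Proof. by move=> tx; rewrite /clip min_r. Qed.

Lemma continuous_clip (x : \bar R) : (0 <= x)%E -> continuous (fun t : R => clip t x).
Proof.
case: x => [r _|_|//] t.
  rewrite (_ : (fun t => _) = (fun t => Num.min t r)); last first.
    by apply/funext => s; rewrite /clip -EFin_min.
  by apply: continuous_min; [exact: cvg_id|exact: cvg_cst].
rewrite (_ : (fun t => _) = id); first exact: cvg_id.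
by apply/funext => s; rewrite clip_le// leey.
Qed.

End histories.

Section plmp_paths.
Context {R : realType} {d : nat}.
Local Notation E := 'rV[R]_d.
Variables (Vs : set E) (nu : {sigma_finite_measure set E -> \bar R}).
Variables (sigma_s : E -> E -> R) (K : E -> E -> E -> R).
Context {dW} {W : measurableType dW} (P : probability W R).
Variables (X V : R -> W -> E) (J : nat -> W -> \bar R) (U : nat -> W -> E).
Hypothesis hX : plmp_with_jumps Vs nu sigma_s K P X V J U.

Let mJ n := plmp_measurable_times hX n.
Let mU n := plmp_measurable_velocities hX n.

Lemma jump_times_le (k n : nat) w : (k <= n)%N -> (J k w <= J n w)%E.
Proof.
exact: (homo_leq (@lexx _ _) (@le_trans _ _) (plmp_times_ndecr hX ^~ w)).
Qed.

Lemma jump_times_ge0 n w : (0 <= J n w)%E.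
Proof. by rewrite -(plmp_time0 hX w) jump_times_le. Qed.

Lemma position_eq n w (t : R) : 0 <= t -> (t%:E <= J n.+1 w)%E ->
  X t w = X 0 w + \sum_(0 <= k < n.+1) (clip t (J k.+1 w) - clip t (J k w)) *: U k w.
Proof.
elim: n t => [|n IH] t t0 tJ.
  rewrite big_nat1 (plmp_time0 hX) (clip_le tJ) clip_ge ?lee_fin//=.
  have := plmp_position hX (n := 0%N) (w := w) (t := t).
  by rewrite (plmp_time0 hX) lee_fin t0 tJ/= => /(_ isT) ->.
rewrite big_nat_recr//= addrA; have [tJn|Jnt] := leP t%:E (J n.+1 w).
  by rewrite -IH// !clip_le// subrr scale0r addr0.
have Jfin : J n.+1 w \is a fin_num.
  by rewrite ge0_fin_numE ?jump_times_ge0// (lt_trans Jnt)// ltry.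
have := plmp_position hX (n := n.+1) (w := w) (t := t).
rewrite (ltW Jnt) tJ/= => /(_ isT) ->.
rewrite [clip t (J n.+2 w)]clip_le// [clip t (J n.+1 w)]clip_ge ?ltW//; congr (_ + _).
rewrite IH ?fine_ge0 ?jump_times_ge0 ?fineK//; congr (_ + _).
apply: eq_big_nat => k /andP[_ kn].
(* The induction hypothesis is used at the time of the last jump, where earlier jump times are cut
   off to the same values as at [t]. *)
have Jk l : (l <= n.+1)%N -> clip (fine (J n.+1 w)) (J l w) = clip t (J l w).
  move=> ln; rewrite !clip_ge ?fineK ?jump_times_le//.
  by rewrite (le_trans (jump_times_le w ln))// ltW.
by rewrite !Jk// ltnW.
Qed.

Local Notation hist n := (plmp_history X J U n).

Lemma hist_timeE n w k : (k <= n)%N -> hist_time (hist n w) k = J k w.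
Proof. by move=> kn; rewrite /hist_time kn tnth_mktuple inordK. Qed.

Lemma hist_velocityE n w k : (k <= n)%N -> hist_velocity (hist n w) k = U k w.
Proof. by move=> kn; rewrite /hist_velocity tnth_mktuple inordK. Qed.

Lemma hist_positionE n w (t : R) : 0 <= t -> (t%:E <= J n.+1 w)%E ->
  hist_position (hist n w) t = X t w.
Proof.
move=> t0 tJ; rewrite (position_eq t0 tJ) /hist_position; congr (_ + _).
rewrite !big_nat_recr//=; congr (_ + _).
  apply: eq_big_nat => k /andP[_ kn].
  by rewrite !hist_timeE ?hist_velocityE// ltnW.
rewrite hist_velocityE// [hist_time _ n]hist_timeE//.
(* The history ends with +oo in place of [J n.+1 w]; both are cut off to [t]. *)
by rewrite /hist_time ltnn/= (clip_le (leey _)) (clip_le tJ).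
Qed.

Lemma measurable_history n : measurable_fun setT (hist n).
Proof.
apply: measurable_fun_pair; first exact: (plmp_measurable_init hX).
apply/measurable_fun_tnthP => i.
rewrite [X in measurable_fun _ X](_ : _ = (fun w => (J i w, U i w))).
  by apply: measurable_fun_pair; [exact: mJ|exact: mU].
by apply/funext => w; rewrite /= tnth_mktuple.
Qed.

Definition between_jumps (t : R) (n : nat) : set W :=
  [set w | (J n w <= t%:E)%E && (t%:E < J n.+1 w)%E].

Lemma measurable_between_jumps t n : measurable (between_jumps t n).
Proof.
rewrite (_ : between_jumps t n = [set w | (J n w <= t%:E)%E] `&` [set w | (t%:E < J n.+1 w)%E]).
  apply: measurableI; rewrite -[X in measurable X]setTI.
    exact: emeasurable_fun_infty_c.
  exact: emeasurable_fun_o_infty.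
by apply/seteqP; split => w /andP.
Qed.

Lemma between_jumps_cover (t : R) : 0 <= t -> \bigcup_n between_jumps t n = setT.
Proof.
move=> t0; apply/seteqP; split => // w _.
(* The least index whose jump is after [t]; it is not 0 since [J 0] is 0. *)
have [n nP nmin] := ex_minnP (plmp_no_explosion hX w t).
case: n nP nmin => [|n] nP nmin.
  by move: nP; rewrite (plmp_time0 hX) lte_fin ltNge t0.
exists n => //; rewrite /between_jumps/= nP andbT leNgt; apply/negP => /nmin.
by rewrite ltnn.
Qed.

Lemma between_jumps_trivIset (t : R) : trivIset setT (between_jumps t).
Proof.
apply/trivIsetP.
have H i j : (i < j)%N -> between_jumps t i `&` between_jumps t j = set0.
  move=> ij; apply/seteqP; split => // w [/andP[_ a] /andP[b _]].
  by have := lt_le_trans a (le_trans (jump_times_le w ij) b); rewrite ltxx.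
by move=> i j _ _; case: ltngtP => // ij _; [|rewrite setIC]; exact: H.
Qed.

Lemma measurable_process (Z : R -> W -> E) (z : nat -> W -> E) (t : R) : 0 <= t ->
  (forall n w, between_jumps t n w -> Z t w = z n w) ->
  (forall n, measurable_fun setT (z n)) -> measurable_fun setT (Z t).
Proof.
move=> t0 Zz mz _ B mB; rewrite setTI.
rewrite (_ : _ @^-1` B = \bigcup_n (between_jumps t n `&` z n @^-1` B)).
  apply: bigcupT_measurable => n; apply: measurableI.
    exact: measurable_between_jumps.
  by rewrite -[X in measurable X]setTI; exact: mz.
apply/seteqP; split => w /=.
  have : setT w by []; rewrite -(between_jumps_cover t0) => -[n _ nw] Bw.
  by exists n => //; split => //=; rewrite -Zz.
by move=> [n _ [nw Bw]]; rewrite (Zz n).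
Qed.

Lemma measurable_plmp_position t : 0 <= t -> measurable_fun setT (X t).
Proof.
move=> t0; apply: (measurable_process (z := fun n w => hist_position (hist n w) t)) => //.
  by move=> n w /andP[_ tJ]; rewrite hist_positionE// ltW.
by move=> n; apply: measurable_hist_position => //; exact: measurable_history.
Qed.

Lemma measurable_plmp_velocity t : 0 <= t -> measurable_fun setT (V t).
Proof.
move=> t0; apply: (measurable_process (z := U)) => //.
by move=> n w nw; exact: (plmp_velocity hX nw).
Qed.

Lemma plmp_stopped_continuous w : stopped_continuous (X ^~ w).
Proof.
move=> t; pose s := Num.max 0 t; have s0 : 0 <= s by rewrite le_max lexx.
(* The margin 1 lets the single formula [f], which involves finitely many jumps, describe the
   trajectory in a whole neighbourhood. *)
have [n nP] := plmp_no_explosion hX w (s + 1).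
have nP' : ((s + 1)%:E < J n.+1 w)%E by exact: lt_le_trans (plmp_times_ndecr hX n w).
pose f (r : R) := X 0 w + \sum_(0 <= k < n.+1) (clip r (J k.+1 w) - clip r (J k w)) *: U k w.
have fE r : 0 <= r -> r <= s + 1 -> X r w = f r.
  move=> r0 rs; apply: position_eq => //.
  by rewrite (le_trans _ (ltW nP'))// lee_fin.
have cf : continuous f.
  move=> r; apply: cvgD; first exact: cvg_cst.
  elim: (index_iota 0 n.+1) => [|k l IH].
    by under eq_fun do rewrite big_nil; rewrite big_nil; exact: cvg_cst.
  under eq_fun do rewrite big_cons; rewrite big_cons; apply: cvgD; last exact: IH.
  apply: cvgZr_tmp.
  by apply: cvgB; apply: continuous_clip; exact: jump_times_ge0.
have cm : continuous (fun r : R => Num.max 0 r).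
  by move=> r; apply: continuous_max; [exact: cvg_cst|exact: cvg_id].
have H : f (Num.max 0 r) @[r --> t] --> f s.
  by apply: continuous_cvg; [exact: cf|exact: cm].
rewrite /continuous_at -/s fE ?lerDl//.
apply: cvg_trans H; apply: near_eq_cvg; near=> r.
rewrite fE ?le_max ?lexx//.
have : `|t - r| < 1 by near: r; exact: cvgr_dist_lt.
rewrite ltr_norml => /andP[a b]; rewrite ge_max; apply/andP; split.
  by rewrite addr_ge0.
have : t <= s by rewrite le_max lexx orbT.
by lra.
Unshelve. all: by end_near. Qed.

End plmp_paths.

(** * Induction over the jumps *)

Section plmp_uniqueness.
Local Open Scope ereal_scope.
Context {R : realType} {d : nat}.
Local Notation E := 'rV[R]_d.
Local Notation path := (g_sigma_algebraType (@position_generators R d)).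
Variables (Vs : set E) (nu : {sigma_finite_measure set E -> \bar R}).
Variables (sigma_s : E -> E -> R) (K : E -> E -> E -> R).
Hypothesis hcoeff : plmp_coefficients Vs nu sigma_s K.

Let mVs : measurable Vs. Proof. exact: velocities_measurable hcoeff. Qed.

(** The coefficients are measurable and nonnegative for velocities in [Vs] only; extension by 0
    makes them so everywhere. *)
Let rate : E * E -> R := (fun z => sigma_s z.1 z.2) \_ (setT `*` Vs).

Let measurable_rate : measurable_fun setT rate.
Proof.
apply/(measurable_restrictT _ (measurableX measurableT mVs)).
exact: rate_measurable hcoeff.
Qed.

Let rate_ge0 z : (0 <= rate z)%R.
Proof. by rewrite /rate patchE; case: ifPn => // /set_mem[_ /=]; exact: rate_ge0 hcoeff _ _. Qed.

Let rateE x v : Vs v -> rate (x, v) = sigma_s x v.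
Proof. by move=> v_; rewrite /rate patchE mem_set. Qed.

Let jump : E * E * E -> R := (fun z => K z.1.1 z.1.2 z.2) \_ (Vs `*` Vs `*` setT).

Let measurable_jump : measurable_fun setT jump.
Proof.
apply/(measurable_restrictT _ (measurableX (measurableX mVs mVs) measurableT)).
exact: kernel_measurable hcoeff.
Qed.

Let jump_ge0 z : (0 <= jump z)%R.
Proof.
rewrite /jump patchE; case: ifPn => // /set_mem[[/= a b] _]; exact: (kernel_ge0 hcoeff).
Qed.

Let jumpE v v' x : Vs v -> Vs v' -> jump (v, v', x) = K v v' x.
Proof. by move=> v_ v'_; rewrite /jump patchE mem_set. Qed.

Let jump_position n (h : history n) : E := hist_position h (fine (hist_time h n)).

Let measurable_jump_position n :
  measurable_fun [set: E * n.+1.-tuple (\bar R * E)] (@jump_position n).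
Proof.
apply: measurable_hist_position; first exact: measurable_id.
apply: (measurableT_comp (@fine_measurable _ setT measurableT)).
exact: measurable_hist_time.
Qed.

(** The conditional law of the waiting time written in terms of the history alone, hence the same
    function for all processes with these coefficients. *)
Let survival n (t : R) (h : history n) : \bar R :=
  (expN (\int[lebesgue_measure]_(s in `[0%R, t])
    (rate (jump_position h + s *: hist_velocity h n, hist_velocity h n)%R)%:E))%:E.

Let measurable_survival n t :
  measurable_fun [set: E * n.+1.-tuple (\bar R * E)] (@survival n t).
Proof.
apply/measurable_EFinP; apply: (measurableT_comp measurable_expN).
under eq_fun do rewrite integral_mkcond.
pose f (z : (E * n.+1.-tuple (\bar R * E)) * R) : \bar R :=
  (rate (jump_position z.1 + z.2 *: hist_velocity z.1 n, hist_velocity z.1 n)%R *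
   \1_(`[0%R, t]%classic : set R) z.2)%:E.
have mhv : measurable_fun setT
    (fun z : (E * n.+1.-tuple (\bar R * E)) * R => hist_velocity z.1 n).
  exact: (measurableT_comp (@measurable_hist_velocity _ _ n n) measurable_fst).
have mf : measurable_fun setT f.
  apply/measurable_EFinP; apply: measurable_funM; last first.
    apply: (measurableT_comp (f := \1_(`[0%R, t]%classic : set R) : R -> R)).
      by apply: measurable_indic; exact: measurable_itv.
    exact: measurable_snd.
  apply: (measurableT_comp measurable_rate); apply: measurable_fun_pair => //.
  apply: measurable_fun_addrV.
    exact: (measurableT_comp (@measurable_jump_position n) measurable_fst).
  by apply: measurable_fun_scalerV => //; exact: measurable_snd.
have f0 z : 0 <= f z by rewrite lee_fin mulr_ge0.
have := @measurable_fun_fubini_tonelli_F _ _ _ _ _ (@lebesgue_measure R) f mf f0.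
congr (measurable_fun _ _); apply/funext => h; rewrite /fubini_F.
by apply: eq_integral => s _; rewrite epatch_indic.
Qed.

Let new_velocity n (C : set E) (z : history n * \bar R) : \bar R :=
  \int[nu]_(v in Vs `&` C)
    (jump (hist_velocity z.1 n, v, hist_position z.1 (fine z.2)))%:E.

Let measurable_new_velocity n C : measurable C ->
  measurable_fun [set: (E * n.+1.-tuple (\bar R * E)) * \bar R] (@new_velocity n C).
Proof.
move=> mC; rewrite /new_velocity; under eq_fun do rewrite integral_mkcond.
pose f (z : ((E * n.+1.-tuple (\bar R * E)) * \bar R) * E) : \bar R :=
  (jump (hist_velocity z.1.1 n, z.2, hist_position z.1.1 (fine z.1.2)) *
   \1_(Vs `&` C) z.2)%:E.
have m11 : measurable_fun setT
    (fun z : ((E * n.+1.-tuple (\bar R * E)) * \bar R) * E => z.1.1).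
  exact: (measurableT_comp measurable_fst measurable_fst).
have mf : measurable_fun setT f.
  apply/measurable_EFinP; apply: measurable_funM; last first.
    apply: (measurableT_comp (f := \1_(Vs `&` C) : E -> R)).
      by apply: measurable_indic; exact: measurableI.
    exact: measurable_snd.
  apply: (measurableT_comp measurable_jump); apply: measurable_fun_pair.
    apply: measurable_fun_pair; last exact: measurable_snd.
    exact: (measurableT_comp (@measurable_hist_velocity _ _ n n) m11).
  apply: measurable_hist_position => //.
  apply: (measurableT_comp (@fine_measurable _ setT measurableT)).
  exact: (measurableT_comp measurable_snd measurable_fst).
have f0 z : 0 <= f z by rewrite lee_fin mulr_ge0.
have := @measurable_fun_fubini_tonelli_F _ _ _ _ _ nu f mf f0.
congr (measurable_fun _ _); apply/funext => h; rewrite /fubini_F.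
by apply: eq_integral => s _; rewrite epatch_indic.
Qed.

Section one_process.
Context {dW} {W : measurableType dW} (P : probability W R).
Variables (X V : R -> W -> E) (J : nat -> W -> \bar R) (U : nat -> W -> E).
Hypothesis hX : plmp_with_jumps Vs nu sigma_s K P X V J U.
Local Notation hist n := (plmp_history X J U n).

Definition jumped (n : nat) : set W := [set w | J n w < +oo].

Lemma measurable_jumped n : measurable (jumped n).
Proof.
rewrite -[X in measurable X]setTI; apply: emeasurable_fun_infty_o => //.
exact: (plmp_measurable_times hX).
Qed.

Let fin_jumped n w : jumped n w -> J n w \is a fin_num.
Proof. by move=> Jn; rewrite ge0_fin_numE// (jump_times_ge0 hX). Qed.

Lemma jump_time_law n (t : R) (B : set (E * n.+1.-tuple (\bar R * E))) :
  (0 <= t)%R -> measurable B ->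
  P (hist n @^-1` B `&` jumped n `&` [set w | J n w + t%:E < J n.+1 w]) =
  \int[P]_(w in hist n @^-1` B `&` jumped n) survival t (hist n w).
Proof.
move=> t0 mB; rewrite (plmp_jump_time hX t0 mB).
apply: eq_integral => w /set_mem[_ Jn]; have Jfin := fin_jumped Jn.
have -> : survival t (hist n w) = expeR (- \int[lebesgue_measure]_(s in `[0%R, t])
    (rate (jump_position (hist n w) + s *: hist_velocity (hist n w) n,
           hist_velocity (hist n w) n)%R)%:E).
  rewrite /survival; set I := \int[_]_(s in _) _.
  have : 0 <= I by apply: integral_ge0 => s _; rewrite lee_fin.
  by case: I => // _; rewrite expNy.
congr (expeR (- _)); apply: eq_integral => s _.
rewrite hist_velocityE// rateE; last exact: (plmp_velocities hX).
rewrite /jump_position hist_timeE// (hist_positionE hX)//.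
  by rewrite fine_ge0// (jump_times_ge0 hX).
by rewrite fineK// (plmp_times_ndecr hX).
Qed.

Lemma jump_velocity_law n (C : set E) (B : set ((E * n.+1.-tuple (\bar R * E)) * \bar R)) :
  measurable C -> measurable B ->
  P ((fun w => (hist n w, J n.+1 w)) @^-1` B `&` jumped n.+1 `&` U n.+1 @^-1` C) =
  \int[P]_(w in (fun w => (hist n w, J n.+1 w)) @^-1` B `&` jumped n.+1)
    new_velocity C (hist n w, J n.+1 w).
Proof.
move=> mC mB; rewrite (plmp_jump_velocity hX mC mB).
apply: eq_integral => w /set_mem[_ Jn]; have Jfin := fin_jumped Jn.
apply: eq_integral => v /set_mem[Vsv _] /=.
rewrite hist_velocityE// jumpE//; last exact: (plmp_velocities hX).
rewrite (hist_positionE hX)//.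
  by rewrite fine_ge0// (jump_times_ge0 hX).
by rewrite fineK.
Qed.

(** The equality needs [J 1] to be positive, which has probability 1: survival at [t = 0] is 1. *)
Lemma initial_velocity_ae : {ae P, forall w, V 0%R w = U 0%N w}.
Proof.
have mset : measurable [set w | J 0%N w + 0%:E < J 1%N w].
  have := emeasurable_fun_o_infty measurableT (plmp_measurable_times hX 1%N) 0.
  rewrite setTI (_ : [set w | 0 < J 1%N w] = [set w | J 0%N w + 0%:E < J 1%N w])//.
  by apply/seteqP; split => w /=; rewrite (plmp_time0 hX) adde0.
have : {ae P, forall w, J 0%N w + 0%:E < J 1%N w}.
  apply: (probability1_ae mset).
  have := @jump_time_law 0 0 setT (lexx _) measurableT.
  rewrite preimage_setT setTI (_ : jumped 0 = setT); last first.
    by apply/seteqP; split => // w _; rewrite /jumped/= (plmp_time0 hX) ltry.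
  rewrite setTI => ->.
  under eq_integral do rewrite /survival set_itv1 integral_set1 expN_EFin oppr0 expR0.
  rewrite integral_cst// mul1e; exact: probability_setT.
apply: filterS => w; rewrite (plmp_time0 hX) adde0 => J1.
by apply: (plmp_velocity hX (n := 0%N)); rewrite (plmp_time0 hX) lexx.
Qed.

Lemma measurable_position_path : measurable_fun setT (fun w => X ^~ w : path).
Proof.
apply: (@measurability _ _ W path setT _ (@position_generators R d) erefl).
move=> _ [_ [t [B [t0 mB ->]] <-]].
exact: (measurable_plmp_position hX t0).
Qed.

End one_process.

Section two_processes.
Context {dW dW1 : measure_display} {W : measurableType dW} {W1 : measurableType dW1}
  (P : probability W R) (P1 : probability W1 R).
Variables (X V : R -> W -> E) (J : nat -> W -> \bar R) (U : nat -> W -> E).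
Variables (X1 V1 : R -> W1 -> E) (J1 : nat -> W1 -> \bar R) (U1 : nat -> W1 -> E).
Hypothesis hX : plmp_with_jumps Vs nu sigma_s K P X V J U.
Hypothesis hX1 : plmp_with_jumps Vs nu sigma_s K P1 X1 V1 J1 U1.
Hypothesis init : forall C : set (E * E), measurable C ->
  P [set w | C (X 0%R w, V 0%R w)] = P1 [set w | C (X1 0%R w, V1 0%R w)].

Local Notation hist := (plmp_history X J U).
Local Notation hist1 := (plmp_history X1 J1 U1).
Local Notation G := (jumped J).
Local Notation G1 := (jumped J1).

Let mh n : measurable_fun setT (hist n).
Proof. exact: (measurable_history hX). Qed.
Let mh1 n : measurable_fun setT (hist1 n).
Proof. exact: (measurable_history hX1). Qed.
Let mJ n : measurable_fun setT (J n).
Proof. exact: (plmp_measurable_times hX). Qed.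
Let mJ1 n : measurable_fun setT (J1 n).
Proof. exact: (plmp_measurable_times hX1). Qed.
Let mU n : measurable_fun setT (U n).
Proof. exact: (plmp_measurable_velocities hX). Qed.
Let mU1 n : measurable_fun setT (U1 n).
Proof. exact: (plmp_measurable_velocities hX1). Qed.
Let mG n : measurable (G n).
Proof. exact: (measurable_jumped hX). Qed.
Let mG1 n : measurable (G1 n).
Proof. exact: (measurable_jumped hX1). Qed.

Lemma same_law_initial : same_law_on P P1 (hist 0) (G 0) (hist1 0) (G1 0).
Proof.
move=> B mB.
have mt : measurable_fun setT (fun z : E * E => (z.1, [tuple (0 : \bar R, z.2) | i < 1])).
  apply: measurable_fun_pair; first exact: measurable_fst.
  apply/measurable_fun_tnthP => i.
  rewrite [X in measurable_fun _ X](_ : _ = (fun z => (0, z.2))); last first.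
    by apply/funext => z; rewrite /= tnth_mktuple.
  by apply: measurable_fun_pair => //; exact: measurable_snd.
have key dd (T : measurableType dd) (Q : probability T R) (Y Z : R -> T -> E) (j : nat -> T -> \bar R)
    (u : nat -> T -> E) (hY : plmp_with_jumps Vs nu sigma_s K Q Y Z j u) :
    Q (plmp_history Y j u 0 @^-1` B `&` jumped j 0) =
    Q [set w | B (Y 0%R w, [tuple (0, Z 0%R w) | i < 1])].
  apply: ae_eq_probability.
  - apply: measurableI; last exact: (measurable_jumped hY).
    by rewrite -[X in measurable X]setTI; exact: (measurable_history hY).
  - have m0 := measurable_fun_pair (measurable_plmp_position hY (lexx 0%R))
      (measurable_plmp_velocity hY (lexx 0%R)).
    by have := measurableT_comp mt m0 measurableT mB; rewrite setTI.
  apply: filterS (initial_velocity_ae hY) => w VU.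
  have hE : plmp_history Y j u 0 w = (Y 0%R w, [tuple (0, Z 0%R w) | i < 1]).
    congr pair; apply: eq_from_tnth => i; rewrite !tnth_mktuple (ord1 i) VU.
    by rewrite (plmp_time0 hY).
  split => [[/= Bw _]|h]; first by rewrite -hE.
  by split; [rewrite /= hE|rewrite /jumped/= (plmp_time0 hY) ltry].
rewrite (key _ _ _ _ _ _ _ hX) (key _ _ _ _ _ _ _ hX1).
have mB' : measurable ((fun z : E * E => (z.1, [tuple (0 : \bar R, z.2) | i < 1])) @^-1` B).
  by rewrite -[X in measurable X]setTI; exact: mt.
exact: (init mB').
Qed.

Lemma same_law_jump_time n : same_law_on P P1 (hist n) (G n) (hist1 n) (G1 n) ->
  same_law_on P P1 (fun w => (hist n w, J n.+1 w)) (G n)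
    (fun w => (hist1 n w, J1 n.+1 w)) (G1 n).
Proof.
move=> L.
(* The conditional law is known for the waiting time [J n.+1 - J n]. *)
pose C : set (set (\bar R)) := [set A | A = setT \/ ErealGenOInfty.G A].
have mZ : measurable_fun setT (fun w => J n.+1 w - J n w).
  by apply: emeasurable_funB; exact: mJ.
have mZ1 : measurable_fun setT (fun w => J1 n.+1 w - J1 n w).
  by apply: emeasurable_funB; exact: mJ1.
have LZ : same_law_on P P1 (fun w => (hist n w, J n.+1 w - J n w)) (G n)
    (fun w => (hist1 n w, J1 n.+1 w - J1 n w)) (G1 n).
  apply: (same_law_on_pair (C := C) (@mh n) (@mh1 n) (mG n) (mG1 n) mZ mZ1).
  - move=> A B [->|[r ->]]; first by rewrite setTI.
    move=> [->|[s ->]]; first by rewrite setIT; right; exists r.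
    right; exists (Num.max r s); apply/seteqP; split => x /=; rewrite !in_itv/= !andbT.
      by move=> [a b]; rewrite EFin_max gt_max a.
    by rewrite EFin_max gt_max => /andP[].
  - by left.
  - apply/seteqP; split.
      rewrite [X in X `<=` _](ErealGenOInfty.measurableE R).
      by apply: sub_smallest2r; [exact: smallest_sigma_algebra|move=> A GA; right].
    apply: smallest_sub; first exact: sigma_algebra_measurable.
    by move=> A [->//|[r ->]]; exact: emeasurable_itv.
  - move=> A B mA CB.
    (* For [B] a half-line starting at r >= 0 the survival function gives the value; otherwise [B]
       is [setT] or starts below 0, and contains every waiting time. *)
    have key dd (T : measurableType dd) (Q : probability T R) (Y Z : R -> T -> E) (j : nat -> T -> \bar R)
        (u : nat -> T -> E) (hY : plmp_with_jumps Vs nu sigma_s K Q Y Z j u) :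
        Q (plmp_history Y j u n @^-1` A `&` jumped j n `&` (fun w => j n.+1 w - j n w) @^-1` B) =
        if pselect (exists2 r : R, (0 <= r)%R & B = `]r%:E, +oo[%classic) is left e
        then \int[Q]_(w in plmp_history Y j u n @^-1` A `&` jumped j n)
          survival (projT1 (cid2 e)) (plmp_history Y j u n w)
        else Q (plmp_history Y j u n @^-1` A `&` jumped j n).
      have jfin w : jumped j n w -> j n w \is a fin_num.
        by move=> jn; rewrite ge0_fin_numE// (jump_times_ge0 hY).
      case: pselect => [e|ne].
        case: cid2 => r /= r0 BE; rewrite -(jump_time_law hY r0 mA); congr (Q _).
        apply/seteqP; split => w [[Aw jn] /=]; rewrite BE/= in_itv/= andbT.
          by rewrite lteBrDl ?jfin// => h.
        by move=> h; split => //; rewrite lteBrDl ?jfin.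
      congr (Q _); apply/seteqP; split => [w []//|w [Aw jn]]; split => //=.
      case: CB => [->//|[r BE]]; rewrite BE/= in_itv/= andbT.
      have r0 : (r < 0)%R by rewrite ltNge; apply/negP => r0; apply: ne; exists r.
      rewrite lteBrDl ?jfin//; apply: lt_le_trans (plmp_times_ndecr hY n w).
      by rewrite gteDl// ?jfin// lte_fin.
    rewrite (key _ _ _ _ _ _ _ hX) (key _ _ _ _ _ _ _ hX1).
    case: pselect => [e|ne]; last exact: L.
    apply: (same_law_on_integral (@mh n) (@mh1 n) (mG n) (mG1 n) L mA).
      exact: measurable_survival.
    by move=> h; rewrite lee_fin expN_ge0.
(* The jump time is recovered by adding back [J n], which is finite on the event considered. *)
pose Phi (z : (E * n.+1.-tuple (\bar R * E)) * \bar R) :=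
  (z.1, @hist_time R d n z.1 n + z.2).
have mPhi : measurable_fun setT Phi.
  apply: measurable_fun_pair; first exact: measurable_fst.
  apply: emeasurable_funD; last exact: measurable_snd.
  exact: (measurableT_comp (@measurable_hist_time _ _ n n) measurable_fst).
apply: (same_law_on_eq (same_law_on_comp LZ mPhi)) => w Jn /=.
  rewrite /Phi/= hist_timeE// addeC subeK// ge0_fin_numE//.
  exact: (jump_times_ge0 hX).
rewrite /Phi/= hist_timeE// addeC subeK// ge0_fin_numE//.
exact: (jump_times_ge0 hX1).
Qed.

Lemma same_law_jump_velocity n :
  same_law_on P P1 (fun w => (hist n w, J n.+1 w)) (G n)
    (fun w => (hist1 n w, J1 n.+1 w)) (G1 n) ->
  same_law_on P P1 (hist n.+1) (G n.+1) (hist1 n.+1) (G1 n.+1).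
Proof.
move=> L.
have mhJ : measurable_fun setT (fun w => (hist n w, J n.+1 w)) by apply: measurable_fun_pair; [exact: mh|exact: mJ].
have mhJ1 : measurable_fun setT (fun w => (hist1 n w, J1 n.+1 w)).
  by apply: measurable_fun_pair; [exact: mh1|exact: mJ1].
(* As jump times are nondecreasing, the event of a further jump is a condition on [J n.+1] inside
   the previous event. *)
have L' : same_law_on P P1 (fun w => (hist n w, J n.+1 w)) (G n.+1)
    (fun w => (hist1 n w, J1 n.+1 w)) (G1 n.+1).
  have mC : measurable [set z : (E * n.+1.-tuple (\bar R * E)) * \bar R | z.2 < +oo].
    rewrite -[X in measurable X]setTI.
    by apply: (emeasurable_fun_infty_o (f := snd)) => //; exact: measurable_snd.
  have := same_law_on_sub L mC.
  rewrite (_ : _ `&` G n = G n.+1); last first.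
    apply/seteqP; split => [w []//|w Jn]; split => //.
    exact: le_lt_trans (plmp_times_ndecr hX n w) Jn.
  rewrite (_ : _ `&` G1 n = G1 n.+1)//.
  apply/seteqP; split => [w []//|w Jn]; split => //.
  exact: le_lt_trans (plmp_times_ndecr hX1 n w) Jn.
have LU : same_law_on P P1 (fun w => ((hist n w, J n.+1 w), U n.+1 w)) (G n.+1)
    (fun w => ((hist1 n w, J1 n.+1 w), U1 n.+1 w)) (G1 n.+1).
  apply: (same_law_on_pair (C := measurable) mhJ mhJ1 (mG n.+1) (mG1 n.+1) (@mU n.+1) (@mU1 n.+1)).
  - exact: measurableI.
  - exact: measurableT.
  - by rewrite sigma_algebra_id//; exact: sigma_algebra_measurable.
  - move=> A B mA mB; rewrite (jump_velocity_law hX mB mA) (jump_velocity_law hX1 mB mA).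
    apply: (same_law_on_integral mhJ mhJ1 (mG n.+1) (mG1 n.+1) L' mA).
      exact: measurable_new_velocity.
    by move=> z; apply: integral_ge0 => v _; rewrite lee_fin.
(* Appends the new jump time and velocity to the history. *)
pose Psi (z : ((E * n.+1.-tuple (\bar R * E)) * \bar R) * E) : E * n.+2.-tuple (\bar R * E) :=
  (z.1.1.1, [tuple (if (i < n.+1)%N then tnth z.1.1.2 (inord i) else (z.1.2, z.2)) | i < n.+2]).
have m1 : measurable_fun setT (fun z : ((E * n.+1.-tuple (\bar R * E)) * \bar R) * E => z.1.1).
  exact: (measurableT_comp measurable_fst measurable_fst).
have mPsi : measurable_fun setT Psi.
  apply: measurable_fun_pair; first exact: (measurableT_comp measurable_fst m1).
  apply/measurable_fun_tnthP => i.
  rewrite [X in measurable_fun _ X](_ : _ = (fun z =>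
    if (i < n.+1)%N then tnth z.1.1.2 (inord i) else (z.1.2, z.2))); last first.
    by apply/funext => z; rewrite /= tnth_mktuple.
  case: (i < n.+1)%N.
    apply: (measurableT_comp (measurable_tnth _)).
    exact: (measurableT_comp measurable_snd m1).
  apply: measurable_fun_pair; last exact: measurable_snd.
  exact: (measurableT_comp measurable_snd measurable_fst).
have PsiE dd (T : measurableType dd) (x : R -> T -> E) (j : nat -> T -> \bar R) (u : nat -> T -> E) w :
    Psi ((plmp_history x j u n w, j n.+1 w), u n.+1 w) = plmp_history x j u n.+1 w.
  congr pair; apply: eq_from_tnth => i; rewrite !tnth_mktuple/=.
  case: ifPn => [ni|]; first by rewrite inordK.
  by rewrite -leqNgt => ni; have -> : i = n.+1 :> nat by apply/eqP; rewrite eqn_leq ni -ltnS ltn_ord.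
by apply: (same_law_on_eq (same_law_on_comp LU mPsi)) => w _ /=; rewrite PsiE.
Qed.

Lemma same_law_history n : same_law_on P P1 (fun w => (hist n w, J n.+1 w)) (G n)
    (fun w => (hist1 n w, J1 n.+1 w)) (G1 n).
Proof.
apply: same_law_jump_time; elim: n => [|n IH]; first exact: same_law_initial.
by apply: same_law_jump_velocity; exact: same_law_jump_time.
Qed.

Lemma position_path_law (A : set path) : measurable A ->
  P [set w | A (X ^~ w)] = P1 [set w | A (X1 ^~ w)].
Proof.
(* The pi-system of the events that depend on a bounded time interval. *)
pose C : set (set path) := [set A | measurable A /\ exists2 T : R, (0 <= T)%R &
  forall p q : path, (forall t, 0 <= t <= T -> p t = q t)%R -> A p -> A q].
pose m := measure_function_pushforward__canonical__measure_function_Measure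
  P (measurable_position_path hX).
pose m1 := measure_function_pushforward__canonical__measure_function_Measure
  P1 (measurable_position_path hX1).
move=> mA; rewrite -[LHS]/(m A) -[RHS]/(m1 A).
apply: (measure_unique C (fun=> setT)) => //.
- apply/seteqP; split.
    apply: sub_smallest2r; first exact: smallest_sigma_algebra.
    move=> _ [t [B [t0 mB ->]]]; split.
      by apply: sub_sigma_algebra; exists t, B.
    by exists t => // p q pq /=; rewrite pq// t0 lexx.
  apply: smallest_sub; first exact: sigma_algebra_measurable.
  by move=> B [].
- move=> B B' [mB [T T0 BT]] [mB' [T' T'0 BT']]; split; first exact: measurableI.
  exists (Num.max T T'); first by rewrite le_max T0.
  move=> p q pq [Bp B'p]; split; [apply: BT Bp|apply: BT' B'p] => t /andP[t0 tT];
    by apply: pq; rewrite t0 le_max tT ?orbT.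
- by move=> _; split => //; exists 0%R.
- by apply/seteqP; split => // p _; exists 0%N.
- move=> B [mB [T T0 BT]].
  (* As [B] depends on the path up to [T] only, the path may be replaced by [hist_position], which
     agrees with it until the next jump, after [T]. *)
  pose D n : set ((E * n.+1.-tuple (\bar R * E)) * \bar R) :=
    [set z | [/\ B (@hist_position R d n z.1), @hist_time R d n z.1 n <= T%:E & T%:E < z.2]].
  have mD n : measurable (D n).
    have mpos : measurable_fun setT
        (fun z : (E * n.+1.-tuple (\bar R * E)) * \bar R => @hist_position R d n z.1 : path).
      apply: (@measurability _ _ _ path setT _ (@position_generators R d) erefl).
      move=> _ [_ [t [F [t0 mF ->]] <-]].
      by apply: (measurable_hist_position (t := fun=> t)) => //; exact: measurable_fst.
    rewrite (_ : D n = (fun z : (E * n.+1.-tuple (\bar R * E)) * \bar R => @hist_position R d n z.1) @^-1` B `&`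
      ([set z | @hist_time R d n z.1 n <= T%:E] `&` [set z | T%:E < z.2])); last first.
      by apply/seteqP; split => [z []|z [? []]].
    apply: measurableI; first by have := mpos measurableT _ mB; rewrite setTI.
    apply: measurableI; rewrite -[X in measurable X]setTI.
      apply: emeasurable_fun_infty_c => //.
      exact: (measurableT_comp (@measurable_hist_time _ _ n n) measurable_fst).
    by apply: emeasurable_fun_o_infty => //; exact: measurable_snd.
  have key dd (S : measurableType dd) (Q : probability S R) (Y Z : R -> S -> E) (j : nat -> S -> \bar R)
      (u : nat -> S -> E) (hY : plmp_with_jumps Vs nu sigma_s K Q Y Z j u) :
      Q [set w | B (Y ^~ w)] =
      \sum_(n <oo) Q ((fun w => (plmp_history Y j u n w, j n.+1 w)) @^-1` D n `&` jumped j n).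
    have E1 n : [set w | B (Y ^~ w)] `&` between_jumps j T n =
        (fun w => (plmp_history Y j u n w, j n.+1 w)) @^-1` D n `&` jumped j n.
      apply/seteqP; split => w.
        move=> [/= Bw /andP[jT Tj]]; split; last exact: le_lt_trans jT (ltry _).
        split => //=; last by rewrite hist_timeE.
        apply: BT Bw => t /andP[t0 tT]; rewrite (hist_positionE hY)//.
        by rewrite (le_trans _ (ltW Tj))// lee_fin.
      move=> [[/= Bw jT Tj] _]; rewrite hist_timeE// in jT; split; last by apply/andP.
      apply: BT Bw => t /andP[t0 tT]; rewrite (hist_positionE hY)//.
      by rewrite (le_trans _ (ltW Tj))// lee_fin.
    have mB1 : measurable [set w | B (Y ^~ w)].
      by have := measurable_position_path hY measurableT mB; rewrite setTI.
    rewrite -[X in Q X]setIT -(between_jumps_cover hY T0) setI_bigcupr.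
    rewrite measure_bigcup//=.
    + by rewrite eseries_mkcond; apply: eq_eseriesr => n _; rewrite in_setT E1.
    + by move=> n _; apply: measurableI => //; exact: (measurable_between_jumps hY).
    + apply/trivIsetP => i k _ _ ik; rewrite setIACA setIid.
      have /trivIsetP tB : trivIset setT (between_jumps j T).
        exact: (between_jumps_trivIset hY).
      by rewrite tB// setI0.
  rewrite [LHS](key _ _ _ _ _ _ _ hX) [RHS](key _ _ _ _ _ _ _ hX1).
  by apply: eq_eseriesr => n _; exact: (same_law_history (mD n)).
- by move=> _; exact: le_lt_trans (probability_le1 P measurableT) (ltry 1).
Qed.

End two_processes.
End plmp_uniqueness.
(** * The exit process *)

Section exit_times.
Context {R : realType} {d : nat}.
Local Notation E := 'rV[R]_d.
Local Open Scope ereal_scope.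

Lemma exit_time_ge (Om : set E) (t0 : R) (x : R -> E) : t0%:E <= exit_time Om t0 x.
Proof. by apply: le_ereal_inf_tmp => _ [t [t0t _] <-]; rewrite lee_fin ltW. Qed.

Lemma exit_time_shift (Om : set E) (t0 : R) (x : R -> E) :
  exit_time Om t0 x = t0%:E + exit_time Om 0 (fun t => x (t0 + t)%R).
Proof.
apply/eqP; rewrite eq_le; apply/andP; split.
  rewrite -leeBlDl//; apply: le_ereal_inf_tmp => _ [t [t_0 Ot] <-].
  rewrite leeBlDl// -EFinD; apply: ereal_inf_lbound; exists (t0 + t)%R => //.
  by split; rewrite // ltrDl.
apply: le_ereal_inf_tmp => _ [t [t0t Ot] <-].
rewrite -leeBrDl// -EFinB; apply: ereal_inf_lbound; exists (t - t0)%R => //.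
by split; rewrite ?subr_gt0// addrC subrK.
Qed.

(** Leaving outside [D] and never leaving both make the mark, hence the displaced point, infinite,
    and the product of indicators 0. *)
Lemma exit_indicator (Om D : set E) (t0 t : R) (x : R -> E) :
  let tau := exit_time Om t0 x in
  (\1_[set s : \bar R | (0 <= s <= t%:E)%E] tau * \1_D (x (fine tau)))%R =
  \1_(EFin @` `[0%R, t]) (t0%:E + exit_mark Om D (fun s => x (t0 + s)%R)) :> R.
Proof.
rewrite /exit_mark /= exit_time_shift.
set y := fun s => x (t0 + s)%R; have := exit_time_ge Om 0 y.
case: (exit_time Om 0 y) => [r r0||//]; last first.
  move=> _; rewrite if_same addey// indicE memNset ?mul0r.
    by rewrite indicE memNset// => -[].
  by rewrite /= leye_eq andbF.
case: asboolP => [Dr|nDr]; last first.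
  rewrite [X in (_ * X)%R]indicE memNset// mulr0 addey// indicE memNset// => -[] //.
rewrite [X in (_ * X)%R]indicE mem_set// mulr1 !indicE; congr ((nat_of_bool _)%:R).
apply/idP/idP => /set_mem h; apply/mem_set.
  by exists (t0 + r)%R => //=; rewrite in_itv/= -!lee_fin.
by case: h => s /=; rewrite in_itv/= -!lee_fin => h <-.
Qed.

Lemma exit_mark_fin_num (Om D : set E) (x : R -> E) :
  exit_mark Om D x \is a fin_num <->
  exit_time Om 0 x < +oo /\ D (x (fine (exit_time Om 0 x))).
Proof.
rewrite /exit_mark /=; have t0 := exit_time_ge Om 0 x.
case: asboolP => [Dx|nDx]; last by split => // -[].
by rewrite ge0_fin_numE//; split => [|[]].
Qed.

(** Marks depend on positions only, whereas independence of the particles is stated for paths of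
    positions and velocities. *)
Lemma path_events_position (B : set (R -> E)) : <<s position_generators >> B ->
  path_events [set p | B (fun t => (p t).1)].
Proof.
pose paths := g_sigma_algebraType [set A : set (R -> E * E) | exists (t : R) (B : set (E * E)),
  [/\ (0 <= t)%R, measurable B & A = [set p | B (p t)]]].
have H : measurable_fun setT
    ((fun p t => (p t).1) : paths -> g_sigma_algebraType (@position_generators R d)).
  apply: (@measurability _ _ _ (g_sigma_algebraType (@position_generators R d)) setT _
    (@position_generators R d) erefl).
  move=> _ [_ [t [C [t0 mC ->]] <-]]; rewrite setTI; apply: sub_sigma_algebra.
  exists t, (fst @^-1` C); split => //.
  by rewrite -[X in measurable X]setTI; exact: measurable_fst.
by move=> mB; have := H measurableT B mB; rewrite setTI.
Qed.

End exit_times.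

Lemma image_probability (R : realType) d d' (W : measurableType d) (S : measurableType d')
    (P : probability W R) (Y : W -> S) : measurable_fun setT Y ->
  exists pi : probability S R, forall C, pi C = P (Y @^-1` C).
Proof.
move=> mY; pose m := measure_function_pushforward__canonical__measure_function_Measure P mY.
have m1 : (m setT = 1)%E by exact: (probability_setT P).
pose pi : probability S R := HB.pack (Measure.sort m)
  (Measure_isProbability.Build _ _ _ (m : set S -> \bar R) m1).
by exists pi.
Qed.

Theorem theorem3p5 (R : realType) (d : nat) (hd : (0 < d)%N)
  (Om : set 'rV[R]_d) (hOm : smooth_bounded_domain Om)
  (J : nat) (D : 'I_J -> set 'rV[R]_d) (hD : detectors Om D)
  (Vs : set 'rV[R]_d) (nu : {sigma_finite_measure set 'rV[R]_d -> \bar R})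
  (sigma_s : 'rV[R]_d -> 'rV[R]_d -> R)
  (K : 'rV[R]_d -> 'rV[R]_d -> 'rV[R]_d -> R)
  (hcoeff : plmp_coefficients Vs nu sigma_s K)
  (hexit : bounded_mean_exit_time Vs nu sigma_s K Om)
  (phi : 'rV[R]_d -> 'rV[R]_d -> R) (hphi : admissible_source Vs nu Om phi)
  (lam : R) (hlam : 0 < lam)
  (dW : measure_display) (W : measurableType dW) (P : probability W R)
  (T : nat -> W -> R) (X V : nat -> R -> W -> 'rV[R]_d)
  (hfountain : stochastic_fountain Vs nu sigma_s K P lam phi T X V)
  (dW1 : measure_display) (W1 : measurableType dW1) (P1 : probability W1 R)
  (X1 V1 : R -> W1 -> 'rV[R]_d)
  (hplmp : plmp Vs nu sigma_s K P1 X1 V1)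
  (hinit : starts_with_density Vs nu P1 phi X1 V1) (j : 'I_J) :
  poisson_process P (lam * fine (exit_probability P1 Om (D j) X1))
    (exit_process Om (D j) T X).
Proof.
have [Phi mPhi PhiE] := measurable_path_functional (domain_open hOm) (detector_measurable hD j).
have [J1 [U1 hX1]] := hplmp.
have mX1 : measurable_fun setT (fun w => Phi (X1 ^~ w)).
  exact: (measurableT_comp mPhi (measurable_position_path hX1)).
(* The common law of the marks is taken from the reference process; uniqueness in law transfers it
   to the particles. *)
have [pi piE] := image_probability P1 mX1.
pose Z n t w := X n (T n w + t) w.
pose M n w := Phi (Z n ^~ w).
have mM n : measurable_fun setT (M n).
  have [Jn [Un hn]] := fountain_plmp hfountain n.
  exact: (measurableT_comp mPhi (measurable_position_path hn)).
have ME n w : M n w = exit_mark Om (D j) (Z n ^~ w).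
  have [Jn [Un hn]] := fountain_plmp hfountain n.
  by rewrite /M PhiE//; exact: (plmp_stopped_continuous hn).
have law n C : measurable C -> P (M n @^-1` C) = pi C.
  move=> mC; rewrite piE; have [Jn [Un hn]] := fountain_plmp hfountain n.
  have mA := mPhi measurableT C mC; rewrite setTI in mA.
  apply: (position_path_law hcoeff hn hX1 _ mA) => B mB.
  by rewrite (hinit _ mB); exact: (fountain_source hfountain n mB).
have indep (N : nat) (A : set W) (C : nat -> set (\bar R)) :
    births_algebra T A -> (forall n, measurable (C n)) ->
    (P (A `&` \bigcap_(n in [set n | (n < N)%N]) (M n @^-1` C n)) =
     P A * \prod_(0 <= n < N) pi (C n))%E.
  (* The event on births takes the index [None], the first [N] marks the indices [Some n]. *)
  move=> bA mC; pose F (o : option nat) := if o is Some n then M n @^-1` C n else A.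
  have := fountain_independent hfountain (s := None :: map Some (iota 0 N)) (A := F).
  rewrite big_cons big_map /index_iota subn0 => H.
  rewrite (eq_bigr (fun n => P (M n @^-1` C n))); last by move=> n _; rewrite law.
  rewrite -H.
  - congr (P _); apply/seteqP; split => [w [Aw MC] [n|] //=|w FC].
      rewrite inE/= (mem_map (@Some_inj _)) mem_iota add0n => nN; exact: MC.
    split; first by apply: (FC None); rewrite /= inE.
    move=> n nN; apply: (FC (Some n)).
    by rewrite /= inE/= (mem_map (@Some_inj _)) mem_iota.
  - rewrite /= (map_inj_uniq (@Some_inj _)) iota_uniq andbT.
    by apply/mapP => -[].
  - move=> [n|] _; last exact: bA.
    exists [set p | (Phi @^-1` C n) (fun t => (p t).1)]; last by rewrite setTI.
    by apply: path_events_position; have := mPhi measurableT _ (mC n); rewrite setTI.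
(* The mark is finite exactly when the particle leaves through [D j]. *)
rewrite (_ : fine (exit_probability _ _ _ _) = fine (pi [set m | m \is a fin_num])); last first.
  rewrite piE; congr (fine (P1 _)); apply/seteqP; split => w /=;
    by rewrite PhiE ?exit_mark_fin_num//; exact: (plmp_stopped_continuous hX1).
rewrite (_ : exit_process _ _ _ _ = fun t => displaced_count T M `[0%R, t]%classic).
  exact: (displaced_poisson_process hlam (fountain_births hfountain) mM indep).
apply/funext => t; apply/funext => w; apply: eq_eseriesr => n _.
by rewrite /= exit_indicator ME.
Qed.
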